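(* (1) Let $m=6$ or $m\ge 12$, and let $F_m(\mathbf x)=a_1P_m(x_1)+\cdots+a_nP_m(x_n)$ be an $m$-gonal form which represents every positive integer up to $m-4$. Then there is $a_{n+1}\in\mathbb N$ for which $$F_m(\mathbf x)+a_{n+1}P_m(x_{n+1})$$ is universal. (2) Let $m\in\{5,7,8,9,10,11\}$, and let $F_m(\mathbf x)=a_1P_m(x_1)+\cdots+a_nP_m(x_n)$ be an $m$-gonal form which represents every positive integer up to $m-4$. Then there are $a_{n+1},a_{n+2}\in\mathbb N$ for which $$F_m(\mathbf x)+a_{n+1}P_m(x_{n+1})+a_{n+2}P_m(x_{n+2})$$ is universal.
   Context: Throughout, $m$ is an integer with $m\ge 3$ and $\mathbb N$ is the set of positive integers. For an integer $x$ (positive, zero or negative), the $x$-th (generalized) $m$-gonal number is $P_m(x)=\frac{m-2}{2}x^2-\frac{m-4}{2}x$. An $m$-gonal form is an expression $F_m(\mathbf x)=a_1P_m(x_1)+\cdots+a_nP_m(x_n)$ with all $a_i\in\mathbb N$. It represents an integer $N$ if $F_m(\mathbf x)=N$ has a solution $\mathbf x=(x_1,\dots,x_n)\in\mathbb Z^n$. It is universal if it represents every positive integer. *)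

(* Defs.v *)
From HB Require Import structures.
From mathcomp Require Import all_boot all_order all_algebra.
From mathcomp Require Import ring zify.

Set Implicit Arguments.
Unset Strict Implicit.
Unset Printing Implicit Defensive.

Import Order.TTheory GRing.Theory Num.Theory.
Local Open Scope ring_scope.

(* The division by 2 is exact, see [mgonalE]. *)
Definition mgonal (m x : int) : int :=
  (((m - 2) * x ^+ 2 - (m - 4) * x) %/ 2)%Z.

Lemma mgonalE (m x : int) :
  (mgonal m x)%:~R = (m%:~R - 2) / 2 * x%:~R ^+ 2 - (m%:~R - 4) / 2 * x%:~R :> rat.
Proof.
have dvd2 : (2 %| (m - 2) * x ^+ 2 - (m - 4) * x)%Z.
  have [k [->|->]] : exists k : int, x = k * 2 \/ x = k * 2 + 1.
    by exists (x %/ 2)%Z; lia.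
  - by apply/dvdzP; exists ((m - 2) * k ^+ 2 * 2 - (m - 4) * k); ring.
  - by apply/dvdzP; exists ((m - 2) * (k ^+ 2 * 2 + k * 2) - (m - 4) * k + 1); ring.
have /(congr1 (fun z : int => z%:~R : rat)) := divzK dvd2.
rewrite -/(mgonal m x) !(rmorphM, rmorphB, rmorphXn) /= => h.
apply: (@mulIf _ (2 : rat)) => //; rewrite h; by field.
Qed.

Section MgonalForms.
Variables (m : int) (n : nat) (a : n.-tuple nat).

Definition mgonal_form (x : n.-tuple int) : int :=
  \sum_(i < n) (tnth a i)%:Z * mgonal m (tnth x i).

Definition represents (N : int) : Prop :=
  exists x : n.-tuple int, mgonal_form x = N.

Definition universal : Prop := forall N : int, 0 < N -> represents N.

Definition positive_coefs : Prop := forall i : 'I_n, (0 < tnth a i)%N.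

End MgonalForms.

(* Main.v *)
(** With [mu = m - 2] one has [P_m x = mu * (x (x - 1) / 2) + x], so that the form represents [N]
    iff [N = mu * Q + r] for some [x] with [sum a_i x_i = r] and [sum a_i x_i ^ 2 = 2 Q + r].
    Outside [x = 0, 1] the values of [P_m] are at least [m - 3]; hence representing all numbers up
    to [m - 4] means that the subset sums of the coefficients fill [0, m - 4], and the four smallest
    coefficients form one of 27 quadruples.  Each quadruple, of sum [s], has an augmentation by one
    coefficient [b] for which the linear-quadratic system is solvable for all [Q >= 0] and
    [1 <= r <= s + 1]; using the other variables with values in [{0, 1}] this yields all residues
    modulo [mu].  Small [m] are similar.  Eliminating one variable turns each system into a ternary
    quadratic form that is a sum of three squares up to congruence conditions, so that everything
    rests on the three squares theorem for [n = 1, 2, 3, 5, 6 mod 8], plus finitely many values of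
    [Q], which are searched.

    For three squares, [n] is represented by a ternary form of determinant 1, which reduces to the
    identity.  The form is built from some [q] with [-n] a square modulo [q] and [-q] (or [-2q]) a
    square modulo [n].  Instead of a prime [q], whose existence needs Dirichlet's theorem, a product
    of primes [p] with [chi p = 1], [chi] being the Jacobi character of [-n], is enough: residues of
    such products generate the kernel of [chi], for otherwise a real character [psi] is trivial on
    all of them, and the Dirichlet convolution of [psi] and [psi chi] is nonnegative and at least 1
    on squares, which contradicts the boundedness of its partial sums weighted by [1 / sqrt k]. *)
Require Import Defs.
From Stdlib Require Import ZArith Znumtheory Lia.
From HB Require Import structures.
From mathcomp Require Import all_boot all_order all_algebra all_fingroup all_solvable all_field.
From mathcomp Require Import archimedean realalg boolp.
From mathcomp Require Import ring lra zify ssrZ.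

Set Implicit Arguments.
Unset Strict Implicit.
Unset Printing Implicit Defensive.

Import Order.TTheory GRing.Theory Num.Theory.
Local Open Scope ring_scope.

(** * Quadratic reciprocity *)

(** Euler's criterion serves as the definition, [p./2] being [(p - 1) / 2] for odd [p]. The link
    with squares is [legendre_sqr]. *)
Definition legendre (p : nat) (x : 'F_p) : int :=
  if x == 0 then 0 else if x ^+ p./2 == 1 then 1 else -1.

Section Legendre.
Variable p : nat.
Hypotheses (prp : prime p) (oddp : odd p).
Let h := p./2.

Let pE : p = (h.*2).+1. Proof. by rewrite /h; lia. Qed.

Let natF_eq0 (k : nat) : ((k%:R : 'F_p) == 0) = (p %| k)%N.
Proof. by rewrite -(dvdn_pcharf (pchar_Fp prp)). Qed.

Lemma Fp_natr_modn (k : nat) : ((k %% p)%:R : 'F_p) = k%:R.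
Proof. by rewrite [in RHS](divn_eq k p) natrD natrM pchar_Fp_0 // mulr0 add0r. Qed.

Lemma Fp_m1_neq1 : (-1 : 'F_p) != 1.
Proof.
rewrite -subr_eq0 -opprD oppr_eq0 -[1 + 1]/(2%:R) natF_eq0.
by apply/negP => /dvdn_leq; have := prime_gt1 prp; lia.
Qed.

Lemma expf_half_sqr (x : 'F_p) : x != 0 -> (x ^+ h == 1) || (x ^+ h == -1).
Proof.
move=> x0; rewrite -sqrf_eq1 -exprM.
have := expf_card x; rewrite card_Fp // => xp.
have : x ^+ (h * 2).+1 = x by rewrite muln2 -pE.
by rewrite exprS -[X in _ = X]mulr1 => /(mulfI x0) ->.
Qed.

Lemma legendreE (x : 'F_p) : x != 0 -> (legendre x)%:~R = x ^+ h.
Proof.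
move=> x0; rewrite /legendre (negPf x0) -/h.
by have := expf_half_sqr x0; case: eqP => [->|_ /= /eqP ->].
Qed.

Lemma legendre0 : legendre (0 : 'F_p) = 0.
Proof. by rewrite /legendre eqxx. Qed.

Lemma legendre_cases (x : 'F_p) : x != 0 -> legendre x = 1 \/ legendre x = -1.
Proof. by move=> x0; rewrite /legendre (negPf x0); case: ifP; [left|right]. Qed.

Lemma sign_Fp_inj (s t : int) : s = 1 \/ s = -1 -> t = 1 \/ t = -1 ->
  (s%:~R : 'F_p) = t%:~R -> s = t.
Proof.
by move=> [->|->] [->|->] //; rewrite rmorphN1 rmorph1 => /eqP;
  rewrite ?(eq_sym 1) (negPf Fp_m1_neq1).
Qed.

Lemma legendreM (x y : 'F_p) : legendre (x * y) = legendre x * legendre y.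
Proof.
have [->|x0] := eqVneq x 0; first by rewrite mul0r legendre0 mul0r.
have [->|y0] := eqVneq y 0; first by rewrite mulr0 legendre0 mulr0.
apply: sign_Fp_inj.
- by apply: legendre_cases; rewrite mulf_neq0.
- by case: (legendre_cases x0) => ->; case: (legendre_cases y0) => ->; auto.
by rewrite rmorphM /= !legendreE ?mulf_neq0 // exprMn.
Qed.

Lemma legendre1 : legendre (1 : 'F_p) = 1.
Proof. by rewrite /legendre oner_eq0 expr1n eqxx. Qed.

(** The unit group is cyclic: if [x = g ^ i] for a generator [g], then [x ^ h = 1] makes [2 h]
    divide [i h], so [i] is even. *)
Lemma legendre_sqr (x : 'F_p) : legendre x = 1 -> exists y, x = y ^+ 2.
Proof.
move=> lx; have x0 : x != 0 by apply: contra_eq_neq lx => ->; rewrite legendre0.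
have xh : x ^+ h = 1 by rewrite -legendreE // lx.
pose rs := [seq z <- enum 'F_p | z != 0].
have h0 : (0 < h)%N by have := prime_gt1 prp; rewrite /h; lia.
have unit_rt (z : 'F_p) : z != 0 -> z ^+ (h.*2) = 1.
  by move=> z0; rewrite -muln2 exprM; case/orP: (expf_half_sqr z0) => /eqP ->;
    rewrite ?expr1n ?sqrrN ?expr1n.
have size_rs : size rs = h.*2.
  have -> : size rs = #|predC1 (0 : 'F_p)|.
    by rewrite cardE /rs enumT /enum_mem; congr size; apply: eq_filter.
  by rewrite cardC1 card_Fp // [RHS](congr1 predn (esym pE)).
have /hasP[g _ gp] : has (h.*2).-primitive_root rs.
  apply: has_prim_root; rewrite ?size_rs ?double_gt0 ?(filter_uniq _ (enum_uniq _)) //.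
  by apply/allP => z; rewrite mem_filter => /andP[z0 _]; rewrite unity_rootE unit_rt.
have [i xi] := prim_rootP gp (unit_rt x x0).
have : (2 * h %| i * h)%N by rewrite mul2n (prim_order_dvd gp) exprM -xi xh eqxx.
rewrite dvdn_pmul2r // => /dvdnP[j ij].
by exists (g ^+ j); rewrite xi ij exprM.
Qed.

(** * Gauss's lemma *)

Section GaussLemma.
Variable a : nat.
Hypothesis pa : ~~ (p %| a)%N.

Let r k := ((a * k) %% p)%N.
(** The absolute value of the absolutely least residue of [a k]; these values permute
    [1, ..., h]. *)
Let s k := (if h < r k then p - r k else r k)%N.

Let r_gt0 k : (0 < k <= h)%N -> (0 < r k < p)%N.
Proof.
move=> k0; rewrite /r ltn_mod (prime_gt0 prp) andbT lt0n -/(dvdn _ _) Euclid_dvdM //.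
by rewrite (negPf pa) /=; apply/negP => /dvdn_leq; have := pE; lia.
Qed.

Let s_range k : (0 < k <= h)%N -> (0 < s k <= h)%N.
Proof. by move=> /r_gt0; rewrite /s; have := pE; case: (ltnP h (r k)); lia. Qed.

Let s_inj : {in iota 1 h &, injective s}.
Proof.
move=> k l; rewrite !mem_iota => kh lh skl.
have kh' : (0 < k <= h)%N by lia.
have lh' : (0 < l <= h)%N by lia.
have := r_gt0 kh'; have := r_gt0 lh' => rl rk.
have /orP[/eqP e|/eqP e] : (r k == r l) || (r k + r l == p)%N.
  by move: skl; rewrite /s; have := pE; case: (ltnP h (r k)); case: (ltnP h (r l)); lia.
- wlog lk : k l kh lh e rl rk kh' lh' skl / (l <= k)%N.
    by move=> W; case: (leqP l k) => lk; [exact: W|apply/esym/W => //; apply: ltnW].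
  move/eqP: e; rewrite /r eqn_mod_dvd ?leq_mul2l ?lk ?orbT // -mulnBr Euclid_dvdM //.
  by rewrite (negPf pa) /= => /dvdn_leq; have := pE; lia.
- have : (p %| a * (k + l))%N.
    by rewrite mulnDr /dvdn -modnDm -/(r k) -/(r l) e modnn.
  by rewrite Euclid_dvdM // (negPf pa) /= => /dvdn_leq; have := pE; lia.
Qed.

Let s_perm : perm_eq [seq s k | k <- iota 1 h] (iota 1 h).
Proof.
have us : uniq [seq s k | k <- iota 1 h] by rewrite (map_inj_in_uniq s_inj) iota_uniq.
apply: uniq_perm => //; first exact: iota_uniq.
have [] := uniq_min_size us (s2 := iota 1 h); rewrite ?size_map ?size_iota //.
by move=> x /mapP[k]; rewrite mem_iota => kh ->; rewrite mem_iota;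
   have := @s_range k; lia.
Qed.

Definition gauss_count := (\sum_(1 <= k < h.+1) (h < r k))%N.

(** Multiplying the congruences between [a k] and plus or minus [s k] over [1 <= k <= h] gives [h!]
    on both sides; only the signs remain. *)
Lemma gauss_lemma : (a%:R : 'F_p) ^+ h = (-1) ^+ gauss_count.
Proof.
have fact0 : \prod_(k <- iota 1 h) (k%:R : 'F_p) != 0.
  rewrite prodf_seq_neq0; apply/allP => k; rewrite mem_iota natF_eq0 => kh.
  by apply/negP => /dvdn_leq; have := pE; lia.
have fact0' : \prod_(1 <= k < h.+1) (k%:R : 'F_p) != 0.
  by move: fact0; rewrite /index_iota subn1.
apply: (mulIf fact0').
rewrite -[X in _ ^+ X](subn1 h.+1) -prodr_const_nat -big_split /=.
transitivity (\prod_(1 <= k < h.+1) ((-1) ^+ (h < r k)%N * (s k)%:R : 'F_p)).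
  rewrite big_nat [RHS]big_nat; apply: eq_bigr => k kh.
  rewrite -natrM -Fp_natr_modn -/(r k) /s; case: ltnP => _; last by rewrite mul1r.
  have := r_gt0 kh => rk; rewrite natrB; last by lia.
  by rewrite pchar_Fp_0 // sub0r expr1 mulN1r opprK.
rewrite big_split /= -expr_sum; congr (_ * _).
rewrite /index_iota subn1 -[LHS](big_map s xpredT (fun k => (k%:R : 'F_p))).
exact: perm_big s_perm.
Qed.

(** Modulo 2, division of [a k] by [p] gives [k = (a * k) %/ p + r k], and [s k] differs in parity
    from [r k] exactly when [h < r k]. In the sum over [k] the [s k] cancel against the [k]. *)
Lemma gauss_count_floor : odd a ->
  odd gauss_count = odd (\sum_(1 <= k < h.+1) (a * k) %/ p)%N.
Proof.
move=> odda.
have sumS : (\sum_(1 <= k < h.+1) s k = \sum_(1 <= k < h.+1) k)%N.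
  rewrite /index_iota subn1 -[LHS](big_map s xpredT id).
  exact: perm_big s_perm.
have : ~~ odd (\sum_(1 <= k < h.+1) ((a * k) %/ p + s k + (h < r k) + k))%N.
  rewrite big_nat; elim/big_ind: _ => // [x y|k kh]; first by rewrite oddD => /negPf-> /negPf->.
  have := r_gt0 kh; have := divn_eq (a * k) p; rewrite -/(r k) => e rk.
  have : odd (a * k) = odd ((a * k) %/ p * p + r k) by rewrite -e.
  rewrite !oddD !oddM odda oddp andbT /= => ->.
  rewrite /s; case: (ltnP h (r k)) => _; last by do 2!case: odd.
  by rewrite oddB ?oddp; [do 2!case: odd|lia].
rewrite !big_split /= sumS !oddD -/gauss_count.
by do 3!case: odd.
Qed.

End GaussLemma.

Lemma legendre_gauss (a : nat) : ~~ (p %| a)%N ->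
  legendre (a%:R : 'F_p) = (-1) ^+ gauss_count a.
Proof.
move=> pa; have a0 : (a%:R : 'F_p) != 0 by rewrite natF_eq0.
apply: sign_Fp_inj; first exact: legendre_cases.
  by rewrite -signr_odd; case: odd; [right|left].
by rewrite legendreE // gauss_lemma // rmorphXn /= rmorphN1.
Qed.

Lemma legendreN1 : legendre (-1 : 'F_p) = (-1) ^+ h.
Proof.
apply: sign_Fp_inj; first by apply: legendre_cases; rewrite oppr_eq0 oner_eq0.
  by rewrite -signr_odd; case: odd; [right|left].
by rewrite legendreE ?oppr_eq0 ?oner_eq0 // rmorphXn /= rmorphN1.
Qed.

(** The residue [2 k] exceeds [h] exactly for [h./2 < k <= h]. *)
Lemma legendre2 : legendre (2%:R : 'F_p) = (-1) ^+ (h - h./2).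
Proof.
have p2 : ~~ (p %| 2)%N.
  by apply/negP => /dvdn_leq; have := pE; have := prime_gt1 prp; lia.
rewrite legendre_gauss //; congr (_ ^+ _); rewrite /gauss_count.
rewrite (@big_cat_nat _ _ _ h./2.+1) //=; last by lia.
rewrite big_nat big1 ?add0n => [|k kh]; last first.
  by rewrite modn_small; have := pE; lia.
rewrite big_nat (eq_bigr (fun=> 1%N)) => [|k kh]; last first.
  by rewrite modn_small; have := pE; lia.
by rewrite -big_nat sum_nat_const_nat muln1 subSS.
Qed.

End Legendre.

(** Eisenstein's count: the two sums count the lattice points of the rectangle [p./2] by [q./2] on
    either side of the line [p j = q k], which contains none of them. *)
Lemma sum_floor_reciprocity (p q : nat) : prime p -> prime q -> odd p -> odd q -> p != q ->
  (\sum_(1 <= k < p./2.+1) (q * k) %/ p + \sum_(1 <= j < q./2.+1) (p * j) %/ q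
    = p./2 * q./2)%N.
Proof.
have floorE (m n : nat) : prime m -> odd m -> odd n ->
  (\sum_(1 <= k < m./2.+1) (n * k) %/ m
    = \sum_(1 <= k < m./2.+1) \sum_(1 <= j < n./2.+1) (m * j <= n * k))%N.
  move=> prm om on; rewrite big_nat [RHS]big_nat; apply: eq_bigr => k km.
  have m0 := prime_gt0 prm.
  have fl : (n * k %/ m <= n./2)%N by rewrite -ltnS ltn_divLR //; nia.
  rewrite (@big_cat_nat _ _ _ (n * k %/ m).+1) //=.
  rewrite big_nat (eq_bigr (fun=> 1%N)) => [|j jn]; last first.
    by rewrite mulnC -leq_divRL //; lia.
  rewrite -big_nat sum_nat_const_nat muln1 subn1 big_nat big1 ?addn0 // => j jn.
  by rewrite mulnC -leq_divRL //; lia.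
move=> prp prq op oq pq.
rewrite (floorE p q) // (floorE q p) // [X in (_ + X)%N]exchange_big /= -big_split /=.
rewrite (eq_big_nat _ _ (F2 := fun=> q./2)) ?sum_nat_const_nat ?subn1 // => k kp.
rewrite -big_split /= (eq_big_nat _ _ (F2 := fun=> 1%N)) ?sum_nat_const_nat ?subn1 ?muln1 //.
move=> j jq; have [pj|pj|e] := ltngtP (p * j)%N (q * k)%N => //.
have : (p %| q * k)%N by rewrite -e dvdn_mulr.
rewrite Euclid_dvdM // dvdn_prime2 // (negPf pq) /= => /dvdn_leq; lia.
Qed.

Lemma quadratic_reciprocity (p q : nat) : prime p -> prime q -> odd p -> odd q -> p != q ->
  legendre (q%:R : 'F_p) = (-1) ^+ (p./2 * q./2) * legendre (p%:R : 'F_q).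
Proof.
move=> prp prq op oq pq.
rewrite !legendre_gauss ?dvdn_prime2 //; last by rewrite eq_sym.
rewrite -signr_odd -[in RHS]signr_odd -[X in _ * X]signr_odd.
rewrite !gauss_count_floor ?dvdn_prime2 //; last by rewrite eq_sym.
rewrite -sum_floor_reciprocity // oddD signr_addb.
by do 2!case: odd; rewrite ?mulN1r ?opprK ?mul1r ?mulr1.
Qed.

(** * Primes separated by two real characters *)

Definition real_char (D : nat) (psi : nat -> int) : Prop :=
  [/\ forall k, psi (k + D)%N = psi k,
      {morph psi : k l / (k * l)%N >-> k * l} &
      forall k, psi k ^+ 2 = (coprime k D)%:R].

Lemma real_char_cases D psi k : real_char D psi ->
  [\/ psi k = 1 /\ coprime k D, psi k = -1 /\ coprime k D | psi k = 0 /\ ~~ coprime k D].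
Proof.
move=> [_ _ /(_ k)]; case: coprime => /eqP.
  by rewrite sqrf_eq1 => /orP[]/eqP ->; [apply: Or31|apply: Or32].
by rewrite sqrf_eq0 => /eqP ->; apply: Or33.
Qed.

Lemma real_char1 D psi : real_char D psi -> psi 1%N = 1.
Proof.
move=> cpsi; have [_ psiM _] := cpsi; have := psiM 1%N 1%N; rewrite muln1.
by case: (real_char_cases 1 cpsi) => -[-> //]; rewrite coprime1n.
Qed.

Lemma real_char_modn D psi k : real_char D psi -> psi (k %% D)%N = psi k.
Proof.
move=> [per _ _]; rewrite [in RHS](divn_eq k D) addnC.
by elim: (k %/ D)%N => [|j IH]; rewrite ?addn0 // mulSn addnCA addnC per.
Qed.

(** * Partial sums of a nonprincipal real character *)

Section PartialSums.
Variables (D : nat) (psi : nat -> int).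
Hypotheses (D_gt0 : (0 < D)%N) (cpsi : real_char D psi).
Hypothesis nonprincipal : exists u, psi u = -1.

Let per k : psi (k + D)%N = psi k. Proof. by case: cpsi. Qed.

(** Multiplication by some [u] with [psi u = -1] permutes the residues and changes the sign of the
    sum. *)
Lemma sum_period0 : \sum_(0 <= k < D) psi k = 0.
Proof.
have [u psiu] := nonprincipal.
have uD : coprime u D by case: (real_char_cases u cpsi) => -[]; rewrite psiu.
have Dm (k : nat) : (k %% D < D)%N by rewrite ltn_mod.
pose f (i : 'I_D) := Ordinal (Dm (u * i)%N).
have f_inj : injective f.
  move=> i j /(congr1 val) /= /eqP; wlog ij : i j / (i <= j)%N.
    move=> W e; case: (leqP i j) => ij; first exact: W.
    by apply/esym/W; rewrite ?(ltnW ij) // eq_sym.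
  rewrite eq_sym eqn_mod_dvd ?leq_mul2l ?ij ?orbT // -mulnBr.
  rewrite Gauss_dvdr 1?coprime_sym // => /dvdn_leq h; apply/val_inj => /=.
  by have := ltn_ord j; lia.
have : \sum_(0 <= k < D) psi k = - \sum_(0 <= k < D) psi k.
  rewrite !big_mkord [LHS](reindex_inj f_inj) /= -sumrN; apply: eq_bigr => i _.
  by rewrite real_char_modn //; case: cpsi => _ -> _; rewrite psiu mulN1r.
lia.
Qed.

Lemma sum_shift_period a : \sum_(a <= k < a + D) psi k = 0.
Proof.
elim: a => [|a IH]; first by rewrite add0n sum_period0.
move: IH; rewrite big_ltn; last by lia.
by rewrite addSn big_nat_recr /=; [rewrite per addrC => ->|lia].
Qed.

Lemma partial_sum_bound a n : `|\sum_(a <= k < a + n) psi k| <= D%:Z.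
Proof.
elim/ltn_ind: n a => n IH a; case: (ltnP n D) => nD.
  apply: le_trans (ler_norm_sum _ _ _) _.
  apply: le_trans (_ : \sum_(a <= k < a + n) 1 <= _).
    by apply: ler_sum => k _; case: (real_char_cases k cpsi) => -[-> _].
  by rewrite sumr_const_nat; lia.
rewrite (@big_cat_nat _ _ _ (a + D)) /=; try lia.
rewrite sum_shift_period add0r.
by have -> : (a + n = a + D + (n - D))%N; [lia | apply: IH; lia].
Qed.

End PartialSums.

(** * Summation by parts *)

Section Abel.
Variable R : realFieldType.
Implicit Types (f : nat -> R) (g : nat -> int).

Lemma abel_bound g f (C : nat) a n :
  (forall k, 0 <= f k) -> (forall k, (a <= k)%N -> f k.+1 <= f k) ->
  (forall m, `|\sum_(a <= k < a + m) g k| <= C%:Z) ->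
  `|\sum_(a <= k < a + n) (g k)%:~R * f k| <= C%:R * f a.
Proof.
move=> f0 fdec gC.
have gCR m : `|\sum_(a <= k < a + m) (g k)%:~R : R| <= C%:R.
  by rewrite -rmorph_sum -intr_norm -[C%:R]/((C%:Z)%:~R) ler_int.
case: n => [|n]; first by rewrite addn0 big_geq // normr0 mulr_ge0.
pose A m := \sum_(a <= k < a + m.+1) (g k)%:~R * f k.
pose S m : R := \sum_(a <= k < a + m.+1) (g k)%:~R.
have AS m : A m.+1 = A m + (g (a + m.+1)%N)%:~R * f (a + m.+1)%N.
  by rewrite /A (addnS a m.+1) big_nat_recr //=; lia.
have SS m : S m.+1 = S m + (g (a + m.+1)%N)%:~R.
  by rewrite /S (addnS a m.+1) big_nat_recr //=; lia.
(* The difference is the sum over [j < m] of [S j * (f (a + j) - f (a + j + 1))]; bounding each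
   [S j] by [C] leaves a telescoping sum. *)
have key m : `|A m - S m * f (a + m)%N| <= C%:R * (f a - f (a + m)%N).
  elim: m => [|m IH].
    by rewrite /A /S addn1 !big_nat1 addn0 !subrr normr0 mulr0.
  have S_C : `|S m| <= C%:R by exact: gCR.
  have -> : A m.+1 - S m.+1 * f (a + m.+1)%N
    = (A m - S m * f (a + m)%N) + S m * (f (a + m)%N - f (a + m.+1)%N).
    by rewrite AS SS; ring.
  apply: le_trans (ler_normD _ _) _.
  have fm : 0 <= f (a + m)%N - f (a + m.+1)%N by rewrite subr_ge0 addnS fdec // leq_addr.
  rewrite normrM (ger0_norm fm).
  have := ler_wpM2r fm S_C; lra.
have := gCR n.+1; have := key n; rewrite -/(A n) -/(S n) => h1 h2.
rewrite -[A n](subrK (S n * f (a + n)%N)).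
apply: le_trans (ler_normD _ _) _; rewrite normrM (ger0_norm (f0 _)).
have := ler_wpM2r (f0 (a + n)%N) h2; lra.
Qed.

End Abel.

(** * The Dirichlet convolution of two real characters *)

Section Convolution.
Variable D : nat.
Variables psi phi : nat -> int.
Hypotheses (cpsi : real_char D psi) (cphi : real_char D phi).
Hypothesis no_split : forall p, prime p -> ~ (psi p = -1 /\ phi p = -1).

Definition conv k : int := \sum_(d <- divisors k) psi d * phi (k %/ d)%N.

Let psiM k l : psi (k * l)%N = psi k * psi l. Proof. by case: cpsi. Qed.
Let phiM k l : phi (k * l)%N = phi k * phi l. Proof. by case: cphi. Qed.

(** The divisors prime to [p] are those of [k]; the others are [p] times a divisor of
    [p ^ e * k]. *)
Lemma divisors_mul_prime p e k : prime p -> (0 < k)%N -> ~~ (p %| k)%N ->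
  perm_eq (divisors (p ^ e.+1 * k))
          (divisors k ++ [seq (p * d)%N | d <- divisors (p ^ e * k)]).
Proof.
move=> prp k0 pk; have p0 := prime_gt0 prp.
apply: uniq_perm; first exact: divisors_uniq.
  rewrite cat_uniq divisors_uniq /= map_inj_uniq ?divisors_uniq; last first.
    by move=> x y /eqP; rewrite eqn_pmul2l // => /eqP.
  rewrite andbT; apply/hasPn => x /mapP[d _ ->] /=; rewrite -dvdn_divisors //.
  by apply: contra pk => /(dvdn_trans (dvdn_mulr d (dvdnn p))).
move=> d; rewrite mem_cat -!dvdn_divisors ?muln_gt0 ?expn_gt0 ?p0 //.
apply/idP/orP => [|[dk|/mapP[d']]].
- have [/dvdnP[d' ->]|pd] := boolP (p %| d)%N.
    rewrite mulnC expnS -mulnA dvdn_pmul2l // => d'k; right.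
    by apply/mapP; exists d' => //; rewrite -dvdn_divisors ?muln_gt0 ?expn_gt0 ?p0.
  by rewrite Gauss_dvdr ?coprimeXr // 1?coprime_sym ?prime_coprime //; left.
- exact: dvdn_mull.
- rewrite -dvdn_divisors ?muln_gt0 ?expn_gt0 ?p0 // => d'k ->.
  by rewrite expnS -mulnA dvdn_pmul2l.
Qed.

(** The value of the convolution at [p ^ e], for [a = psi p] and [b = phi p]. *)
Let geo (a b : int) e : int := \sum_(i < e.+1) a ^+ i * b ^+ (e - i).

Let geoS a b e : geo a b e.+1 = b ^+ e.+1 + a * geo a b e.
Proof.
rewrite /geo big_ord_recl expr0 mul1r subn0; congr (_ + _).
by rewrite big_distrr; apply: eq_bigr => i _ /=; rewrite exprS mulrA.
Qed.

Lemma conv_mul_prime p e k : prime p -> (0 < k)%N -> ~~ (p %| k)%N ->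
  conv (p ^ e * k)%N = geo (psi p) (phi p) e * conv k.
Proof.
move=> prp k0 pk; have p0 := prime_gt0 prp.
elim: e => [|e IH].
  by rewrite expn0 mul1n /geo big_ord_recl big_ord0 subnn !expr0 mulr1 addr0 mul1r.
rewrite {1}/conv (perm_big _ (divisors_mul_prime e prp k0 pk)) big_cat big_map /=.
rewrite geoS mulrDl -mulrA -IH /conv !big_distrr /=; congr (_ + _).
  rewrite big_seq [RHS]big_seq; apply: eq_bigr => d; rewrite -dvdn_divisors // => dk.
  rewrite -muln_divA // phiM mulrCA; congr (_ * _).
  by elim: (e.+1) => [|i IHi]; rewrite ?(real_char1 cphi) // expnS exprS phiM IHi.
apply: eq_bigr => d _; rewrite psiM mulrA; congr (_ * phi _).
by rewrite expnS -mulnA divnMl.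
Qed.

(** The value is [e + 1] for the pair 1, 1, the indicator of even [e] for opposite signs, and the
    indicator of [e = 0] for 0, 0. A single zero is impossible, as both characters have modulus [D],
    and [no_split] excludes the pair -1, -1. *)
Let geo_ge0 p e : prime p -> 0 <= geo (psi p) (phi p) e.
Proof.
move=> prp; have := no_split prp.
have [[-> cp]|[-> cp]|[-> cp]] := real_char_cases p cpsi;
have [[-> cp']|[-> cp']|[-> cp']] := real_char_cases p cphi => ns.
all: try by rewrite cp' in cp.
all: try by rewrite cp in cp'.
- elim: e => [|e IH]; first by rewrite /geo big_ord_recl big_ord0.
  by rewrite geoS expr1n mul1r addr_ge0.
- suff : geo 1 (-1) e = (~~ odd e)%:Z by move->.
  elim: e => [|e IH]; first by rewrite /geo big_ord_recl big_ord0.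
  by rewrite geoS IH -signr_odd /=; case: odd.
- suff : geo (-1) 1 e = (~~ odd e)%:Z by move->.
  elim: e => [|e IH]; first by rewrite /geo big_ord_recl big_ord0.
  by rewrite geoS IH expr1n /=; case: odd.
- by case: ns.
- case: e => [|e]; first by rewrite /geo big_ord_recl big_ord0.
  by rewrite geoS expr0n mul0r.
Qed.

Let geo_even p e : prime p -> coprime p D -> 1 <= geo (psi p) (phi p) e.*2.
Proof.
move=> prp cp; have := no_split prp.
have [[-> _]|[-> _]|[_ /negP//]] := real_char_cases p cpsi;
have [[-> _]|[-> _]|[_ /negP//]] := real_char_cases p cphi => ns.
- elim: e => [|e IH]; first by rewrite /geo big_ord_recl big_ord0.
  by rewrite doubleS !geoS !expr1n !mul1r; lia.
- suff -> : geo 1 (-1) e.*2 = (~~ odd e.*2)%:Z by rewrite odd_double.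
  elim: (e.*2) => [|i IH]; first by rewrite /geo big_ord_recl big_ord0.
  by rewrite geoS IH -signr_odd /=; case: odd.
- suff -> : geo (-1) 1 e.*2 = (~~ odd e.*2)%:Z by rewrite odd_double.
  elim: (e.*2) => [|i IH]; first by rewrite /geo big_ord_recl big_ord0.
  by rewrite geoS IH expr1n /=; case: odd.
- by case: ns.
Qed.

Let conv1 : conv 1 = 1.
Proof. by rewrite /conv big_seq1 divnn (real_char1 cpsi) (real_char1 cphi). Qed.

Let prime_part k : (1 < k)%N -> exists p e k',
  [/\ prime p, (0 < e)%N, (0 < k' < k)%N, ~~ (p %| k')%N & k = (p ^ e * k')%N].
Proof.
move=> k1; have prp := pdiv_prime k1; have k0 : (0 < k)%N by lia.
have [k' cpk kE] := pfactor_coprime prp k0.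
have e0 : (0 < logn (pdiv k) k)%N by rewrite logn_gt0 mem_primes prp k0 pdiv_dvd.
exists (pdiv k), (logn (pdiv k) k), k'; split=> //; last by rewrite mulnC.
  have k'0 : (0 < k')%N by rewrite lt0n; apply: contraTneq k0 => k'0; rewrite kE k'0.
  rewrite k'0 [ltnRHS]kE -{1}[k']muln1 ltn_pmul2l //.
  by rewrite -{1}(expn0 (pdiv k)) ltn_exp2l // prime_gt1.
by rewrite -prime_coprime.
Qed.

Lemma conv_ge0 k : (0 < k)%N -> 0 <= conv k.
Proof.
elim/ltn_ind: k => k IH k0; have [k1|k1] := leqP k 1.
  by have -> : k = 1%N by [lia|]; rewrite conv1.
have [p [e [k' [prp e0 /andP[k'0 k'k] pk kE]]]] := prime_part k1.
by rewrite kE conv_mul_prime // mulr_ge0 ?geo_ge0 ?IH.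
Qed.

Lemma conv_sqr m : (0 < m)%N -> coprime m D -> 1 <= conv (m ^ 2).
Proof.
elim/ltn_ind: m => m IH m0 mD; have [m1|m1] := leqP m 1.
  by have -> : m = 1%N by [lia|]; rewrite conv1.
have [p [e [k' [prp e0 /andP[k'0 k'k] pk kE]]]] := prime_part m1.
move: mD; rewrite kE coprimeMl coprime_pexpl // => /andP[pD k'D].
rewrite expnMn -expnM muln2 conv_mul_prime ?expn_gt0 ?k'0 ?Euclid_dvdX ?negb_and ?pk //.
have := geo_even e prp pD; have := IH k' k'k k'0 k'D; nia.
Qed.

End Convolution.

(** * Dirichlet's hyperbola method *)

Section Hyperbola.
Variable R : rcfType.

(** Both sides run over the pairs with [d * e <= N]. *)
Lemma sum_divisors_pairs (G : nat -> nat -> R) N :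
  \sum_(1 <= k < N.+1) \sum_(d <- divisors k) G d (k %/ d)%N
    = \sum_(1 <= d < N.+1) \sum_(1 <= e < (N %/ d).+1) G d e.
Proof.
transitivity (\sum_(1 <= k < N.+1) \sum_(1 <= d < N.+1 | (d %| k)%N) G d (k %/ d)%N).
  rewrite big_nat [RHS]big_nat; apply: eq_bigr => k kN.
  rewrite -[RHS]big_filter; apply: perm_big; apply: uniq_perm.
  - exact: divisors_uniq.
  - exact/filter_uniq/iota_uniq.
  move=> d; rewrite mem_filter -dvdn_divisors ?mem_index_iota; last by lia.
  by case: (boolP (d %| k)%N) => //= dk; have := dvdn_leq _ dk; have := dvdn_gt0 _ dk; lia.
rewrite (exchange_big_dep_nat xpredT) //=; rewrite big_nat [RHS]big_nat; apply: eq_bigr => d dN.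
rewrite -[LHS]big_filter.
rewrite (perm_big [seq (d * e)%N | e <- index_iota 1 (N %/ d).+1]) ?big_map /=.
  by apply: eq_bigr => e _; rewrite mulKn //; lia.
apply: uniq_perm; first exact/filter_uniq/iota_uniq.
  rewrite map_inj_uniq ?iota_uniq // => x y /eqP; rewrite eqn_pmul2l; last by lia.
  by move/eqP.
move=> k; rewrite mem_filter mem_index_iota; apply/andP/mapP => [[/dvdnP[e ->] eN]|[e]].
  exists e; last by rewrite mulnC.
  by rewrite mem_index_iota ltnS leq_divRL; lia.
by rewrite mem_index_iota ltnS leq_divRL => [eN ->|]; [rewrite dvdn_mulr //; nia|lia].
Qed.

Let v k : R := (Num.sqrt k%:R)^-1.

Let v_ge0 k : 0 <= v k. Proof. by rewrite invr_ge0 sqrtr_ge0. Qed.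

Let vM k l : v (k * l)%N = v k * v l.
Proof. by rewrite /v natrM sqrtrM ?ler0n // invfM. Qed.

Let v_dec k l : (0 < k <= l)%N -> v l <= v k.
Proof.
move=> /andP[k0 kl]; have l0 : (0 < l)%N by lia.
by rewrite lef_pV2 ?posrE ?sqrtr_gt0 ?ltr0n // ler_sqrt ?ler_nat ?ltr0n.
Qed.

Let v_sqr m : v (m ^ 2)%N = m%:R^-1.
Proof. by rewrite /v natrX sqrtr_sqr ger0_norm. Qed.

Let sum_v X : \sum_(1 <= k < X.+1) v k <= 2 * Num.sqrt X%:R.
Proof.
elim: X => [|X IH]; first by rewrite big_geq // mulr_ge0 ?sqrtr_ge0.
rewrite big_nat_recr //=; apply: le_trans (lerD IH (lexx _)) _; rewrite /v.
set t := Num.sqrt X%:R; set s := Num.sqrt X.+1%:R.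
have t0 : 0 <= t by exact: sqrtr_ge0.
have s0 : 0 < s by rewrite sqrtr_gt0.
have ts : t <= s by rewrite ler_sqrt ?ler_nat.
have e : s ^+ 2 = t ^+ 2 + 1 by rewrite !sqr_sqrtr // mulrSr.
rewrite -(ler_pM2r s0) mulrDl mulVf ?gt_eqF //.
have : 0 <= (s - t) ^+ 2 by exact: sqr_ge0.
nra.
Qed.

Section Bound.
Variable D : nat.
Variables psi phi : nat -> int.
Hypotheses (D_gt0 : (0 < D)%N) (cpsi : real_char D psi) (cphi : real_char D phi).
Hypotheses (npsi : exists u, psi u = -1) (nphi : exists u, phi u = -1).

Let bound (chi : nat -> int) a b : real_char D chi -> (exists u, chi u = -1) ->
  (0 < a)%N -> `|\sum_(a <= k < b) (chi k)%:~R * v k| <= D%:R * v a.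
Proof.
move=> cchi nchi a0; case: (leqP a b) => ab; last first.
  by rewrite big_geq ?normr0 ?mulr_ge0 //; lia.
rewrite -(subnKC ab); apply: abel_bound => // [k ak|m].
  by apply: v_dec; lia.
exact: partial_sum_bound.
Qed.

Lemma hyperbola_bound X : (0 < X)%N ->
  `|\sum_(1 <= k < (X ^ 2).+1) (conv psi phi k)%:~R * v k| <= (D%:R ^+ 2 + 3 * D%:R).
Proof.
move=> X0; set N := (X ^ 2)%N; have D0 : 0 <= D%:R :> R by exact: ler0n.
have XR0 : 0 < X%:R :> R by rewrite ltr0n.
have v1 : v 1 = 1 by rewrite /v sqrtr1 invr1.
pose f (chi : nat -> int) k : R := (chi k)%:~R * v k.
have -> : \sum_(1 <= k < N.+1) (conv psi phi k)%:~R * v k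
    = \sum_(1 <= d < N.+1) \sum_(1 <= e < (N %/ d).+1) f psi d * f phi e.
  rewrite -sum_divisors_pairs big_nat [RHS]big_nat; apply: eq_bigr => k kN.
  rewrite /conv rmorph_sum big_distrl /= big_seq [RHS]big_seq; apply: eq_bigr => d.
  rewrite -dvdn_divisors => [dk|]; last by lia.
  by rewrite -{2}(divnK dk) vM rmorphM /f /=; ring.
have XN : (X <= N)%N by rewrite /N; nia.
rewrite (@big_cat_nat _ _ _ X.+1) //=.
pose L := \sum_(1 <= e < N.+1) f phi e.
have L_D : `|L| <= D%:R.
  by have := @bound phi 1%N N.+1 cphi nphi isT; rewrite v1 mulr1.
(* For [d <= X] the inner sum is [L] minus a tail. The terms with [L] give at most [D ^ 2]. A tail
   is at most [D * v (N %/ d).+1], and as [d * (N %/ d).+1] exceeds [N = X ^ 2], the factor [v d]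
   brings this down to [D / X] for each of the [X] values of [d]. *)
have part1 : `|\sum_(1 <= d < X.+1) \sum_(1 <= e < (N %/ d).+1) f psi d * f phi e|
    <= D%:R ^+ 2 + D%:R.
  rewrite (eq_big_nat _ _ (F2 := fun d => f psi d * L
      - f psi d * \sum_((N %/ d).+1 <= e < N.+1) f phi e)); last first.
    move=> d dX; rewrite -big_distrr /= -mulrBr; congr (_ * _).
    rewrite /L (@big_cat_nat _ _ _ (N %/ d).+1 1 N.+1) //= ?addrK //.
    by rewrite ltnS leq_div.
  rewrite big_split /= sumrN -big_distrl /=.
  apply: le_trans (ler_normB _ _) _; apply: lerD.
    rewrite normrM expr2; apply: ler_pM => //.
    by have := @bound psi 1%N X.+1 cpsi npsi isT; rewrite v1 mulr1.
  apply: le_trans (ler_norm_sum _ _ _) _.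
  apply: le_trans (_ : \sum_(1 <= d < X.+1) D%:R / X%:R <= _); last first.
    by rewrite sumr_const_nat subn1 /= -[leLHS]mulr_natr divfK ?gt_eqF.
  rewrite big_nat [leRHS]big_nat; apply: ler_sum => d dX.
  rewrite normrM; apply: le_trans (_ : v d * (D%:R * v (N %/ d).+1) <= _).
    apply: ler_pM => //; last exact: (bound _ cphi nphi).
    rewrite /f normrM (ger0_norm (v_ge0 d)) ler_piMl //.
    by case: (real_char_cases d cpsi) => -[-> _]; rewrite ?normrN ?normr1 ?normr0.
  rewrite mulrCA -vM ler_wpM2l // -v_sqr; apply: v_dec; rewrite /N expn_gt0 X0 /=.
  by have := divn_eq (X ^ 2) d; have := @ltn_pmod (X ^ 2) d; nia.
(* For [d > X] one has [e <= X], so the summations are exchanged: each inner sum is at most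
   [D * v X], and the [v e] add up to at most [2 sqrt X]. *)
have part2 : `|\sum_(X.+1 <= d < N.+1) \sum_(1 <= e < (N %/ d).+1) f psi d * f phi e|
    <= 2 * D%:R.
  have -> : \sum_(X.+1 <= d < N.+1) \sum_(1 <= e < (N %/ d).+1) f psi d * f phi e
     = \sum_(1 <= e < X.+1) f phi e * \sum_(X.+1 <= d < (N %/ e).+1) f psi d.
    transitivity (\sum_(X.+1 <= d < N.+1) \sum_(1 <= e < X.+1 | (d * e <= N)%N)
                    f psi d * f phi e).
      rewrite big_nat [RHS]big_nat; apply: eq_bigr => d dX.
      have NdX : (N %/ d <= X)%N by rewrite -ltnS ltn_divLR /N; nia.
      rewrite (@big_cat_nat _ _ _ (N %/ d).+1 1 X.+1) //= [X in _ = _ + X]big_nat_cond.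
      rewrite [X in _ = _ + X]big_pred0 ?addr0 => [|e]; last first.
        by rewrite (mulnC d) -leq_divRL; lia.
      rewrite big_nat [RHS]big_nat_cond; apply: eq_bigl => e.
      by rewrite (mulnC d) -leq_divRL; lia.
    rewrite (exchange_big_dep_nat xpredT) //= big_nat [RHS]big_nat; apply: eq_bigr => e eX.
    rewrite big_distrr /= (@big_cat_nat _ _ _ (N %/ e).+1 X.+1 N.+1) /=.
    - rewrite [X in _ + X]big_nat_cond [X in _ + X]big_pred0 ?addr0 => [|d]; last first.
        by rewrite -leq_divRL; lia.
      rewrite big_nat_cond [RHS]big_nat; apply: eq_big => [d|d _]; last exact: mulrC.
      by rewrite -leq_divRL; lia.
    - by rewrite ltnS leq_divRL /N; nia.
    - by rewrite ltnS leq_div.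
  apply: le_trans (ler_norm_sum _ _ _) _.
  apply: le_trans (_ : \sum_(1 <= e < X.+1) v e * (D%:R * v X) <= _).
    rewrite big_nat [leRHS]big_nat; apply: ler_sum => e eX.
    rewrite normrM; apply: ler_pM => //.
      rewrite /f normrM (ger0_norm (v_ge0 e)) ler_piMl //.
      by case: (real_char_cases e cphi) => -[-> _]; rewrite ?normrN ?normr1 ?normr0.
    by apply: le_trans (bound _ cpsi npsi _) _ => //; rewrite ler_wpM2l // v_dec //; lia.
  rewrite -big_distrl /=.
  apply: le_trans (ler_wpM2r _ (sum_v X)) _; first by rewrite mulr_ge0.
  have s0 : 0 < Num.sqrt X%:R :> R by rewrite sqrtr_gt0.
  rewrite /v le_eqVlt; apply/orP; left; apply/eqP; field; exact: lt0r_neq0.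
apply: le_trans (ler_normD _ _) _; apply: le_trans (lerD part1 part2) _; lra.
Qed.

End Bound.
End Hyperbola.

(** * A prime at which two real characters are both -1 *)

Section SplitPrime.
Variable D : nat.
Variables psi phi : nat -> int.
Hypotheses (D_gt0 : (0 < D)%N) (cpsi : real_char D psi) (cphi : real_char D phi).
Hypotheses (npsi : exists u, psi u = -1) (nphi : exists u, phi u = -1).

Lemma sum_le_subset (R : numDomainType) (I : eqType) (s t : seq I) (f : I -> R) :
  uniq s -> uniq t -> {subset s <= t} -> {in t, forall i, 0 <= f i} ->
  \sum_(i <- s) f i <= \sum_(i <- t) f i.
Proof.
move=> us ut st f0; rewrite [leRHS](bigID (mem s)) /=.
have -> : \sum_(i <- t | i \in s) f i = \sum_(i <- s) f i.
  rewrite -big_filter; apply: perm_big; apply: uniq_perm => //; first exact: filter_uniq.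
  by move=> i; rewrite mem_filter /=; case: (boolP (i \in s)) => //= /st ->.
by rewrite lerDl big_seq_cond sumr_ge0 // => i /andP[/f0].
Qed.

(** Dyadic blocks: the terms with [2 ^ n <= j < 2 ^ n.+1] add up to at least [1 / (2 (D + 1))]. *)
Lemma harmonic_progression_unbounded (M : nat) :
  exists J, M%:R <= \sum_(0 <= j < J) (1 + (j * D)%N)%:R^-1 :> realalg.
Proof.
have D0 : 0 < (D.+1)%:R :> realalg by rewrite ltr0n.
suff doubling n : n%:R / (2 * D.+1)%N%:R <= \sum_(0 <= j < 2 ^ n) (1 + (j * D)%N)%:R^-1 :> realalg.
  exists (2 ^ (2 * D.+1 * M))%N; apply: le_trans (doubling _).
  by rewrite natrM mulrC mulKf // pnatr_eq0; lia.
elim: n => [|n IH]; first by rewrite mul0r sumr_ge0 // => j _; rewrite invr_ge0.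
have p0 : (0 < 2 ^ n)%N by rewrite expn_gt0.
rewrite (@big_cat_nat _ _ _ (2 ^ n)) //=; last by rewrite leq_exp2l.
rewrite mulrSr mulrDl mul1r; apply: lerD => //.
apply: le_trans (_ : \sum_(2 ^ n <= j < 2 ^ n.+1) ((2 ^ n * (2 * D.+1))%N)%:R^-1 <= _).
  have -> : (\sum_(2 ^ n <= j < 2 ^ n.+1) ((2 ^ n * (2 * D.+1))%N)%:R^-1 : realalg)
      = (2 * D.+1)%N%:R^-1.
    rewrite sumr_const_nat (_ : 2 ^ n.+1 - 2 ^ n = 2 ^ n)%N; last by rewrite expnS; lia.
    by rewrite -[LHS]mulr_natl natrM invfM mulrA mulfV ?mul1r // pnatr_eq0; lia.
  by [].
rewrite [leLHS]big_nat [leRHS]big_nat; apply: ler_sum => j jn.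
rewrite lef_pV2 ?posrE ?ltr0n ?ler_nat; try lia.
by rewrite expnS in jn; nia.
Qed.

(** Without such a prime the convolution is nonnegative, and at least 1 at the squares of
    [m = 1 + j D], where the weight is [1 / m]. The weighted sum would then dominate an unbounded
    harmonic sum, against [hyperbola_bound]. *)
Theorem split_prime_exists : exists p, [/\ prime p, psi p = -1 & phi p = -1].
Proof.
apply: contrapT => none.
have no_split p : prime p -> ~ (psi p = -1 /\ phi p = -1).
  by move=> prp [h1 h2]; apply: none; exists p.
have [J MJ] := harmonic_progression_unbounded (D ^ 2 + 3 * D).+1.
pose X := (1 + J * D)%N.
have X0 : (0 < X)%N by [].
have := hyperbola_bound realalg D_gt0 cpsi cphi npsi nphi X0.
apply/negP; rewrite -ltNge; apply: lt_le_trans (ler_norm _).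
apply: lt_le_trans (_ : (D ^ 2 + 3 * D).+1%:R <= _).
  by rewrite -(natr1 (D ^ 2 + 3 * D)%N) natrD natrX natrM ltrDl.
apply: le_trans MJ _.
pose sq j := ((1 + j * D) ^ 2)%N.
pose f k : realalg := (conv psi phi k)%:~R * (Num.sqrt k%:R)^-1.
apply: le_trans (_ : \sum_(k <- [seq sq j | j <- index_iota 0 J]) f k <= _).
  rewrite big_map; apply: ler_sum => j _; rewrite /f natrX sqrtr_sqr ger0_norm //.
  rewrite ler_peMl ?invr_ge0 // ler1z.
  by apply: conv_sqr cphi _ _ _ _ => //; rewrite /coprime gcdnC addnC gcdnMDl gcdn1.
apply: sum_le_subset; last first.
- move=> k; rewrite mem_index_iota => k0; rewrite mulr_ge0 ?invr_ge0 ?sqrtr_ge0 //.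
  by rewrite ler0z; apply: conv_ge0 cpsi cphi no_split _ _; lia.
- move=> k /mapP[j]; rewrite !mem_index_iota => jJ ->; rewrite /sq /X expn_gt0 /=.
  by rewrite ltnS leq_exp2r // leq_add2l leq_mul2r; lia.
- exact: iota_uniq.
rewrite map_inj_uniq ?iota_uniq // => i j /eqP; rewrite /sq eqn_exp2r // eqn_add2l.
by rewrite eqn_mul2r -(negbK (D == 0)%N) -lt0n D_gt0 => /eqP.
Qed.
End SplitPrime.

(** * The kernel of a real character is generated by primes and squares *)

Section Generation.
Import GroupScope.
Local Open Scope ring_scope.
Variables (D : nat) (chi : nat -> int) (P : nat -> Prop).
Hypotheses (D_gt1 : (1 < D)%N) (cchi : real_char D chi).
Hypothesis P_mod : forall k l, k = l %[mod D] -> P k -> P l.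
Hypothesis P1 : P 1.
Hypothesis P_sqr : forall k x, coprime x D -> P k -> P (k * x ^ 2).
Hypothesis P_split : forall k p, prime p -> coprime p D -> chi p = 1 -> P k -> P (k * p).

Let gT := {unit 'Z_D}.
Let cls (k : nat) : gT := insubd (1%g : gT) (k%:R : 'Z_D).

Let val_cls k : coprime k D -> FinRing.uval (cls k) = (k%:R : 'Z_D).
Proof. by move=> kD; rewrite /cls insubdK // unitZpE // coprime_sym. Qed.

Let clsM k l : coprime k D -> coprime l D -> cls (k * l) = (cls k * cls l)%g.
Proof.
by move=> kD lD; apply/val_inj; rewrite /= !val_cls ?natrM // coprimeMl kD.
Qed.

Let residue (x : gT) : nat := FinRing.uval x.

Let residueK x : (residue x)%:R = FinRing.uval x. Proof. exact: natr_Zp. Qed.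

Let coprime_residue x : coprime (residue x) D.
Proof. by rewrite coprime_sym -unitZpE // residueK; exact: (valP x). Qed.

Let clsK x : cls (residue x) = x.
Proof. by apply/val_inj; rewrite /= val_cls ?residueK. Qed.

Let residue_cls k : coprime k D -> residue (cls k) = (k %% D)%N.
Proof. by move=> kD; rewrite /residue val_cls // val_Zp_nat. Qed.

Let cls_modn k : coprime k D -> cls (k %% D) = cls k.
Proof. by move=> kD; rewrite -residue_cls // clsK. Qed.

Let stab : {set gT} := [set x | `[< forall k, P k -> P (k * residue x) >]].

Let stabP x : reflect (forall k, P k -> P (k * residue x)) (x \in stab).
Proof. by rewrite inE; apply: asboolP. Qed.

Let stab_group_set : group_set stab.
Proof.
apply/group_setP; split=> [|x y /stabP hx /stabP hy]; apply/stabP => k Pk.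
  have -> : 1%g = cls 1 by apply/val_inj; rewrite /= val_cls ?coprime1n.
  by apply: P_mod Pk; rewrite residue_cls ?coprime1n // modnMmr muln1.
apply: P_mod (hy _ (hx _ Pk)); apply/esym.
have -> : residue (x * y)%g = ((residue x * residue y) %% D)%N.
  by rewrite -residue_cls ?coprimeMl ?coprime_residue // clsM ?coprime_residue // !clsK.
by rewrite modnMmr mulnA.
Qed.

Let H := Group stab_group_set.

(** Otherwise a subgroup [M] containing the stabilizer [H] of [P], and maximal among those avoiding
    the class of [u], has index 2, since [H] contains all squares. Its sign character [psi] and
    [phi = psi * chi] are both -1 at [u], hence at some prime [p]; then [chi p = 1] puts the class
    of [p] into [H], against [psi p = -1]. *)
Lemma generated_by_split u : coprime u D -> chi u = 1 -> P u.
Proof.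
move=> uD chiu; apply: contrapT => nPu.
have uH : cls u \notin H.
  apply/stabP => /(_ 1%N P1); rewrite mul1n residue_cls //.
  by move=> Pu; apply: nPu; apply: P_mod Pu; rewrite modn_mod.
have sqrH x : (x ^+ 2)%g \in H.
  apply/stabP => k Pk; have := P_sqr (coprime_residue x) Pk; apply: P_mod.
  have -> : residue (x ^+ 2)%g = ((residue x ^ 2) %% D)%N.
    by rewrite -residue_cls ?coprimeXl ?coprime_residue // -mulnn clsM ?coprime_residue // !clsK.
  by rewrite modnMmr.
pose avoids (M : {set gT}) := (H \subset M) && (cls u \notin M).
have [M /maxgroupP[/andP[HM uM] Mmax] _] :
    {M : {group gT} | maxgroup M avoids & H \subset M}.
  by apply: maxgroup_exists; rewrite /avoids subxx.
(* As [z ^ 2] is in [M], the union of [M] and [M z] is a subgroup; by maximality it contains the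
   class of [u], which therefore lies in [M z]. *)
have coset_u z : z \notin M -> (cls u * z)%g \in M.
  move=> zM; pose Mz := (M :|: M :* z)%g.
  have zz : (z * z)%g \in M by apply: (subsetP HM); exact: (sqrH z).
  have comm x y : (x * y = y * x :> gT)%g by apply/val_inj; rewrite /= mulrC.
  have Mz_group : group_set Mz.
    apply/group_setP; split=> [|x y]; first by rewrite inE group1.
    have zP t : t \in Mz -> t \in M \/ exists2 m, m \in M & t = (m * z)%g.
      by rewrite inE => /orP[|/rcosetP[m]]; [left|right; exists m].
    have Mz_mul m : m \in M -> (m * z)%g \in Mz.
      by move=> mM; rewrite inE mem_rcoset mulgK mM orbT.
    have MMz m : m \in M -> m \in Mz by move=> mM; rewrite inE mM.
    move=> /zP[xM|[x' xM ->]] /zP[yM|[y' yM ->]].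
    - by rewrite MMz ?groupM.
    - by rewrite mulgA Mz_mul ?groupM.
    - by rewrite -mulgA (comm z) mulgA Mz_mul ?groupM.
    - have -> : (x' * z * (y' * z))%g = (x' * y' * (z * z))%g by apply/val_inj => /=; ring.
      by apply: MMz; apply: groupM zz; apply: groupM.
  have uMz : cls u \in Mz.
    apply: contraNT zM => uMz; have := Mmax (Group Mz_group); rewrite /avoids uMz andbT /=.
    move=> <- //; first by rewrite inE mem_rcoset mulgV group1 orbT.
    - by apply: subset_trans HM (subsetUl _ _).
    - exact: subsetUl.
  move: uMz; rewrite inE (negPf uM) => /rcosetP[m mM ->].
  by rewrite -mulgA groupM.
have mulM x y : x \notin M -> y \notin M -> (x * y)%g \in M.
  move=> /coset_u hx /coset_u hy; have := groupM hx hy.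
  have -> : (cls u * x * (cls u * y))%g = (cls u ^+ 2 * (x * y))%g.
    by apply/val_inj; rewrite /=; ring.
  by rewrite groupMl // (subsetP HM) ?sqrH.
pose psi k : int := if coprime k D then (if cls k \in M then 1 else -1) else 0.
have cpsi : real_char D psi.
  split=> [k|k l|k]; rewrite /psi.
  - have e : coprime (k + D) D = coprime k D by rewrite /coprime gcdnC gcdnDr gcdnC.
    rewrite e; case: ifP => // kD.
    by rewrite -[cls k]cls_modn // -[cls (k + D)]cls_modn ?e // modnDr.
  - rewrite coprimeMl; case: (boolP (coprime k D)) => kD /=; last by rewrite mul0r.
    case: (boolP (coprime l D)) => lD /=; last by rewrite mulr0.
    rewrite clsM //; have [kM|kM] := boolP (cls k \in M).
      by rewrite groupMl // mul1r.
    have [lM|lM] := boolP (cls l \in M); last by rewrite mulM // mulN1r opprK.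
    by rewrite groupMr // (negPf kM) mulr1.
  - by case: coprime; [case: ifP|].
pose phi k := psi k * chi k.
have cphi : real_char D phi.
  have [perp mulp sqrp] := cpsi; have [perc mulc sqrc] := cchi.
  split=> [k|k l|k]; rewrite /phi ?perp ?perc ?mulp ?mulc ?exprMn ?sqrp ?sqrc //; first by ring.
  by case: coprime.
have psiu : psi u = -1 by rewrite /psi uD (negPf uM).
have phiu : phi u = -1 by rewrite /phi psiu chiu mulr1.
have D_gt0 : (0 < D)%N by exact: ltnW.
have [p [prp psip phip]] := split_prime_exists D_gt0 cpsi cphi
   (ex_intro _ u psiu) (ex_intro _ u phiu).
have chip : chi p = 1 by move: phip; rewrite /phi psip; lia.
have pD : coprime p D by move: psip; rewrite /psi; case: ifP.
have : cls p \in M.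
  apply: (subsetP HM); apply/stabP => k Pk.
  have := P_split prp pD chip Pk; apply: P_mod.
  by rewrite residue_cls // modnMmr.
by move: psip; rewrite /psi pD; case: ifP.
Qed.
End Generation.

(** * The Jacobi character *)

Lemma real_charM D1 D2 psi phi : real_char D1 psi -> real_char D2 phi ->
  real_char (D1 * D2) (fun k => psi k * phi k).
Proof.
move=> cpsi cphi; have [_ psiM sqpsi] := cpsi; have [_ phiM sqphi] := cphi.
split=> [k|k l|k].
- rewrite -(real_char_modn (k + _) cpsi) -(real_char_modn (k + _) cphi) ![(k + _)%N]addnC.
  by rewrite modnMDl {1}mulnC modnMDl !real_char_modn.
- by rewrite psiM phiM; ring.
- by rewrite exprMn sqpsi sqphi coprimeMr -mulnb natrM.
Qed.

(** The Jacobi symbol (2 / n) for odd [n]; at even [n] the value 1 is a default, whence the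
    restriction in [char2M]. *)
Definition char2 (n : nat) : int := if (n %% 8 == 3)%N || (n %% 8 == 5)%N then -1 else 1.

Lemma odd_mod8 n : odd n -> [\/ n %% 8 = 1, n %% 8 = 3, n %% 8 = 5 | n %% 8 = 7]%N.
Proof.
move=> on; have : (n %% 8 < 8)%N by rewrite ltn_mod.
have : odd (n %% 8) by rewrite (_ : (n %% 8 = n - n %/ 8 * 8)%N); lia.
by case: (n %% 8)%N => [|[|[|[|[|[|[|[|//]]]]]]]] //;
  [constructor 1|constructor 2|constructor 3|constructor 4].
Qed.

Lemma char2M : {in odd &, {morph char2 : k l / (k * l)%N >-> k * l}}.
Proof.
move=> k l; rewrite !unfold_in => ok ol; rewrite /char2 -(modnMm k l 8).
by case: (odd_mod8 ok) => ->; case: (odd_mod8 ol) => ->.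
Qed.

Lemma sign_half_mod8 n : (-1) ^+ n./2 = (if odd (n %% 8)./2 then -1 else 1) :> int.
Proof.
rewrite -signr_odd (_ : odd n./2 = odd (n %% 8)./2); first by case: odd.
by rewrite {1}(divn_eq n 8); lia.
Qed.

Lemma sign_halfM : {in odd &, {morph (fun k => (-1) ^+ k./2 : int) : k l / (k * l)%N >-> k * l}}.
Proof.
move=> k l; rewrite !unfold_in => ok ol /=; rewrite !sign_half_mod8 -(modnMm k l 8).
by case: (odd_mod8 ok) => ->; case: (odd_mod8 ol) => ->.
Qed.

Lemma legendre2_char2 p : prime p -> odd p -> legendre (2%:R : 'F_p) = char2 p.
Proof.
move=> prp op; rewrite legendre2 // /char2 -signr_odd.
have -> : odd (p./2 - p./2./2) = (p %% 8 == 3)%N || (p %% 8 == 5)%N.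
  have e : (p = p %/ 8 * 8 + p %% 8)%N by exact: divn_eq.
  by case: (odd_mod8 op) => r; rewrite r in e *; rewrite e; lia.
by case: ifP.
Qed.

(* [chi] is the Jacobi symbol [(_ / n)], and [s n] is the associate of [n] congruent to 1 mod 4. *)
Definition jacobi_char (n : nat) (chi : nat -> int) : Prop :=
  [/\ real_char n chi,
      forall k, (n %| k.+1)%N -> chi k = (-1) ^+ n./2,
      chi 2%N = char2 n &
      forall p, prime p -> odd p -> coprime p n ->
        legendre (((-1) ^+ n./2 * n%:Z)%:~R : 'F_p) = chi p].

(** The sign in quadratic reciprocity is absorbed by [(-1) ^+ l./2], whose Legendre symbol modulo
    [p] is [(-1) ^+ (p./2 * l./2)]. *)
Lemma jacobi_char_prime l : prime l -> odd l ->
  jacobi_char l (fun k => legendre (k%:R : 'F_l)).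
Proof.
move=> prl ol; split=> [|k /dvdnP[c kc]||p prp op pl].
- split=> [k|k m|k].
  + by rewrite natrD pchar_Fp_0 // addr0.
  + by rewrite natrM legendreM.
  + have F0 : ((k%:R : 'F_l) == 0) = (l %| k)%N by rewrite -(dvdn_pcharf (pchar_Fp prl)).
    rewrite coprime_sym prime_coprime // -F0; have [->|k0] := eqVneq (k%:R : 'F_l) 0.
      by rewrite legendre0.
    by case: (legendre_cases k0) => ->.
- rewrite -legendreN1 //; congr legendre.
  by apply/eqP; rewrite -subr_eq0 opprK natr1 kc natrM pchar_Fp_0 // mulr0.
- exact: legendre2_char2.
- have pl' : l != p by apply: contraTneq pl => ->; rewrite /coprime gcdnn; have := prime_gt1 prp; lia.
  rewrite rmorphM rmorphXn rmorphN1 /= legendreM // pmulrn quadratic_reciprocity //; last by rewrite eq_sym.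
  have -> : legendre ((-1) ^+ l./2 : 'F_p) = (-1) ^+ (p./2 * l./2).
    rewrite exprM -legendreN1 //; elim: l./2 => [|i IH]; first by rewrite legendre1.
    by rewrite exprS legendreM // IH exprS.
  by rewrite mulrA -expr2 sqrr_sign mul1r.
Qed.

Lemma jacobi_charM m n chi phi : odd m -> odd n ->
  jacobi_char m chi -> jacobi_char n phi -> jacobi_char (m * n) (fun k => chi k * phi k).
Proof.
move=> om on [cchi m1 m2 ml] [cphi n1 n2 nl]; split=> [|k mnk||p prp op].
- exact: real_charM.
- rewrite m1 ?n1 ?sign_halfM //.
    by apply: dvdn_trans mnk; apply: dvdn_mull.
  by apply: dvdn_trans mnk; apply: dvdn_mulr.
- by rewrite m2 n2 char2M.
- rewrite coprimeMr => /andP[pm pn]; rewrite -ml // -nl // -legendreM // sign_halfM //.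
  by congr legendre; rewrite -rmorphM /= PoszM; congr (_%:~R); ring.
Qed.

Lemma jacobi_char_exists n : odd n -> exists chi, jacobi_char n chi.
Proof.
elim/ltn_ind: n => n IH on; have [n1|n1] := leqP n 1.
  have -> : n = 1%N by lia.
  exists (fun=> 1); split=> // [|p prp op _].
    by split=> // k; rewrite coprimen1.
  by rewrite expr0 mul1r legendre1.
have prp := pdiv_prime n1; have /dvdnP[m nm] := pdiv_dvd n.
have [om op] : odd m /\ odd (pdiv n) by move: on; rewrite {1}nm oddM => /andP.
have mn : (m < n)%N.
  rewrite [ltnRHS]nm -{1}[m]muln1 ltn_pmul2l ?prime_gt1 //.
  by case: m om {nm} => [|].
have [chi cchi] := IH m mn om.
exists (fun k => chi k * legendre (k%:R : 'F_(pdiv n))).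
by rewrite {1}nm; apply: jacobi_charM => //; apply: jacobi_char_prime.
Qed.

(** * Moduli for which a given negative number is a quadratic residue *)

Lemma real_char_mod8 (f : nat -> int) :
  [/\ f 1%N ^+ 2 = 1, f 3%N ^+ 2 = 1, f 5%N ^+ 2 = 1 & f 7%N ^+ 2 = 1] ->
  {in [:: 1; 3; 5; 7]%N &, forall k l, f ((k * l) %% 8)%N = f k * f l} ->
  real_char 8 (fun k => if odd k then f (k %% 8)%N else 0).
Proof.
move=> [f1 f3 f5 f7] fM; split=> [k|k l|k].
- by rewrite oddD addbF modnDr.
- rewrite oddM; case: (boolP (odd k)) => ok; last by rewrite mul0r.
  case: (boolP (odd l)) => ol; last by rewrite mulr0.
  rewrite /= -(modnMm k l 8).
  by apply: fM; [case: (odd_mod8 ok) => ->|case: (odd_mod8 ol) => ->].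
- rewrite (@coprime_pexpr 3 k 2) // coprimen2; case: (boolP (odd k)) => ok //.
  by case: (odd_mod8 ok) => ->.
Qed.

Definition residue_at (n q : nat) : Prop := exists B, (q %| B ^ 2 + n)%N.

(** The product in the hypothesis is the Legendre symbol of [- 2 ^ e * n] modulo [p], factored into
    the symbols of [- (-1) ^+ n./2], of [2 ^ e] and of [(-1) ^+ n./2 * n]. *)
Lemma residue_at_split n chi p : odd n -> jacobi_char n chi ->
  forall e : bool, prime p -> coprime p (8 * n) ->
  (if odd n./2 then 1 else (-1) ^+ p./2 : int) *
    (if e then char2 p else 1) * chi p = 1 ->
  residue_at (2 ^ e * n) p.
Proof.
move=> on [_ _ _ chiE] e prp; rewrite coprimeMr (@coprime_pexpr 3 p 2) // coprimen2.
move=> /andP[op pn] h.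
have : legendre ((- (2 ^ e * n)%:Z)%:~R : 'F_p) = 1.
  have -> : - (2 ^ e * n)%:Z = - (-1) ^+ n./2 * 2%:Z ^+ e * ((-1) ^+ n./2 * n%:Z).
    have := sqrr_sign int n./2; case: e {h} => /=; rewrite PoszM; nia.
  rewrite rmorphM rmorphM /= !legendreM // chiE // -[RHS]h; congr (_ * _ * _).
    rewrite -[(-1) ^+ n./2]signr_odd; case: (odd n./2).
      by rewrite expr1 opprK legendre1.
    by rewrite expr0 rmorphN1 legendreN1.
  by case: e {h} => /=; rewrite ?legendre1 // -legendre2_char2.
move=> /(legendre_sqr prp op)[y ye].
exists (val y); rewrite (dvdn_pcharf (pchar_Fp prp)) natrD natrX natr_Zp -ye.
by rewrite rmorphN /= addNr.
Qed.

Lemma coprime_neg_inv y n : (0 < n)%N -> coprime n y -> exists z, (n %| 1 + z * y)%N.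
Proof.
by move=> n0 ny; have [z _] := Bezoutl y n0; rewrite (eqP ny); exists z.
Qed.

(** For [z = - 1 / y] modulo [n], the unit [y ^ 2] times [z ^ 2 + q] is [1 + q * y ^ 2]. *)
Lemma residue_of_inverse n q y : (0 < n)%N -> coprime n y -> (n %| q * y ^ 2 + 1)%N ->
  exists z, (n %| z ^ 2 + q)%N.
Proof.
move=> n0 ny nq; have [z nz] := coprime_neg_inv n0 ny; exists z.
rewrite -(@Gauss_dvdr _ (y ^ 2)); last by rewrite coprimeXr.
have e : (y ^ 2 * (z ^ 2 + q) + (z * y + 1) = (q * y ^ 2 + 1) + (z * y) * (1 + z * y))%N by ring.
have h2 : (n %| z * y + 1)%N by rewrite addnC.
by rewrite -(dvdn_addl _ h2) e dvdn_add ?dvdn_mull.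
Qed.

(** This is [generated_by_split] for [chi] times a character modulo 8, together the symbol of
    [- 2 ^ e * n]. The factor [y ^ 2] makes the property stable under multiplication by squares. *)
Lemma residue_generation (n : nat) (e : bool) u chi : odd n -> jacobi_char n chi ->
  coprime u (8 * n) ->
  (if odd n./2 then 1 else (-1) ^+ u./2 : int) *
    (if e then char2 u else 1) * chi u = 1 ->
  exists q y, [/\ (0 < q)%N, coprime y (8 * n), residue_at (2 ^ e * n) q &
    q * y ^ 2 = u %[mod 8 * n]].
Proof.
move=> on jchi; have [cchi _ _ _] := jchi.
pose f k : int := (if odd n./2 then 1 else (-1) ^+ k./2) *
                  (if e then char2 k else 1).
pose chi8 k : int := if odd k then f (k %% 8)%N else 0.
have f8 k : odd k -> chi8 k = f k.
  by rewrite /chi8 /f => ->; rewrite !sign_half_mod8 /char2 modn_mod.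
have cchi8 : real_char 8 chi8.
  apply: real_char_mod8.
    by rewrite /f /char2; case: ifP => _; case: (e).
  move=> k l; rewrite !inE /f => kh lh.
  have ok : odd k by move: kh; do 3!case: eqP => [->//|_] /=; move/eqP->.
  have ol : odd l by move: lh; do 3!case: eqP => [->//|_] /=; move/eqP->.
  rewrite !sign_half_mod8 /char2 modn_mod -(modnMm k l 8).
  by case: (odd_mod8 ok) => ->; case: (odd_mod8 ol) => ->; case: ifP => _; case: (e).
have n0 : (0 < n)%N by exact: odd_gt0.
have cc := real_charM cchi8 cchi.
have odd8 k : coprime k (8 * n) -> odd k.
  by rewrite coprimeMr (@coprime_pexpr 3 k 2) // coprimen2 => /andP[].
move=> uD hu.
pose P k := exists q y, [/\ (0 < q)%N, coprime y (8 * n), residue_at (2 ^ e * n) q &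
    q * y ^ 2 = k %[mod 8 * n]].
apply: (@generated_by_split (8 * n) _ P _ cc) => //; last by rewrite f8 ?odd8 //.
- lia.
- by move=> k l kl [q [y [q0 yD rq qk]]]; exists q, y; rewrite -kl.
- by exists 1%N, 1%N; split; rewrite ?coprime1n //; exists 0%N; rewrite dvd1n.
- move=> k x xD [q [y [q0 yD rq qk]]]; exists q, (y * x)%N; split=> //.
    by rewrite coprimeMl yD.
  by rewrite expnMn mulnA -modnMml qk modnMml.
move=> k p prp pD chip [q [y [q0 yD [B qB] qk]]].
have [b pb] : residue_at (2 ^ e * n) p.
  by apply: (residue_at_split on jchi) => //; rewrite -/(f p) -f8 ?odd8.
(* If [p] already divides [q], it moves from [q] into [y], because
   [q' p * p * y ^ 2 = q' * (y p) ^ 2]; no solution has to be lifted to a power of [p]. *)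
have [/dvdnP[q' qE]|pq] := boolP (p %| q)%N.
  exists q', (y * p)%N; rewrite qE muln_gt0 in q0; have /andP[q'0 _] := q0.
  split=> //; first by rewrite coprimeMl yD.
    by exists B; apply: dvdn_trans qB; rewrite qE dvdn_mulr.
  by rewrite -[RHS]modnMml -qk modnMml qE expnMn; congr (_ %% _)%N; ring.
exists (q * p)%N, y; split=> //; first by rewrite muln_gt0 q0 prime_gt0.
  have qp : coprime q p by rewrite coprime_sym prime_coprime.
  exists (chinese q p B b); rewrite Gauss_dvd //; apply/andP; split.
    by rewrite /dvdn -modnDml -modnXm chinese_modl // modnXm modnDml.
  by rewrite /dvdn -modnDml -modnXm chinese_modr // modnXm modnDml.
by rewrite mulnAC -modnMml qk modnMml.
Qed.

Lemma chinese_unit n c r : odd c -> (c < 8)%N -> odd n -> coprime r n ->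
  exists u, [/\ coprime u (8 * n), u %% 8 = c & u = r %[mod n]]%N.
Proof.
move=> oc c8 on rn; have n8 : coprime 8 n by rewrite (@coprime_pexpl 3 2) // coprime2n.
have u8 : (chinese 8 n c r %% 8 = c)%N by rewrite chinese_modl // modn_small.
exists (chinese 8 n c r); split=> //; last by rewrite chinese_modr.
rewrite coprimeMr (@coprime_pexpr 3 _ 2) // coprimen2; apply/andP; split.
  by rewrite (divn_eq (chinese 8 n c r) 8) u8 oddD oddM andbF.
by rewrite -coprime_modl chinese_modr // coprime_modl.
Qed.

Lemma coprime_mulr_sqr q y u D n : coprime u D -> (n %| D)%N ->
  q * y ^ 2 = u %[mod D] -> coprime q n /\ coprime n y.
Proof.
move=> uD nD e; have : coprime (q * y ^ 2) D by rewrite -coprime_modl e coprime_modl.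
move/(coprime_dvdr nD); rewrite coprimeMl => /andP[-> h]; split=> //.
by move: h; rewrite coprime_sym coprime_pexpr.
Qed.

Lemma dvdn_modS n q y u D : (n %| D)%N -> q * y ^ 2 = u %[mod D] ->
  forall a, (n %| a * u + 1)%N -> (n %| a * q * y ^ 2 + 1)%N.
Proof.
move=> nD e a nu.
have en : q * y ^ 2 = u %[mod n] by rewrite -(modn_dvdm (q * y ^ 2) nD) e modn_dvdm.
by rewrite /dvdn -modnDml -mulnA -modnMmr en modnMmr modnDml.
Qed.

(** Adding the odd [q] to [B] if necessary makes [B ^ 2 + n] even. *)
Lemma residue_at_odd n q : odd n -> odd q -> residue_at n q -> residue_at n (2 * q).
Proof.
move=> on oq [B qB].
have [B' oB' qB'] : exists2 B', odd B' & (q %| B' ^ 2 + n)%N.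
  have [oB|oB] := boolP (odd B); first by exists B.
  exists (B + q)%N; first by rewrite oddD (negPf oB).
  have -> : ((B + q) ^ 2 + n = (B ^ 2 + n) + (B * 2 + q) * q)%N by ring.
  by rewrite dvdn_add // dvdn_mull.
by exists B'; rewrite Gauss_dvd ?coprime2n // qB' andbT dvdn2 oddD oddX oB' on.
Qed.

Lemma odd_half_mod8 n : odd n -> odd n./2 -> (n %% 8)%N \in [:: 1; 2; 3; 5; 6]%N ->
  (n %% 8 = 3)%N.
Proof. by rewrite !inE; lia. Qed.

Lemma even_mod8 n : ~~ odd n -> (n %% 8)%N \in [:: 1; 2; 3; 5; 6]%N ->
  n = (2 * n./2)%N /\ odd n./2.
Proof. by rewrite !inE; lia. Qed.

Lemma residue_pair (n : nat) : (n %% 8)%N \in [:: 1; 2; 3; 5; 6]%N ->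
  exists q k, [/\ (0 < q)%N, coprime q n, residue_at n q & (n %| k ^ 2 + q)%N].
Proof.
move=> n8.
have [on|en] := boolP (odd n).
  have nh : (2 * n./2 + 1 = n)%N by lia.
  have n_gt0 := odd_gt0 on; have [chi jchi] := jacobi_char_exists on.
  have [_ chiN1 chi2 _] := jchi; have [[_ chiM _] _ _ _] := jchi.
  have nD : (n %| 8 * n)%N by exact: dvdn_mull.
  have [on2|en2] := boolP (odd n./2).
  - have n3 := odd_half_mod8 on on2 n8.
    (* For [n = 3 mod 8] the number sought is [2 q], so [u] is [- 1 / 2] modulo [n], that is
       [(n - 1) / 2]. Both [chi 2] and [chi (-1)] are -1, hence [chi u = 1]. *)
    have cop : coprime n./2 n.
      by rewrite -{2}nh /coprime gcdnMDl gcdn1.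
    have [u [uD u8 un]] := @chinese_unit n 1 n./2 isT isT on cop.
    have nu : (n %| 2 * u + 1)%N.
      rewrite /dvdn -modnDml -modnMmr un modnMmr modnDml.
      by rewrite nh modnn.
    have chiu : chi u = 1.
      have := chiN1 (2 * u)%N; rewrite -addn1 => /(_ nu).
      by rewrite chiM chi2 /char2 n3 /= -signr_odd on2 expr1 mulN1r => /oppr_inj.
    have [|q [y [q0 yD rq qu]]] := @residue_generation n false u chi on jchi uD.
      by rewrite on2 chiu.
    rewrite mul1n in rq; have [qn ny] := coprime_mulr_sqr uD nD qu.
    have oq : odd q.
      have [] := coprime_mulr_sqr uD (dvdn_mulr n (isT : 2 %| 8)%N) qu.
      by rewrite coprimen2.
    have [k nk] := residue_of_inverse n_gt0 ny (dvdn_modS nD qu nu).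
    exists (2 * q)%N, k; split=> //; first by rewrite muln_gt0.
      by rewrite coprimeMl qn coprime2n on.
    exact: residue_at_odd.
  - have cop : coprime n.-1 n by rewrite coprime_sym -{1}(prednK n_gt0) coprimeSn.
    have [u [uD u8 un]] := @chinese_unit n 1 n.-1 isT isT on cop.
    have nu : (n %| 1 * u + 1)%N.
      by rewrite mul1n /dvdn -modnDml un modnDml addn1 prednK // modnn.
    have chiu : chi u = 1.
      rewrite chiN1; first by rewrite -signr_odd (negPf en2).
      by rewrite -addn1 -[u]mul1n.
    have [|q [y [q0 yD rq qu]]] := @residue_generation n false u chi on jchi uD.
      by rewrite (negPf en2) chiu sign_half_mod8 u8.
    rewrite mul1n in rq; have [qn ny] := coprime_mulr_sqr uD nD qu.
    have := dvdn_modS nD qu nu; rewrite mul1n => /(residue_of_inverse n_gt0 ny)[k nk].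
    by exists q, k.
have [m nm om] : exists2 m, n = (2 * m)%N & odd m.
  by exists n./2; have [] := even_mod8 en n8.
have m_gt0 := odd_gt0 om; have [chi jchi] := jacobi_char_exists om.
have [_ chiN1 _ _] := jchi.
have mD : (m %| 8 * m)%N by exact: dvdn_mull.
have cop : coprime m.-1 m by rewrite coprime_sym -{1}(prednK m_gt0) coprimeSn.
(* For [n = 2 m] and [u = -1] modulo [m], [c] is the residue modulo 8 that makes the symbol of
   [- 2 m] equal to 1: when [m = 3 mod 4], [chi u = -1] is compensated by [char2 3 = -1]. *)
pose c := if odd m./2 then 3%N else 1%N.
have oc : odd c by rewrite /c; case: ifP.
have c8 : (c < 8)%N by rewrite /c; case: ifP.
have [u [uD u8 un]] := @chinese_unit m c m.-1 oc c8 om cop.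
have mu : (m %| 1 * u + 1)%N.
  by rewrite mul1n /dvdn -modnDml un modnDml addn1 prednK // modnn.
have chiu : chi u = (-1) ^+ m./2 by rewrite chiN1 // -addn1 -[u]mul1n.
have [|q [y [q0 yD rq qu]]] := @residue_generation m true u chi om jchi uD.
  rewrite chiu (sign_half_mod8 u) /char2 u8 -[(-1) ^+ m./2]signr_odd /c.
  by case: (odd m./2).
have [qm my] := coprime_mulr_sqr uD mD qu.
have oq : odd q.
  have [] := coprime_mulr_sqr uD (dvdn_mulr m (isT : 2 %| 8)%N) qu.
  by rewrite coprimen2.
have := dvdn_modS mD qu mu; rewrite mul1n => /(residue_of_inverse m_gt0 my)[k mk].
have [k' ok' mk'] : exists2 k', odd k' & (m %| k' ^ 2 + q)%N.
  have [ok|ok] := boolP (odd k); first by exists k.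
  exists (k + m)%N; first by rewrite oddD (negPf ok).
  have -> : ((k + m) ^ 2 + q = (k ^ 2 + q) + (k * 2 + m) * m)%N by ring.
  by rewrite dvdn_add // dvdn_mull.
exists q, k'; rewrite nm; split=> //.
  by rewrite coprimeMr qm coprimen2 oq.
by rewrite Gauss_dvd ?coprime2n // mk' andbT dvdn2 oddD oddX ok' oq.
Qed.

(** * The three squares theorem *)

Section ThreeSquares.
Local Open Scope Z_scope.

Definition three_squares (n : Z) : Prop := exists x y z, n = x * x + y * y + z * z.

Lemma nearest_multiple (a b : Z) : 0 < a -> exists t, - a <= 2 * (b + t * a) <= a.
Proof.
move=> a0; exists (- ((2 * b + a) / (2 * a))).
have := Z.div_mod (2 * b + a) (2 * a); have := Z.mod_pos_bound (2 * b + a) (2 * a).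
set d := (2 * b + a) / (2 * a); set r := (2 * b + a) mod (2 * a); nia.
Qed.

Lemma Z_strong_ind (P : Z -> Prop) :
  (forall a, 0 < a -> (forall b, 0 < b < a -> P b) -> P a) -> forall a, 0 < a -> P a.
Proof.
move=> H a a0; have : 0 <= a by lia.
move=> an; pattern a; move: a0; pattern a; apply: (Z_lt_induction _ _ a an) => x IH x0.
by apply: H => // b [b0 bx]; apply: IH; lia.
Qed.

Lemma binary_reduction (D A : Z) : 0 < D -> 0 < A -> forall B C, A * C - B * B = D ->
  exists p q r s, [/\ p * s - q * r = 1, 0 < A * p * p + 2 * B * p * r + C * r * r &
    3 * (A * p * p + 2 * B * p * r + C * r * r) ^ 2 <= 4 * D].
Proof.
move=> D0; move: A; apply: Z_strong_ind => A A0 IH B C disc.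
have [t [t1 t2]] := nearest_multiple B A0.
set B' := B + t * A in t1 t2; set C' := A * t * t + 2 * B * t + C.
have disc' : A * C' - B' * B' = D by rewrite -disc /B' /C'; ring.
have C'0 : 0 < C' by nia.
have [AC|CA] := Z.le_gt_cases A C'.
  exists 1, 0, 0, 1; split; [ring|lia|].
  have BB : 4 * (B' * B') <= A * A by nia.
  nia.
have [p [q [r [s [det pos bound]]]]] := IH C' (conj C'0 CA) (- B') A
  (ltac:(rewrite -disc'; ring) : C' * A - - B' * - B' = D).
exists (t * p - r), (t * q - s), p, q.
have e : A * (t * p - r) * (t * p - r) + 2 * B * (t * p - r) * p + C * p * p
  = C' * p * p + 2 * - B' * p * r + A * r * r by rewrite /C' /B'; ring.
by rewrite e; split=> //; rewrite -det; ring.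
Qed.

(** The form of the symmetric matrix with rows [a, b, c], then [b, d, e], then [c, e, f]. *)
Definition ternary (a b c d e f x y z : Z) : Z :=
  a * x * x + d * y * y + f * z * z + 2 * (b * x * y + c * x * z + e * y * z).

Definition ternary_det (a b c d e f : Z) : Z :=
  a * d * f + 2 * b * c * e - a * e * e - d * c * c - f * b * b.

(** The binary form with coefficients [a d - b ^ 2], [a e - b c], [a f - c ^ 2] has determinant [a];
    its reduction gives [A = a * d2 - b2 ^ 2] with [3 A ^ 2 <= 4 a], and a translation gives
    [2 |b2| <= a]. If [d2 < a], exchanging two variables lowers [a]; otherwise [3 a ^ 2 <= 4 A],
    which forces [a = 1], and the form is a sum of three squares of linear forms. *)
Lemma unimodular_ternary (a : Z) : 0 < a -> forall b c d e f,
  0 < a * d - b * b -> ternary_det a b c d e f = 1 ->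
  forall x y z, three_squares (ternary a b c d e f x y z).
Proof.
move: a; apply: Z_strong_ind => a a0 IH b c d e f minor det x y z.
have discg : (a * d - b * b) * (a * f - c * c) - (a * e - b * c) * (a * e - b * c) = a.
  by rewrite -[RHS]Z.mul_1_r -det /ternary_det; ring.
have [p [q [r [s [ps]]]]] := binary_reduction a0 minor discg.
set b1 := b * p + c * r; set c1 := b * q + c * s.
set d1 := d * p * p + 2 * e * p * r + f * r * r.
set e1 := d * p * q + e * (p * s + q * r) + f * r * s.
set f1 := d * q * q + 2 * e * q * s + f * s * s.
have [t [t1 t2]] := nearest_multiple b1 a0.
set b2 := b1 + t * a in t1 t2; set d2 := d1 + 2 * t * b1 + t * t * a.
set e2 := e1 + t * c1.
have -> : (a * d - b * b) * p * p + 2 * (a * e - b * c) * p * r + (a * f - c * c) * r * r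
  = a * d2 - b2 * b2 by rewrite /d2 /b2 /d1 /b1; ring.
set A := a * d2 - b2 * b2 => A0 A_le.
have det2 : ternary_det a b2 c1 d2 e2 f1 = 1.
  have -> : ternary_det a b2 c1 d2 e2 f1
    = ternary_det a b c d e f * (p * s - q * r) * (p * s - q * r).
    by rewrite /ternary_det /b2 /d2 /e2 /f1 /b1 /c1 /d1 /e1; ring.
  by rewrite det ps.
pose Y := s * y - q * z; pose W := p * z - r * y; pose X := x - t * Y.
have -> : ternary a b c d e f x y z = ternary a b2 c1 d2 e2 f1 X Y W.
  have {1}-> : x = X + t * Y by rewrite /X; ring.
  have {1}-> : y = p * Y + q * W by rewrite -[LHS]Z.mul_1_l -ps /Y /W; ring.
  have {1}-> : z = r * Y + s * W by rewrite -[LHS]Z.mul_1_l -ps /Y /W; ring.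
  by rewrite /ternary /b2 /d2 /e2 /f1 /b1 /c1 /d1 /e1; ring.
have d20 : 0 < d2 by nia.
have [da|ad] := Z.lt_ge_cases d2 a.
  have -> : ternary a b2 c1 d2 e2 f1 X Y W = ternary d2 b2 e2 a c1 f1 Y X W.
    by rewrite /ternary; ring.
  apply: IH; first by split.
    by rewrite Z.mul_comm.
  by rewrite -det2 /ternary_det; ring.
have b2a : 4 * (b2 * b2) <= a * a by nia.
have aA : 3 * (a * a) <= 4 * A by nia.
have a1 : a = 1.
  have : 9 * (a * a * (a * a)) <= 16 * (A * A) by nia.
  have : 27 * (a * a * (a * a)) <= 64 * a by nia.
  nia.
have b20 : b2 = 0 by lia.
have A1 : A = 1 by nia.
have d21 : d2 = 1 by move: A1; rewrite /A a1 b20; lia.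
exists (X + c1 * W), (Y + e2 * W), W.
move: det2; rewrite a1 b20 d21 /ternary_det /ternary => det2.
have -> : f1 = 1 + c1 * c1 + e2 * e2 by lia.
ring.
Qed.

(** The matrix with rows [al, be, k], then [be, ga, l], then [k, l, n] represents [n] at
    [(0, 0, 1)]. Here [al n = k ^ 2 + q], [be n = B + k l], [ga n = C + l ^ 2] and
    [q C = B ^ 2 + n], so [n] times its determinant collapses to [q C - B ^ 2 = n]. *)
Lemma three_squares_of_residues (n q B k : Z) : 0 < n -> 0 < q ->
  Z.gcd q n = 1 -> (q | B * B + n) -> (n | k * k + q) -> three_squares n.
Proof.
move=> n0 q0 cop [C eC] [al eal].
have [u [v uv]] := Z.gcd_bezout q n 1 cop.
(* [l] solves [q l = k B] modulo [n] *)
pose l := u * (k * B).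
have ql : q * l = k * B - v * n * k * B.
  have -> : q * l = (u * q) * (k * B) by rewrite /l; ring.
  have -> : u * q = 1 - v * n by lia.
  ring.
have [be ebe] : (n | B + k * l).
  have nq : (n | q * (B + k * l)).
    exists (al * B - v * k * k * B).
    have -> : q * (B + k * l) = q * B + k * (q * l) by ring.
    rewrite ql; have -> : q * B + k * (k * B - v * n * k * B) = (k * k + q) * B - v * n * k * k * B by ring.
    by rewrite eal; ring.
  by apply: Z.gauss nq _; rewrite Z.gcd_comm.
have [ga ega] : (n | C + l * l).
  have nq : (n | (q * q) * (C + l * l)).
    exists (q + al * (B * B) + (- 2 * v * k * B + v * v * n * k * B) * (k * B)).
    have -> : q * q * (C + l * l) = q * (C * q) + (q * l) * (q * l) by ring.
    rewrite -eC ql.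
    have -> : al * (B * B) = al * B * B by ring.
    have e : al * n * (B * B) = (k * k + q) * (B * B) by rewrite eal.
    have -> : (q + al * B * B + (-2 * v * k * B + v * v * n * k * B) * (k * B)) * n
      = q * n + al * n * (B * B) + (-2 * v * k * B + v * v * n * k * B) * (k * B) * n by ring.
    by rewrite e; ring.
  apply: Z.gauss nq _; have nq1 : rel_prime n q by apply/Zgcd_1_rel_prime; rewrite Z.gcd_comm.
  by apply/Zgcd_1_rel_prime; apply: rel_prime_mult.
have kk : 0 <= k * k by exact: Z.square_nonneg.
have al0 : 0 < al by apply/(Z.mul_pos_cancel_r _ n n0); rewrite -eal; lia.
have qC : q * C = B * B + n by lia.
have minor : 0 < al * ga - be * be.
  have : q * (n * n * (al * ga - be * be)) = n * q + (q * l - B * k) * (q * l - B * k) + n * (k * k).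
    have -> : q * (n * n * (al * ga - be * be)) = q * ((al * n) * (ga * n) - (be * n) * (be * n)) by ring.
    rewrite -eal -ega -ebe.
    have -> : q * ((k * k + q) * (C + l * l) - (B + k * l) * (B + k * l))
      = (q * C) * (k * k + q) + q * (k * k + q) * (l * l) - q * (B + k * l) * (B + k * l) by ring.
    by rewrite qC; ring.
  have nq : 0 < n * q by exact: Z.mul_pos_pos.
  have nkk : 0 <= n * (k * k) by apply: Z.mul_nonneg_nonneg => //; lia.
  have sq := Z.square_nonneg (q * l - B * k).
  have nn : 0 < n * n by exact: Z.mul_pos_pos.
  move=> e; apply/(Z.mul_pos_cancel_l _ _ nn)/(Z.mul_pos_cancel_l _ _ q0).
  by rewrite e; lia.
have det : ternary_det al be k ga l n = 1.
  have : n * ternary_det al be k ga l n = n.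
    have -> : n * ternary_det al be k ga l n = (al * n) * (ga * n) + 2 * (be * n) * k * l
      - (al * n) * (l * l) - (ga * n) * (k * k) - (be * n) * (be * n) by rewrite /ternary_det; ring.
    rewrite -eal -ega -ebe.
    have -> : (k * k + q) * (C + l * l) + 2 * (B + k * l) * k * l - (k * k + q) * (l * l)
      - (C + l * l) * (k * k) - (B + k * l) * (B + k * l) = q * C - B * B by ring.
    by rewrite qC; ring.
  by move=> e; apply/(Z.mul_cancel_l _ _ n); lia.
have := unimodular_ternary al0 minor det 0 0 1.
by rewrite /ternary; have -> : al * 0 * 0 + ga * 0 * 0 + n * 1 * 1
  + 2 * (be * 0 * 0 + k * 0 * 1 + l * 0 * 1) = n by ring.
Qed.

End ThreeSquares.

Section ThreeSquaresTheorem.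
Local Open Scope Z_scope.

Theorem three_squares_mod8 (n : Z) : 0 < n ->
  n mod 8 = 1 \/ n mod 8 = 2 \/ n mod 8 = 3 \/ n mod 8 = 5 \/ n mod 8 = 6 -> three_squares n.
Proof.
move=> n0 n8; have [N nE] : exists N, n = Z.of_nat N by exists (Z.to_nat n); lia.
have N8 : (N %% 8)%N \in [:: 1; 2; 3; 5; 6]%N.
  have := Z.div_mod n 8; have := Z.mod_pos_bound n 8.
  have := divn_eq N 8; have := ltn_pmod N (isT : 0 < 8)%N.
  move: (N %% 8)%N (N %/ 8)%N (n / 8) (n mod 8) n8 => r d d' r' n8.
  rewrite !inE; lia.
have N0 : (0 < N)%N by lia.
have [q [k [q0 qN [B /dvdnP[C eC]] /dvdnP[a ea]]]] := residue_pair N8.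
have [z /dvdnP[c ec]] := coprime_neg_inv N0 (etrans (coprime_sym N q) qN).
rewrite nE; apply: (@three_squares_of_residues _ (Z.of_nat q) (Z.of_nat B) (Z.of_nat k)).
- lia.
- lia.
- apply: Z.bezout_1_gcd; exists (- Z.of_nat z), (Z.of_nat c); nia.
- exists (Z.of_nat C); nia.
- exists (Z.of_nat a); nia.
Qed.

End ThreeSquaresTheorem.

(** * Linear-quadratic systems *)

Ltac Zify.zify_post_hook ::= ZifyBool.elim_bool_cstr;
  zify_ssreflect.SsreflectZifyInstances.divZ_modZ_to_equations;
  Z.to_euclidean_division_equations.

(** * Three squares with parity and sign conditions *)

Section SumsOfSquares.
Local Open Scope Z_scope.

Lemma square_odd (k : Z) : exists j, (2 * k + 1) * (2 * k + 1) = 8 * j + 1.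
Proof.
have [j e] : exists j, k * k + k = 2 * j.
  have [h|h] : (exists h, k = 2 * h) \/ exists h, k = 2 * h + 1.
  - by have := Z.div_mod k 2; have := Z.mod_pos_bound k 2; case: (Z.eq_dec (k mod 2) 0) => h;
      [left|right]; exists (k / 2); lia.
  - by case: h => h ->; exists (2 * h * h + h); ring.
  - by case: h => h ->; exists (2 * h * h + 3 * h + 1); ring.
exists j; lia.
Qed.

Lemma parity (k : Z) : (exists h, k = 2 * h) \/ exists h, k = 2 * h + 1.
Proof.
by have := Z.div_mod k 2; have := Z.mod_pos_bound k 2; case: (Z.eq_dec (k mod 2) 0) => h;
  [left|right]; exists (k / 2); lia.
Qed.

Lemma three_squares_odd n : 0 < n -> n mod 8 = 3 -> exists a b c,
  n = (2 * a + 1) * (2 * a + 1) + (2 * b + 1) * (2 * b + 1) + (2 * c + 1) * (2 * c + 1).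
Proof.
move=> n0 n8; have [|a [b [c e]]] := three_squares_mod8 n0; first by lia.
have dm := Z.div_mod n 8.
case: (parity a) => -[a' ea]; case: (parity b) => -[b' eb]; case: (parity c) => -[c' ec].
8: by exists a', b', c'; rewrite e ea eb ec.
all: exfalso; have [ja ha] := square_odd a'; have [jb hb] := square_odd b'; have [jc hc] := square_odd c'.
all: subst a b c; lia.
Qed.

Lemma three_squares_2mod4 n : 0 < n -> n mod 4 = 2 -> exists a b c,
  n = (2 * a + 1) * (2 * a + 1) + (2 * b + 1) * (2 * b + 1) + 4 * (c * c).
Proof.
move=> n0 n4; have [|a [b [c e]]] := three_squares_mod8 n0; first by lia.
have dm := Z.div_mod n 4.
case: (parity a) => -[a' ea]; case: (parity b) => -[b' eb]; case: (parity c) => -[c' ec];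
subst a b c; have [ja ea] := square_odd a'; have [jb eb] := square_odd b'; have [jc ec] := square_odd c'.
all: try by exfalso; lia.
- by exists b', c', a'; lia.
- by exists a', c', b'; lia.
- by exists a', b', c'; lia.
Qed.

Lemma three_squares_1mod4 n : 0 < n -> n mod 4 = 1 -> exists a b c,
  n = 4 * (a * a) + 4 * (b * b) + (2 * c + 1) * (2 * c + 1).
Proof.
move=> n0 n4; have [|a [b [c e]]] := three_squares_mod8 n0; first by lia.
have dm := Z.div_mod n 4.
case: (parity a) => -[a' ea]; case: (parity b) => -[b' eb]; case: (parity c) => -[c' ec];
subst a b c; have [ja ea] := square_odd a'; have [jb eb] := square_odd b'; have [jc ec] := square_odd c'.
all: try by exfalso; lia.
- by exists a', b', c'; lia.
- by exists a', c', b'; lia.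
- by exists b', c', a'; lia.
Qed.

(** In a representation of [2 n] by two odd squares and [4 w ^ 2], half the sum and half the
    difference of the odd roots have squares adding up to [n - 2 w ^ 2]; exactly one of them is
    odd. *)
Lemma odd_form_112 n : 0 < n -> n mod 2 = 1 -> exists x y z,
  n = (2 * x + 1) * (2 * x + 1) + 4 * (y * y) + 2 * (z * z).
Proof.
move=> n0 n2; have [||p [q [w e]]] := @three_squares_2mod4 (2 * n); try lia.
have [[h eh]|[h eh]] := parity (p + q).
  have ep : p = 2 * h - q by lia.
  by exists h, (h - q), w; rewrite ep in e; lia.
have ep : p = 2 * h + 1 - q by lia.
by exists (h - q), (h + 1), w; rewrite ep in e; lia.
Qed.

Lemma sign_mod4 f h : f mod 2 = 1 -> h mod 2 = 1 ->
  exists f' k, f' * f' = f * f /\ f' = h + 4 * k.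
Proof.
move=> f2 h2; have := Z.div_mod f 4; have := Z.div_mod h 4; have := Z.mod_pos_bound f 4;
have := Z.mod_pos_bound h 4 => bh bf eh ef.
have [e|e] : f mod 4 = h mod 4 \/ f mod 4 + h mod 4 = 4 by lia.
  by exists f, (f / 4 - h / 4); split; lia.
by exists (- f), (- (f / 4) - h / 4 - 1); split; lia.
Qed.

Lemma sign_mod8 g r : g mod 2 = 1 -> r mod 2 = 1 -> (g * g - r * r) mod 16 = 0 ->
  exists g' k, g' * g' = g * g /\ g' = r + 8 * k.
Proof.
move=> g2 r2; have := Z.div_mod g 8; have := Z.div_mod r 8; have := Z.mod_pos_bound g 8;
have := Z.mod_pos_bound r 8; set i := g mod 8; set j := r mod 8; set a := g / 8; set b := r / 8.
move=> bj bi er eg h.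
have ij : (i * i - j * j) mod 16 = 0.
  rewrite -h; have -> : g * g - r * r = i * i - j * j + (4 * a * a + a * i - 4 * b * b - b * j) * 16.
    by rewrite eg ?er; lia.
  by rewrite Z.mod_add.
have i2 : i = 1 \/ i = 3 \/ i = 5 \/ i = 7 by lia.
have j2 : j = 1 \/ j = 3 \/ j = 5 \/ j = 7 by lia.
have [e|e] : i = j \/ i + j = 8.
  move: ij; clear -i2 j2.
  by case: i2 => [->|[->|[->| ->]]]; case: j2 => [->|[->|[->| ->]]] //; auto.
  by exists g, (a - b); split; lia.
by exists (- g), (- a - b - 1); split; lia.
Qed.
End SumsOfSquares.

(** * Coefficients 1, 1, 1, 1 and 1, 1, 2, 4 *)

Section Represent.
Local Open Scope Z_scope.

(** The linear-quadratic system with coefficients [c], as a recursion so that single variables can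
    be fixed in turn. *)
Fixpoint rep (c : seq nat) (r A : Z) : Prop :=
  if c is k :: c' then exists x, rep c' (r - Z.of_nat k * x) (A - Z.of_nat k * (x * x))
  else r = 0 /\ A = 0.

Lemma rep_cat s t r A : rep (s ++ t) r A <->
  exists r1 A1, rep s r1 A1 /\ rep t (r - r1) (A - A1).
Proof.
elim: s r A => [|k s IH] r A /=.
  split=> [h|[r1 [A1 [[-> ->]]]]]; last by rewrite !Z.sub_0_r.
  by exists 0, 0; rewrite !Z.sub_0_r.
split=> [[x /IH[r1 [A1 [h1 h2]]]]|[r1 [A1 [[x h1] h2]]]].
  exists (r1 + Z.of_nat k * x), (A1 + Z.of_nat k * (x * x)); split.
    by exists x; rewrite !Z.add_simpl_r.
  by rewrite !(Z.add_comm _ (Z.of_nat k * _)) !Z.sub_add_distr.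
exists x; apply/IH; exists (r1 - Z.of_nat k * x), (A1 - Z.of_nat k * (x * x)); split=> //.
have -> : r - Z.of_nat k * x - (r1 - Z.of_nat k * x) = r - r1 by ring.
by have -> : A - Z.of_nat k * (x * x) - (A1 - Z.of_nat k * (x * x)) = A - A1 by ring.
Qed.

Lemma rep_perm s t r A : perm_eq s t -> rep s r A -> rep t r A.
Proof.
apply: (@catCA_perm_ind _ (fun u => rep u r A)) => s1 s2 s3.
move=> /rep_cat[r1 [A1 [h1 /rep_cat[r2 [A2 [h2 h3]]]]]].
apply/rep_cat; exists r2, A2; split=> //; apply/rep_cat; exists r1, A1; split=> //.
have -> : r - r2 - r1 = r - r1 - r2 by ring.
by have -> : A - A2 - A1 = A - A1 - A2 by ring.
Qed.

(** Cauchy's lemma for integer variables: [4 A - r ^ 2] is 3 modulo 8, hence a sum of three odd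
    squares, and one sign is adjusted modulo 4 to make the coordinates integral. *)
Lemma rep_1111 r A : A mod 2 = 1 -> r mod 2 = 1 -> 0 <= 4 * A - r * r ->
  rep [:: 1; 1; 1; 1]%N r A.
Proof.
move=> A2 r2 D0; have [k rk] : exists k, r = 2 * k + 1 by exists (r / 2); lia.
have [j ej] := square_odd k; rewrite -rk in ej.
have [||a [b [c e]]] := @three_squares_odd (4 * A - r * r); try lia.
have [ja ha] := square_odd a; have [jb hb] := square_odd b; have [jc hc] := square_odd c.
have [||a' [m [sq em]]] := @sign_mod4 (2 * a + 1) (- (r + (2 * b + 1) + (2 * c + 1))); try lia.
exists m, (m - b - c - 1), (k + b + 1 - m), (k + c + 1 - m).
by rewrite -sq em in e; subst r; split; lia.
Qed.

(* The right-hand side is the diagonal form of what remains of [8 A - r ^ 2] when the variable of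
   the first coefficient 1 is eliminated; the other lemmas [rep_*_coords] are analogous. *)
Lemma rep_1124_coords r A k4 k3 k2 :
  8 * A - r * r = (r - 8 * k4) * (r - 8 * k4)
    + 2 * ((r - 4 * k4 - 4 * k3) * (r - 4 * k4 - 4 * k3))
    + 4 * ((r - 4 * k4 - 2 * k3 - 2 * k2) * (r - 4 * k4 - 2 * k3 - 2 * k2)) ->
  rep [:: 1; 1; 2; 4]%N r A.
Proof. by move=> e; exists (r - 4 * k4 - 2 * k3 - k2), k2, k3, k4; split; lia. Qed.

(** For [r] odd, 2 modulo 4 or 0 modulo 4, [odd_form_112] is applied to [8 A - r ^ 2] divided by 1,
    4 or 16. In the last case the extra condition says that this quotient is odd. *)
Lemma rep_1124 r A : (A - r) mod 2 = 0 -> 0 <= 8 * A - r * r ->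
  r mod 4 <> 0 \/ ((A - r) / 2 + r / 4) mod 2 = 1 -> rep [:: 1; 1; 2; 4]%N r A.
Proof.
move=> Ar D0 cond.
have [r2|r2] : r mod 2 = 1 \/ r mod 2 = 0 by lia.
  have [k rk] : exists k, r = 2 * k + 1 by exists (r / 2); lia.
  have [j ej] := square_odd k; rewrite -rk in ej.
  have [B AB] : exists B, A = 2 * B + 1 by exists (A / 2); lia.
  have [||x [y [z e]]] := @odd_form_112 (8 * A - r * r); try lia.
  have [jx ex] := square_odd x.
  have zodd : z mod 2 = 1.
    by have [[z' ez]|[z' ez]] := parity z; subst z; [exfalso|]; lia.
  have [z' ez] : exists z', z = 2 * z' + 1 by exists (z / 2); lia.
  have [jz hz] := square_odd z'; rewrite -ez in hz.
  have yodd : y mod 2 = 1.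
    by have [[y' ey]|[y' ey]] := parity y; subst y; [exfalso|]; lia.
  have [y' ey] : exists y', y = 2 * y' + 1 by exists (y / 2); lia.
  have [jy hy] := square_odd y'; rewrite -ey in hy.
  have g16 : ((2 * x + 1) * (2 * x + 1) - r * r) mod 16 = 0.
    have -> : (2 * x + 1) * (2 * x + 1) - r * r = (B - 2 * jy - jz - j) * 16 by lia.
    exact: Z.mod_mul.
  have [||g [m [sqg eg]]] := @sign_mod8 (2 * x + 1) r _ _ g16; try lia.
  have [||f [n [sqf ef]]] := @sign_mod4 z (r + 4 * m); try lia.
  have [p yp] : exists p, y = r + 4 * m + 2 * n - 2 * p by exists ((r + 4 * m + 2 * n - y) / 2); lia.
  apply: (@rep_1124_coords r A (- m) (- n) p); rewrite e -sqg -sqf yp eg ef; ring.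
have [rho er] : exists rho, r = 2 * rho by exists (r / 2); lia.
have [r4|r4] : r mod 4 = 2 \/ r mod 4 = 0 by lia.
  have [k rk] : exists k, rho = 2 * k + 1 by exists (rho / 2); lia.
  have [j ej] := square_odd k; rewrite -rk in ej.
  have [B AB] : exists B, A = 2 * B by exists (A / 2); lia.
  have [||x [y [z e]]] := @odd_form_112 (2 * A - rho * rho); try (subst r; lia).
  have [jx ex] := square_odd x.
  have zodd : z mod 2 = 1.
    by have [[z' ez]|[z' ez]] := parity z; subst z; [exfalso|]; lia.
  have [||g [m [sqg eg]]] := @sign_mod4 (2 * x + 1) rho; try lia.
  have [n zn] : exists n, z = rho + 2 * m - 2 * n by exists ((rho + 2 * m - z) / 2); lia.
  apply: (@rep_1124_coords r A (- m) n (rho + 2 * m - n - y)); subst r.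
  have -> : 8 * A - 2 * rho * (2 * rho) = 4 * (2 * A - rho * rho) by ring.
  rewrite e -sqg eg zn; ring.
have [tau et] : exists tau, rho = 2 * tau by exists (rho / 2); lia.
have [Q eA] : exists Q, A = 2 * Q + r by exists ((A - r) / 2); lia.
have cond' : (Q + tau) mod 2 = 1 by move: cond; subst; lia.
have [t2 et2] : exists t2, tau * tau + tau = 2 * t2.
  have [[h ->]|[h ->]] := parity tau; first by exists (2 * h * h + h); ring.
  by exists (2 * h * h + 3 * h + 1); ring.
have [||x [y [z e]]] := @odd_form_112 (Q + 2 * tau - tau * tau); try (subst; lia).
have De : 8 * A - r * r = 16 * (Q + 2 * tau - tau * tau) by subst; ring.
have [f [d [e' [m em]]]] : exists f d, Q + 2 * tau - tau * tau = f * f + d * d + 2 * (z * z) /\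
    exists m, f = tau + 2 * m.
  have [[h eh]|[h eh]] := parity tau.
    by exists (2 * y), (2 * x + 1); split; [rewrite e; ring|exists (y - h); lia].
  by exists (2 * x + 1), (2 * y); split; [rewrite e; ring|exists (x - h); lia].
apply: (@rep_1124_coords r A (- m) (tau + m - z) (tau + m + z - d)).
rewrite De e' em er et; ring.
Qed.
End Represent.

(** * Coefficients 1, 2, 2, 3 *)

Section Represent1223.
Local Open Scope Z_scope.

Lemma mod3_cases (k : Z) : exists h, k = 3 * h \/ k = 3 * h + 1 \/ k = 3 * h - 1.
Proof. by exists ((k + 1) / 3); lia. Qed.

(** Either all or none of the three are divisible by 3. Once the signs are aligned, a third of the
    sum of squares is [(a + k + l) ^ 2 + 2 (k ^ 2 - k l + l ^ 2)], which for even [k] is of the form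
    [x ^ 2 + 2 y ^ 2 + 6 z ^ 2]. *)
Lemma sign_mod3 a b c : (a * a + b * b + c * c) mod 3 = 0 -> exists b' c' k l,
  [/\ b' = b \/ b' = - b, c' = c \/ c' = - c, b' = a + 3 * k & c' = a + 3 * l].
Proof.
have [a1 ha] := mod3_cases a; have [b1 hb] := mod3_cases b; have [c1 hc] := mod3_cases c.
case: ha => [->|[->|->]]; case: hb => [->|[->|->]]; case: hc => [->|[->|->]] h.
all: try by exfalso; lia.
all: first
  [ by eexists _, _, (b1 - a1), (c1 - a1); split; [by left|by left|lia|lia]
  | by eexists _, _, (b1 - a1), (- c1 - a1); split; [by left|by right|lia|lia]
  | by eexists _, _, (- b1 - a1), (c1 - a1); split; [by right|by left|lia|lia]
  | by eexists _, _, (- b1 - a1), (- c1 - a1); split; [by right|by right|lia|lia]].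
Qed.

Lemma rep_1223_coords r A k v w :
  8 * A - r * r = (r - 4 * k) * (r - 4 * k)
    + 6 * ((r - 2 * k - 4 * w) * (r - 2 * k - 4 * w)) + 8 * ((k - 2 * v) * (k - 2 * v)) ->
  rep [:: 1; 2; 2; 3]%N r A.
Proof. by move=> e; exists (r - 2 * k - 3 * w), (k - v), v, w; split; lia. Qed.

(** Three squares are taken for 3 times [8 A - r ^ 2] if [r] is odd, and for 3 times a quarter of it
    if [r = 2 mod 4]; [sign_mod3] removes the factor 3. *)
Lemma rep_1223 r A : (A - r) mod 2 = 0 -> 0 <= 8 * A - r * r -> r mod 4 <> 0 ->
  rep [:: 1; 2; 2; 3]%N r A.
Proof.
move=> Ar D0 r4; have [r2|r2] : r mod 2 = 1 \/ r mod 2 = 0 by lia.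
  have [rho er] : exists rho, r = 2 * rho + 1 by exists (r / 2); lia.
  have [j ej] := square_odd rho; rewrite -er in ej.
  have [B AB] : exists B, A = 2 * B + 1 by exists (A / 2); lia.
  have [||a [b [c e]]] := @three_squares_1mod4 (3 * (8 * A - r * r)); try lia.
  have m3 : ((2 * a) * (2 * a) + (2 * b) * (2 * b) + (2 * c + 1) * (2 * c + 1)) mod 3 = 0.
    have -> : (2 * a) * (2 * a) + (2 * b) * (2 * b) + (2 * c + 1) * (2 * c + 1)
      = (8 * A - r * r) * 3 by lia.
    exact: Z.mod_mul.
  have [jc ec] := square_odd c.
  have [b' [c' [k [l [sb sc eb ec']]]]] := sign_mod3 m3.
  have [k' ek] : exists k', k = 2 * k' by exists (k / 2); lia.
  have [l' el] : exists l', l = 2 * l' + 1 by exists (l / 2); lia.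
  have {}sb : b' * b' = (2 * b) * (2 * b) by case: sb => ->; ring.
  have {}sc : c' * c' = (2 * c + 1) * (2 * c + 1) by case: sc => ->; ring.
  have k'odd : k' mod 2 = 1.
    have [[h eh]|[h eh]] := parity k'; last by lia.
    have [[ha ea]|[ha ea]] := parity a; exfalso; subst; lia.
  have [y ely] : exists y, l = k' + 2 * y by exists ((l - k') / 2); lia.
  have eM : 8 * A - r * r = (2 * a + 3 * k' + 2 * y) * (2 * a + 3 * k' + 2 * y)
      + 6 * (k' * k') + 8 * (y * y).
    by subst b' c' k l; lia.
  have [||P [m [sP eP]]] := @sign_mod4 (2 * a + 3 * k' + 2 * y) r; try lia.
  have [||S [n [sS eS]]] := @sign_mod4 k' (r + 2 * m); try lia.
  have [s es] : exists s, k' = 2 * s + 1 by exists (k' / 2); lia.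
  have [js ejs] := square_odd s; rewrite -es in ejs.
  have [v ev] : exists v, y = m + 2 * v.
    exists ((y - m) / 2); suff : (y - m) mod 2 = 0 by lia.
    have : 16 * B = 16 * j + 48 * js + 8 * (y * y) + 16 * (m * m) + 16 * (rho * m) + 8 * m by subst; lia.
    have [[y' ->]|[y' ->]] := parity y; have [[m' ->]|[m' ->]] := parity m; lia.
  apply: (@rep_1223_coords r A (- m) (- m - v) (- n)).
  rewrite eM -sP -sS eP eS ev; ring.
have [rho er] : exists rho, r = 2 * rho by exists (r / 2); lia.
have [s es] : exists s, rho = 2 * s + 1 by exists (rho / 2); lia.
have [j ej] := square_odd s; rewrite -es in ej.
have [B AB] : exists B, A = 2 * B by exists (A / 2); lia.
have [||a [b [c e]]] := @three_squares_1mod4 (3 * (2 * A - rho * rho)); try (subst r; lia).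
have m3 : ((2 * a) * (2 * a) + (2 * b) * (2 * b) + (2 * c + 1) * (2 * c + 1)) mod 3 = 0.
  have -> : (2 * a) * (2 * a) + (2 * b) * (2 * b) + (2 * c + 1) * (2 * c + 1)
    = (2 * A - rho * rho) * 3 by lia.
  exact: Z.mod_mul.
have [b' [c' [k [l [sb sc eb ec']]]]] := sign_mod3 m3.
have [k' ek] : exists k', k = 2 * k' by exists (k / 2); lia.
have [l' el] : exists l', l = 2 * l' + 1 by exists (l / 2); lia.
have {}sb : b' * b' = (2 * b) * (2 * b) by case: sb => ->; ring.
have {}sc : c' * c' = (2 * c + 1) * (2 * c + 1) by case: sc => ->; ring.
have eM : 2 * A - rho * rho = (2 * a + 2 * k' + l) * (2 * a + 2 * k' + l)
    + 6 * (k' * k') + 2 * ((l - k') * (l - k')).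
  by subst b' c' k l; lia.
have [P [m [sP eP my]]] : exists P m, [/\ P * P = (2 * a + 2 * k' + l) * (2 * a + 2 * k' + l),
    P = rho - 2 * m & (m - (l - k')) mod 2 = 0].
  (* The two signs give [m] and [m'] with odd sum [rho], so one of them has the required parity. *)
  pose m := (rho - (2 * a + 2 * k' + l)) / 2; pose m' := (rho + (2 * a + 2 * k' + l)) / 2.
  have [h|h] : (m - (l - k')) mod 2 = 0 \/ (m' - (l - k')) mod 2 = 0 by rewrite /m /m'; lia.
    by exists (2 * a + 2 * k' + l), m; split=> //; rewrite /m; lia.
  by exists (- (2 * a + 2 * k' + l)), m'; split=> //; [ring|rewrite /m'; lia].
have [v ev] : exists v, l - k' = m - 2 * v by exists ((m - (l - k')) / 2); lia.
have [w ew] : exists w, k' = rho - m - 2 * w by exists ((rho - m - k') / 2); lia.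
apply: (@rep_1223_coords r A m v w).
have -> : 8 * A - r * r = 4 * (2 * A - rho * rho) by subst r; ring.
rewrite eM -sP eP ev ew er; ring.
Qed.
End Represent1223.

(** * Coefficients 1, 1, 2, 3, 3 *)

Section Represent11233.
Local Open Scope Z_scope.

Definition three_squares_test1 (n : Z) : bool := (0 <? n) &&
  [|| n mod 8 =? 1, n mod 8 =? 2, n mod 8 =? 3, n mod 8 =? 5 | n mod 8 =? 6].

Definition three_squares_test (n : Z) : bool :=
  three_squares_test1 n || (n mod 4 =? 0) && three_squares_test1 (n / 4).

Lemma three_squares_testP n : three_squares_test n -> three_squares n.
Proof.
have test1 m : three_squares_test1 m -> three_squares m.
  move=> /andP[m0 h]; apply: three_squares_mod8; first by lia.
  by lia.
case/orP => [/test1 //|/andP[n4 /test1[x [y [z e]]]]].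
by exists (2 * x), (2 * y), (2 * z); lia.
Qed.

Lemma rep_112_coords c3 c4 r A x3 x4 k v :
  4 * (A - Z.of_nat c3 * (x3 * x3) - Z.of_nat c4 * (x4 * x4))
    - (r - Z.of_nat c3 * x3 - Z.of_nat c4 * x4) * (r - Z.of_nat c3 * x3 - Z.of_nat c4 * x4)
  = (r - Z.of_nat c3 * x3 - Z.of_nat c4 * x4 - 4 * k)
      * (r - Z.of_nat c3 * x3 - Z.of_nat c4 * x4 - 4 * k)
    + 2 * ((r - Z.of_nat c3 * x3 - Z.of_nat c4 * x4 - 2 * k - 2 * v)
      * (r - Z.of_nat c3 * x3 - Z.of_nat c4 * x4 - 2 * k - 2 * v)) ->
  rep [:: c4; c3; 1; 1; 2]%N r A.
Proof.
move=> e; exists x4, x3, (r - Z.of_nat c3 * x3 - Z.of_nat c4 * x4 - 2 * k - v), v, k.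
by split; lia.
Qed.

(** The variables of the two coefficients 3 take opposite values and so do not affect [r]. *)
Lemma rep_11233_odd r A : A mod 2 = 1 -> r mod 2 = 1 -> 0 <= 4 * A - r * r ->
  rep [:: 3; 3; 1; 1; 2]%N r A.
Proof.
move=> A2 r2 D0; have [rho er] : exists rho, r = 2 * rho + 1 by exists (r / 2); lia.
have [j ej] := square_odd rho; rewrite -er in ej.
have [B AB] : exists B, A = 2 * B + 1 by exists (A / 2); lia.
have [||a [b [c e]]] := @three_squares_1mod4 (3 * (4 * A - r * r)); try lia.
have m3 : ((2 * a) * (2 * a) + (2 * b) * (2 * b) + (2 * c + 1) * (2 * c + 1)) mod 3 = 0.
  have -> : (2 * a) * (2 * a) + (2 * b) * (2 * b) + (2 * c + 1) * (2 * c + 1)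
    = (4 * A - r * r) * 3 by lia.
  exact: Z.mod_mul.
have [jc ec] := square_odd c.
have [b' [c' [k [l [sb sc eb ec']]]]] := sign_mod3 m3.
have kw : exists w, k = 4 * w.
  suff : k mod 4 = 0 by exists (k / 4); lia.
  have : (a - b) mod 2 = 0.
    by have [[ha ea]|[ha ea]] := parity a; have [[hb eb']|[hb eb']] := parity b; subst; lia.
  by case: sb; lia.
have [w ew] := kw; have [l' el] : exists l', l = 2 * l' + 1 by exists (l / 2); lia.
have {}sb : b' * b' = (2 * b) * (2 * b) by case: sb => ->; ring.
have {}sc : c' * c' = (2 * c + 1) * (2 * c + 1) by case: sc => ->; ring.
have eM : 4 * A - r * r = (2 * a + 4 * w + l) * (2 * a + 4 * w + l)
    + 2 * ((2 * w - l) * (2 * w - l)) + 24 * (w * w).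
  by subst b' c' k l; lia.
have [||P [m [sP eP]]] := @sign_mod4 (2 * a + 4 * w + l) r; try lia.
have [v ev] : exists v, 2 * w - l = r + 2 * m - 2 * v by exists ((r + 2 * m - 2 * w + l) / 2); lia.
rewrite -sP eP ev in eM.
by apply: (@rep_112_coords 3 3 r A w (- w) (- m) v); lia.
Qed.

Lemma same_parity_pair a b c : exists x y z k,
  x * x + y * y + z * z = a * a + b * b + c * c /\ x = y + 2 * k.
Proof.
have [[a' ea]|[a' ea]] := parity a; have [[b' eb]|[b' eb]] := parity b;
have [[c' ec]|[c' ec]] := parity c.
all: first
  [ by exists a, b, c, (a' - b'); lia
  | by exists a, c, b, (a' - c'); lia
  | by exists b, c, a, (b' - c'); lia].
Qed.

(** Here [t] is half the sum of the variables of the two coefficients 3. *)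
Lemma rep_11233_even rho A t :
  A mod 2 = 0 -> three_squares (3 * (A - 6 * t * t - (rho - 3 * t) * (rho - 3 * t))) ->
  rep [:: 3; 3; 1; 1; 2]%N (2 * rho) A.
Proof.
move=> A2 [a0 [b0 [c0 e0]]]; have [b [a [c [h [eq ba]]]]] := same_parity_pair a0 b0 c0.
set N := A - 6 * t * t - (rho - 3 * t) * (rho - 3 * t) in e0.
have e : 3 * N = a * a + b * b + c * c by lia.
have m3 : (a * a + b * b + c * c) mod 3 = 0 by rewrite -e Z.mul_comm; exact: Z.mod_mul.
have [b' [c' [k [l [sb sc eb ec]]]]] := sign_mod3 m3.
have [k' ek] : exists k', k = 2 * k' by exists (k / 2); case: sb; lia.
have {}sb : b' * b' = b * b by case: sb => ->; ring.
have {}sc : c' * c' = c * c by case: sc => ->; ring.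
have eM : N = (a + k + l) * (a + k + l) + 2 * ((k' - l) * (k' - l)) + 6 * (k' * k').
  by subst b' c' k; lia.
have [m em] : exists m, a + k + l = rho - 3 * t - 2 * m.
  exists ((rho - 3 * t - (a + k + l)) / 2).
  have [Bh eB] : exists Bh, A = 2 * Bh by exists (A / 2); lia.
  suff : (rho - 3 * t - (a + k + l)) mod 2 = 0 by lia.
  move: eM; rewrite /N; set P := a + k + l; rewrite eB => eM.
  have [[p ep]|[p ep]] := parity P; have [[q eq']|[q eq']] := parity (rho - 3 * t);
    rewrite ep eq' in eM *; lia.
rewrite em /N in eM.
by apply: (@rep_112_coords 3 3 _ A (t - k') (t + k') m (rho - 3 * t - m - (k' - l))); lia.
Qed.
End Represent11233.

(** * Coefficients 1, 1, 2, 3, 6, and 1, 1, 2, 3, 5 for odd r *)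

Section Represent11236.
Local Open Scope Z_scope.

Lemma square_mod3 x :
  (x mod 3 = 0 /\ exists m, x * x = 3 * m) \/ (x mod 3 <> 0 /\ exists m, x * x = 3 * m + 1).
Proof.
have [h [->|[->|->]]] := mod3_cases x; [left|right|right]; split; try lia.
- by exists (3 * h * h); ring.
- by exists (3 * h * h + 2 * h); ring.
- by exists (3 * h * h - 2 * h); ring.
Qed.

Lemma pick_zero_nonzero_mod3 (P : Z -> Prop) a b c : P a -> P b -> P c ->
  (a * a + b * b + c * c) mod 3 <> 0 -> exists x y z, [/\ P x, P y & P z] /\
    [/\ x * x + y * y + z * z = a * a + b * b + c * c, y mod 3 = 0 & z mod 3 <> 0].
Proof.
move=> Pa Pb Pc s3.
case: (square_mod3 a) => -[ha [ma ea]]; case: (square_mod3 b) => -[hb [mb eb]];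
case: (square_mod3 c) => -[hc [mc ec]].
all: first [ by exists b, a, c; split; split=> //; ring | by exists c, a, b; split; split=> //; ring
  | by exists a, b, c; split; split=> //; ring | by exists c, b, a; split; split=> //; ring
  | by exists a, c, b; split; split=> //; ring | by exists b, c, a; split; split=> //; ring
  | by exfalso; lia ].
Qed.

Lemma pick_zeros_mod3 (P : Z -> Prop) a b c : P a -> P b -> P c ->
  (a * a + b * b + c * c) mod 3 = 1 -> exists x y z, [/\ P x, P y & P z] /\
    [/\ x * x + y * y + z * z = a * a + b * b + c * c, y mod 3 = 0 & z mod 3 = 0].
Proof.
move=> Pa Pb Pc s3.
case: (square_mod3 a) => -[ha [ma ea]]; case: (square_mod3 b) => -[hb [mb eb]];
case: (square_mod3 c) => -[hc [mc ec]].
all: first [ by exists c, a, b; split; split=> //; ring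
  | by exists a, b, c; split; split=> //; ring | by exists b, a, c; split; split=> //; ring
  | by exfalso; lia ].
Qed.

Lemma odd_mod2 a : (2 * a + 1) mod 2 = 1. Proof. by lia. Qed.

(* The parameter [t] is the value of [x + 2 y] for the variables [x], [y] of the coefficients 3 and
   6; once it is fixed, [N] has to be of the form [P ^ 2 + 2 u ^ 2 + 8 v ^ 2] with [v = t mod 3]. *)
Lemma rep_11236 r A t : (A - r) mod 2 = 0 -> (r - t) mod 2 = 1 ->
  0 < 4 * A - 4 * t * t - (r - 3 * t) * (r - 3 * t) ->
  (t mod 3 <> 0 /\ (4 * A - 4 * t * t - (r - 3 * t) * (r - 3 * t)) mod 3 <> 0) \/
  (t mod 3 = 0 /\ (4 * A - 4 * t * t - (r - 3 * t) * (r - 3 * t)) mod 3 = 1) ->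
  rep [:: 6; 3; 1; 1; 2]%N r A.
Proof.
set N := 4 * A - _ - _ => Ar rt N0 cond.
have [h eh] : exists h, r - 3 * t = 2 * h + 1 by exists ((r - 3 * t) / 2); lia.
have [j ej] := square_odd h; rewrite -eh in ej.
have N8 : N mod 8 = 3.
  have [[s es]|[s es]] := parity t.
    have [B eB] : exists B, A = 2 * B + 1 by exists (A / 2); lia.
    by rewrite /N ej es eB; lia.
  have [i ei] := square_odd s; rewrite -es in ei.
  have [B eB] : exists B, A = 2 * B by exists (A / 2); lia.
  have -> : N = 8 * B - 4 * (t * t) - (8 * j + 1) by rewrite /N ej eB; ring.
  by rewrite ei; lia.
have [a [b [c e]]] := three_squares_odd N0 N8.
have [x [y [z [[x2 y2 z2] es hyz]]]] : exists x y z,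
    [/\ [/\ x mod 2 = 1, y mod 2 = 1 & z mod 2 = 1], N = x * x + y * y + z * z &
    (t mod 3 <> 0 /\ y mod 3 = 0 /\ z mod 3 <> 0) \/ (t mod 3 = 0 /\ y mod 3 = 0 /\ z mod 3 = 0)].
  case: cond => -[t3 N3]; rewrite e in N3.
    have [x [y [z [px [es y3 z3]]]]] := @pick_zero_nonzero_mod3 (fun k => k mod 2 = 1) _ _ _
      (odd_mod2 a) (odd_mod2 b) (odd_mod2 c) N3.
    by exists x, y, z; split=> //; [rewrite es|left].
  have [x [y [z [px [es y3 z3]]]]] := @pick_zeros_mod3 (fun k => k mod 2 = 1) _ _ _
    (odd_mod2 a) (odd_mod2 b) (odd_mod2 c) N3.
  by exists x, y, z; split=> //; [rewrite es|right].
(* With [z' = y + 4 q], [y ^ 2 + z' ^ 2 = 2 (y + 2 q) ^ 2 + 8 q ^ 2]. As 3 divides [y], it divides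
   [q] exactly when it divides [z], so [q] agrees with [t] modulo 3 up to sign. *)
have [z' [q [sz ez]]] := sign_mod4 z2 y2.
have z'0 : z' mod 3 = 0 <-> z mod 3 = 0 by have /Z.mul_eq_0 : (z' - z) * (z' + z) = 0 by [lia|]; lia.
have [x4 [q' [sq eq']]] : exists x4 q', q' * q' = q * q /\ q' = t - 3 * x4.
  have [h3|h3] : (t - q) mod 3 = 0 \/ (t + q) mod 3 = 0 by lia.
    by exists ((t - q) / 3), q; split=> //; lia.
  by exists ((t + q) / 3), (- q); split; [ring|lia].
have [|P [m [sP eP]]] := @sign_mod4 x (r - 3 * t) x2; first by lia.
have [v ev] : exists v, y + 2 * q = r - 3 * t + 2 * m - 2 * v.
  by exists ((r - 3 * t + 2 * m - (y + 2 * q)) / 2); lia.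
have eN : N = P * P + 2 * ((y + 2 * q) * (y + 2 * q)) + 8 * (q' * q').
  by rewrite sP sq es -sz ez; ring.
rewrite ev eq' eP /N in eN.
by apply: (@rep_112_coords 3 6 r A (t - 2 * x4) x4 (- m) v); lia.
Qed.

(** The only obstruction is that exactly one of the three is prime to 3. *)
Lemma sign_sum_mod3 a b c : (a * a + b * b + c * c) mod 3 <> 1 -> exists b' c' s,
  [/\ b' = b \/ b' = - b, c' = c \/ c' = - c & a + b' + c' = 3 * s].
Proof.
have [a1 ha] := mod3_cases a; have [b1 hb] := mod3_cases b; have [c1 hc] := mod3_cases c.
case: ha => [->|[->|->]]; case: hb => [->|[->|->]]; case: hc => [->|[->|->]] h.
all: try by exfalso; lia.
all: first
  [ by eexists _, _, (a1 + b1 + c1); split; [by left|by left|lia]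
  | by eexists _, _, (a1 + b1 + c1 + 1); split; [by left|by left|lia]
  | by eexists _, _, (a1 + b1 + c1 - 1); split; [by left|by left|lia]
  | by eexists _, _, (a1 + b1 - c1); split; [by left|by right|lia]
  | by eexists _, _, (a1 + b1 - c1 + 1); split; [by left|by right|lia]
  | by eexists _, _, (a1 + b1 - c1 - 1); split; [by left|by right|lia]
  | by eexists _, _, (a1 - b1 + c1); split; [by right|by left|lia]
  | by eexists _, _, (a1 - b1 + c1 + 1); split; [by right|by left|lia]
  | by eexists _, _, (a1 - b1 + c1 - 1); split; [by right|by left|lia]
  | by eexists _, _, (a1 - b1 - c1); split; [by right|by right|lia]
  | by eexists _, _, (a1 - b1 - c1 + 1); split; [by right|by right|lia]
  | by eexists _, _, (a1 - b1 - c1 - 1); split; [by right|by right|lia] ].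
Qed.

Lemma square_eq_mod3 x y : (x * x - y * y) mod 3 = 0 -> (x + y) mod 3 = 0 \/ (x - y) mod 3 = 0.
Proof.
by have [h [->|[->|->]]] := mod3_cases x; have [k [->|[->|->]]] := mod3_cases y; lia.
Qed.

(** The variables of 3 and 5 get the difference [2 c1] with [c1 ^ 2 = 1]. For [k = 3 c1 + 4 x4],
    they contribute [2 k] to [r] and [(k ^ 2 + 15) / 2] to [A], and 3 times the discriminant left to
    the coefficients 1, 1, 2 is [12 A - r ^ 2 - 90 - 2 (3 k - r) ^ 2]. *)
Lemma rep_11235_odd r A : A mod 2 = 1 -> r mod 2 = 1 -> 0 < 12 * A - r * r - 90 ->
  rep [:: 5; 3; 1; 1; 2]%N r A.
Proof.
move=> A2 r2 M0; have [rho er] : exists rho, r = 2 * rho + 1 by exists (r / 2); lia.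
have [j ej] := square_odd rho; rewrite -er in ej.
have [B AB] : exists B, A = 2 * B + 1 by exists (A / 2); lia.
have [|a [b [c e]]] := three_squares_1mod4 M0; first by lia.
have [jc ec] := square_odd c.
have ab : (a - b) mod 2 = 0.
  by have [[ha ea]|[ha ea]] := parity a; have [[hb eb']|[hb eb']] := parity b; subst; lia.
have s3 : ((2 * a) * (2 * a) + (2 * b) * (2 * b) + (2 * c + 1) * (2 * c + 1)) mod 3 <> 1.
  have -> : (2 * a) * (2 * a) + (2 * b) * (2 * b) + (2 * c + 1) * (2 * c + 1)
    = 12 * A - r * r - 90 by lia.
  by case: (square_mod3 r) => -[_ [i ei]]; rewrite ei; lia.
have [b' [c' [P [sb sc eP]]]] := sign_sum_mod3 s3.
have [b2 eb] : exists b2, b' = 2 * b2 by case: sb => ->; [exists b|exists (- b)]; ring.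
have {}ab : (a - b2) mod 2 = 0 by case: sb; lia.
have c'2 : c' mod 2 = 1 by case: sc; lia.
have [y ey] : exists y, P = c' + 2 * y by exists ((P - c') / 2); lia.
have {}sb : b' * b' = (2 * b) * (2 * b) by case: sb => ->; ring.
have {}sc : c' * c' = (2 * c + 1) * (2 * c + 1) by case: sc => ->; ring.
have eM : 12 * A - r * r - 90 = 2 * ((a - b2) * (a - b2)) + 3 * (P * P) + 6 * (y * y).
  have ec' : c' = P - 2 * y by lia.
  have ea : a = P + y - b2 by lia.
  have -> : 12 * A - r * r - 90 = (2 * a) * (2 * a) + b' * b' + c' * c' by lia.
  by rewrite eb ec' ea; ring.
have [W [k [sW ekW]]] : exists W k, W * W = (a - b2) * (a - b2) /\ r = 3 * k - W.
  have [h|h] : (r + (a - b2)) mod 3 = 0 \/ (r - (a - b2)) mod 3 = 0.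
    apply: square_eq_mod3; set d := a - b2 in eM *.
    have -> : r * r - d * d = (4 * A - 30 - d * d - P * P - 2 * (y * y)) * 3 by lia.
    exact: Z.mod_mul.
    by exists (a - b2), ((r + (a - b2)) / 3); split; [ring|lia].
  by exists (- (a - b2)), ((r - (a - b2)) / 3); split; [ring|lia].
have W2 : W mod 2 = 0.
  have /Z.mul_eq_0 : (W - (a - b2)) * (W + (a - b2)) = 0 by lia.
  by case; lia.
have [c1 [x4 [sc1 ex4]]] : exists c1 x4, c1 * c1 = 1 /\ k = 3 * c1 + 4 * x4.
  have [h|h] : k mod 4 = 3 \/ k mod 4 = 1 by lia.
    by exists 1, ((k - 3) / 4); split=> //; lia.
  by exists (- 1), ((k + 3) / 4); split=> //; lia.
have [||P' [m [sP eP']]] := @sign_mod4 P (r - 2 * k); try lia.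
have [v ev] : exists v, y = r - 2 * k + 2 * m - 2 * v by exists ((r - 2 * k + 2 * m - y) / 2); lia.
have er1 : r - 3 * (x4 + 2 * c1) - 5 * x4 = r - 2 * k by lia.
apply: (@rep_112_coords 3 5 r A (x4 + 2 * c1) x4 (- m) v).
rewrite -[Z.of_nat 3]/3 -[Z.of_nat 5]/5 er1.
have -> : r - 2 * k - 4 * - m = P' by lia.
have -> : r - 2 * k - 2 * - m - 2 * v = y by lia.
rewrite sP; rewrite -sW in eM; have eW : W = 3 * k - r by lia.
rewrite eW in eM; rewrite ex4 in eM *.
have -> : (x4 + 2 * c1) * (x4 + 2 * c1) = x4 * x4 + 4 * (c1 * x4) + 4 * (c1 * c1) by ring.
have h9 : (3 * c1 + 4 * x4) * (3 * c1 + 4 * x4) = 9 * (c1 * c1) + 24 * (c1 * x4) + 16 * (x4 * x4) by ring.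
rewrite sc1 in h9 *; lia.
Qed.
End Represent11236.

(** * Coefficients 1, 1, 2, 3, 5 for even r *)

Section Represent11235.
Local Open Scope Z_scope.

Lemma rep_11235_coords rho B t x4 P y :
  18 * B - 8 * (rho * rho) + 60 * (rho * t) - 180 * (t * t)
    = (9 * x4 - 3 * t - rho) * (9 * x4 - 3 * t - rho) + 9 * (P * P) + 18 * (y * y) ->
  rep [:: 5; 3; 1; 1; 2]%N (2 * rho) (2 * B).
Proof.
move=> e; have [k ek] : exists k, P = rho - 3 * t - x4 - 2 * k.
  exists ((rho - 3 * t - x4 - P) / 2); suff : (rho - 3 * t - x4 - P) mod 2 = 0 by lia.
  have [[w ew]|[w ew]] := parity (9 * x4 - 3 * t - rho); have [[p ep]|[p ep]] := parity P;
    rewrite ew ep in e *; lia.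
apply: (@rep_112_coords 3 5 _ _ (2 * t - x4) x4 k (rho - 3 * t - x4 - k - y)).
by rewrite -[Z.of_nat 3]/3 -[Z.of_nat 5]/5; rewrite ek in e; lia.
Qed.

Lemma pick_zero_nonzeros_mod3 a b c : (a * a + b * b + c * c) mod 3 = 2 ->
  exists x y z, x * x + y * y + (3 * z) * (3 * z) = a * a + b * b + c * c /\
    (x * x - y * y) mod 3 = 0.
Proof.
have div3 k : k mod 3 = 0 -> k = 3 * (k / 3) by lia.
case: (square_mod3 a) => -[ha [ma ea]]; case: (square_mod3 b) => -[hb [mb eb]];
case: (square_mod3 c) => -[hc [mc ec]] h.
all: first [ by exfalso; lia
  | by exists b, c, (a / 3); rewrite -div3 //; split; [ring|lia]
  | by exists a, c, (b / 3); rewrite -div3 //; split; [ring|lia]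
  | by exists a, b, (c / 3); rewrite -div3 //; split; [ring|lia] ].
Qed.

Lemma same_square_pair_mod3 a b c : exists x y z,
  x * x + y * y + z * z = a * a + b * b + c * c /\ (x * x - y * y) mod 3 = 0.
Proof.
case: (square_mod3 a) => -[ha [ma ea]]; case: (square_mod3 b) => -[hb [mb eb]];
case: (square_mod3 c) => -[hc [mc ec]].
all: first [ by exists a, b, c; split; [ring|lia] | by exists a, c, b; split; [ring|lia]
           | by exists b, c, a; split; [ring|lia] ].
Qed.

(** Here [t] is half the sum of the variables of 3 and 5. The three squares add up to 2 modulo 3, so
    one root is [3 z], and the others, aligned so that [x - y = 3 k], satisfy [2 (x ^ 2 + y ^ 2) =
    (x + y) ^ 2 + 9 k ^ 2]. *)
Lemma rep_11235_even rho B t : rho mod 3 <> 0 ->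
  three_squares (9 * B - 4 * (rho * rho) + 30 * (rho * t) - 90 * (t * t)) ->
  rep [:: 5; 3; 1; 1; 2]%N (2 * rho) (2 * B).
Proof.
move=> rho3 [a [b [c e]]]; set N := 9 * B - _ + _ - _ in e.
have N3 : (a * a + b * b + c * c) mod 3 = 2.
  by rewrite -e /N; case: (square_mod3 rho) => -[// hr [i ei]]; rewrite ei; lia.
have [x [y0 [z [es xy]]]] := pick_zero_nonzeros_mod3 N3.
have [y [k [sy ey]]] : exists y k, y * y = y0 * y0 /\ x = y + 3 * k.
  case: (square_eq_mod3 xy) => h; [exists (- y0), ((x + y0) / 3)|exists y0, ((x - y0) / 3)];
    by split; [ring|lia].
have eN : 2 * N = (x + y) * (x + y) + 9 * (k * k) + 18 * (z * z).
  by rewrite e -es -sy ey; ring.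
set s := rho + 3 * t; set w := x + y in eN.
have ws9 : ((w - s) * (w + s)) mod 9 = 0.
  have -> : (w - s) * (w + s)
      = (2 * B - k * k - 2 * (z * z) - rho * rho + 6 * (rho * t) - 21 * (t * t)) * 9.
    by move: eN; rewrite /N /s; lia.
  exact: Z.mod_mul.
have [W [x4 [sW eW]]] : exists W x4, W * W = w * w /\ W = 9 * x4 - s.
  have s3 : s mod 3 <> 0 by rewrite /s; lia.
  have {}ws9 : (9 | (w - s) * (w + s)) by exact/Z.mod_divide.
  (* As 3 does not divide [s], it divides only one of [w - s] and [w + s]; that one is divisible by
     9. *)
  have prod3 : (w - s) mod 3 = 0 \/ (w + s) mod 3 = 0.
    have /prime_mult [||//] : (3 | (w - s) * (w + s)) by case: ws9 => q ->; exists (q * 3); ring.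
    - exact: prime_3.
    - by move/Z.mod_divide; left; lia.
    by move/Z.mod_divide; right; lia.
  have g u v : (9 | u * v) -> v mod 3 <> 0 -> exists q, u = 9 * q.
    move=> d v3; have rp : rel_prime v 3.
      by apply/rel_prime_sym/prime_rel_prime; [exact: prime_3|move=> /Z.mod_divide; lia].
    have [||q eq] := Gauss 9 v u; last by exists q; lia.
      by rewrite Z.mul_comm.
    exact/rel_prime_sym/(@rel_prime_mult v 3 3).
  case: prod3 => h.
    have [|q eq] := g _ _ ws9; first by lia.
    by exists (- w), (- q); split; [ring|lia].
  have [||q eq] := g (w + s) (w - s); [by rewrite Z.mul_comm|by lia|].
  by exists w, q; split=> //; lia.
have e2 : 9 * x4 - 3 * t - rho = W by rewrite eW /s; ring.
apply: (@rep_11235_coords rho B t x4 k z).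
by rewrite e2 sW -eN /N; ring.
Qed.

(** For [9 x4 - 3 t - 3 rho = 3 (x + y)] and [P = x - y], the right-hand side in [rep_11235_coords]
    is 18 times a sum of three squares. *)
Lemma rep_11235_even3 rho B t : (t + rho) mod 3 = 0 ->
  three_squares (B - 4 * (rho * rho) + 10 * (rho * t) - 10 * (t * t)) ->
  rep [:: 5; 3; 1; 1; 2]%N (2 * (3 * rho)) (2 * B).
Proof.
move=> tr [a [b [c e]]]; have [x [y0 [z [es xy]]]] := same_square_pair_mod3 a b c.
have [y [k [sy ey]]] : exists y k, y * y = y0 * y0 /\ x = 3 * k - y.
  case: (square_eq_mod3 xy) => h; [exists y0, ((x + y0) / 3)|exists (- y0), ((x - y0) / 3)];
    by split; [ring|lia].
have [q eq] : exists q, t + rho = 3 * q by exists ((t + rho) / 3); lia.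
have e2 : 9 * (k + q) - 3 * t - 3 * rho = 3 * (x + y) by lia.
apply: (@rep_11235_coords _ B t (k + q) (x - y) z).
rewrite e2; rewrite -es -sy in e; lia.
Qed.
End Represent11235.

(** * The 27 quadruples *)

Section Checker.
Local Open Scope Z_scope.

(* Meant for [c] consisting of coefficients of sum [s] and one augmenting coefficient.  The system
   with [r = 0] is insoluble for some [Q], in which case [r = s + 2] can replace it. *)
Definition augments (c : seq nat) (s : Z) : Prop :=
  (forall r Q, 1 <= r <= s + 1 -> 0 <= Q -> rep c r (2 * Q + r)) /\
  (forall Q, 1 <= Q -> rep c 0 (2 * Q) \/ rep c (s + 2) (2 * (Q - 1) + (s + 2))).

(** Nested [if] in place of [||] lets evaluation stop at the first success. *)
Fixpoint exists_upto (f : Z -> bool) (n : nat) : bool :=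
  if f (Z.of_nat n) then true else if f (- Z.of_nat n) then true
  else if n is n'.+1 then exists_upto f n' else false.

Lemma exists_uptoP f n : exists_upto f n -> exists x, f x.
Proof.
elim: n => [|n IH] /=.
  by case h: (f 0) => // _; exists 0.
have [h|_] := boolP (f _); first by eexists; exact: h.
have [h|_] := boolP (f _); first by eexists; exact: h.
exact: IH.
Qed.

(** The comparison with [r * r] is the Cauchy-Schwarz inequality, necessary for solvability; it
    prunes the search. *)
Fixpoint search (c : seq nat) (r A : Z) : bool :=
  if c is k :: c' then
    if r * r <=? Z.of_nat (sumn c) * A then
      exists_upto (fun x => search c' (r - Z.of_nat k * x) (A - Z.of_nat k * (x * x)))
        (Z.to_nat (Z.sqrt (A / Z.of_nat k)))
    else false
  else (r =? 0) && (A =? 0).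

Lemma searchP c r A : search c r A -> rep c r A.
Proof.
elim: c r A => [|k c IH] r A /=; first by move=> h; split; lia.
by case: ifP => // _ /exists_uptoP[x /IH h]; exists x.
Qed.

(* [tst t r A] is a sufficient criterion for [rep c r A] depending on a parameter [t], with [|t| <= T];
   it is periodic in [A], so that only [Q < Q0 + M] has to be tested. *)
Section Check.
Variables (c : seq nat) (tst : Z -> Z -> Z -> bool) (T : nat) (s M Q0 : nat).
Hypothesis M_gt0 : (0 < M)%N.
Hypothesis tst_sound : forall t r A, tst t r A -> rep c r A.
Hypothesis tst_stable : forall t r A, tst t r A -> tst t r (A + 2 * Z.of_nat M).

Definition hit r Q := exists_upto (fun t => tst t r (2 * Q + r)) T.
Definition hit_or_search r Q := if hit r Q then true else search c r (2 * Q + r).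

Definition check : bool :=
  [&& all (fun r => all (fun Q => hit_or_search (Z.of_nat r) (Z.of_nat Q)) (iota 0 Q0)) (iota 1 s.+1),
      all (fun r => all (fun Q => hit (Z.of_nat r) (Z.of_nat Q)) (iota Q0 M)) (iota 0 s.+2) &
      all (fun Q => if hit_or_search 0 (Z.of_nat Q) then true
                    else hit_or_search (Z.of_nat s + 2) (Z.of_nat Q - 1)) (iota 1 Q0.-1)].

Lemma hitP r Q : hit r Q -> exists t, tst t r (2 * Q + r).
Proof. exact: exists_uptoP. Qed.

Lemma hit_or_searchP r Q : hit_or_search r Q -> rep c r (2 * Q + r).
Proof.
by rewrite /hit_or_search; case: ifP => [/hitP[t /tst_sound] //|_]; apply: searchP.
Qed.

Lemma checkP : check -> augments c (Z.of_nat s).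
Proof.
move=> /and3P[small large zero].
have stable t r A k : tst t r A -> tst t r (A + 2 * Z.of_nat M * Z.of_nat k).
  elim: k => [|k IH] h; first by rewrite Z.mul_0_r Z.add_0_r.
  by have := tst_stable (IH h); congr tst; lia.
(* A value [Q >= Q0] is reduced modulo [M] into the window from [Q0] to [Q0 + M - 1], where [check]
   has found a [t]; [stable] transports it back. *)
have rep_large r Q : (r <= s.+1)%N -> (Q0 <= Q)%N -> rep c (Z.of_nat r) (2 * Z.of_nat Q + Z.of_nat r).
  move=> rs Q0Q; pose j := ((Q - Q0) %% M)%N; pose k := ((Q - Q0) %/ M)%N.
  have jM : (j < M)%N by rewrite ltn_mod.
  have eQ : Q = (Q0 + j + k * M)%N.
    by have := divn_eq (Q - Q0) M; rewrite -/j -/k => e; rewrite -addnA (addnC j) -e subnKC.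
  have /allP/(_ r) := large; rewrite mem_iota => /(_ _)/allP/(_ (Q0 + j)%N); rewrite mem_iota.
  move=> /(_ _ _)/hitP[||t /(stable _ _ _ k)/tst_sound]; [by lia|by lia|].
  by congr rep; rewrite eQ !Nat2Z.inj_add Nat2Z.inj_mul; ring.
split=> [r Q r1 Qge0|Q Qge1].
  have [r' er] : exists r', r = Z.of_nat r' by exists (Z.to_nat r); lia.
  have [Q' eQ] : exists Q', Q = Z.of_nat Q' by exists (Z.to_nat Q); lia.
  subst; have [lt|ge] := ltnP Q' Q0; last by apply: rep_large => //; lia.
  have /allP/(_ r') := small; rewrite mem_iota => /(_ _)/allP/(_ Q'); rewrite mem_iota.
  by move=> /(_ _ _)/hit_or_searchP; apply; lia.
have [Q' eQ] : exists Q', Q = Z.of_nat Q' by exists (Z.to_nat Q); lia.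
subst; have [lt|ge] := ltnP Q' Q0; last first.
  by left; have := @rep_large 0%N Q' isT ge; rewrite Z.add_0_r.
have /allP/(_ Q') := zero; rewrite mem_iota => /(_ _); case: ifP => [/hit_or_searchP h _|_ h].
  by left; move: h; rewrite Z.add_0_r.
by right; apply: hit_or_searchP; apply: h; lia.
Qed.
End Check.
End Checker.

(** * Decidable criteria and their periods *)

Section Tests.
Local Open Scope Z_scope.

(** The variable of a fifth coefficient [l] has the value [t]; the rest has to satisfy the
    hypotheses of [rep_1111]. The next two tests are built alike. *)
Definition test1111 (l t r A : Z) : bool :=
  [&& (A - l * (t * t)) mod 2 =? 1, (r - l * t) mod 2 =? 1 &
      0 <=? 4 * (A - l * (t * t)) - (r - l * t) * (r - l * t)].

Definition test1124 (l t r A : Z) : bool :=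
  [&& (A - l * (t * t) - (r - l * t)) mod 2 =? 0,
      0 <=? 8 * (A - l * (t * t)) - (r - l * t) * (r - l * t) &
      ~~ ((r - l * t) mod 4 =? 0)
        || (((A - l * (t * t) - (r - l * t)) / 2 + (r - l * t) / 4) mod 2 =? 1)].

Definition test1223 (l t r A : Z) : bool :=
  [&& (A - l * (t * t) - (r - l * t)) mod 2 =? 0,
      0 <=? 8 * (A - l * (t * t)) - (r - l * t) * (r - l * t) &
      ~~ ((r - l * t) mod 4 =? 0)].

Definition test11233 (t r A : Z) : bool :=
  if r mod 2 =? 1 then (A mod 2 =? 1) && (0 <=? 4 * A - r * r)
  else (A mod 2 =? 0) &&
    three_squares_test (3 * (A - 6 * t * t - (r / 2 - 3 * t) * (r / 2 - 3 * t))).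

Definition test11235 (t r A : Z) : bool :=
  if r mod 2 =? 1 then (A mod 2 =? 1) && (0 <? 12 * A - r * r - 90)
  else (A mod 2 =? 0) &&
    if (r / 2) mod 3 =? 0 then
      ((t + r / 6) mod 3 =? 0)
        && three_squares_test (A / 2 - 4 * (r / 6 * (r / 6)) + 10 * (r / 6 * t) - 10 * (t * t))
    else three_squares_test (9 * (A / 2) - 4 * (r / 2 * (r / 2)) + 30 * (r / 2 * t) - 90 * (t * t)).

Definition test11236 (t r A : Z) : bool :=
  let N := 4 * A - 4 * t * t - (r - 3 * t) * (r - 3 * t) in
  [&& (A - r) mod 2 =? 0, (r - t) mod 2 =? 1, 0 <? N &
      if t mod 3 =? 0 then N mod 3 =? 1 else ~~ (N mod 3 =? 0)].

(** Once the variable of the coefficient 1 is [t], the rest is twice the system with coefficients 1,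
    1, 2, 4. *)
Definition test12248 (t r A : Z) : bool :=
  [&& (r - t) mod 2 =? 0, (A - t * t) mod 2 =? 0 & test1124 0 0 ((r - t) / 2) ((A - t * t) / 2)].

Lemma test1111P l t r A : test1111 (Z.of_nat l) t r A -> rep [:: l; 1; 1; 1; 1]%N r A.
Proof. by move=> /and3P[h1 h2 h3]; exists t; apply: rep_1111; lia. Qed.

Lemma test1124P l t r A : test1124 (Z.of_nat l) t r A -> rep [:: l; 1; 1; 2; 4]%N r A.
Proof. by move=> /and3P[h1 h2 h3]; exists t; apply: rep_1124; lia. Qed.

Lemma test1223P l t r A : test1223 (Z.of_nat l) t r A -> rep [:: l; 1; 2; 2; 3]%N r A.
Proof. by move=> /and3P[h1 h2 h3]; exists t; apply: rep_1223; lia. Qed.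

Lemma test11233P t r A : test11233 t r A -> rep [:: 3; 3; 1; 1; 2]%N r A.
Proof.
rewrite /test11233; case: ifP => r2 /andP[h1 h2]; first by apply: rep_11233_odd; lia.
have -> : r = 2 * (r / 2) by lia.
by apply: (@rep_11233_even _ _ t); [lia|exact: three_squares_testP].
Qed.

Lemma test11235P t r A : test11235 t r A -> rep [:: 5; 3; 1; 1; 2]%N r A.
Proof.
rewrite /test11235; case: ifP => r2 /andP[h1]; first by move=> h2; apply: rep_11235_odd; lia.
have eA : 2 * (A / 2) = A by lia.
case: ifP => r3 => [/andP[h2 /three_squares_testP h3]|/three_squares_testP h3].
  have er : 2 * (3 * (r / 6)) = r by lia.
  by rewrite -{1}er -eA; apply: rep_11235_even3 h3; lia.
have er : 2 * (r / 2) = r by lia.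
by rewrite -{1}er -eA; apply: rep_11235_even h3; lia.
Qed.

Lemma test11236P t r A : test11236 t r A -> rep [:: 6; 3; 1; 1; 2]%N r A.
Proof.
rewrite /test11236; set N := 4 * A - _ - _ => /and4P[h1 h2 h3 h4].
apply: (@rep_11236 r A t); [lia|lia|rewrite -/N; lia|rewrite -/N].
by move: h4; case: ifP; lia.
Qed.

Lemma test12248P t r A : test12248 t r A -> rep [:: 1; 2; 2; 4; 8]%N r A.
Proof.
move=> /and3P[h1 h2 /and3P[h3 h4 h5]].
have [|||x [y [z [w [e1 e2]]]]] := @rep_1124 ((r - t) / 2) ((A - t * t) / 2); try lia.
by exists t, x, y, z, w; split; lia.
Qed.

Lemma test1111S l t r A : test1111 l t r A -> test1111 l t r (A + 2 * Z.of_nat 1).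
Proof. by rewrite /test1111; lia. Qed.

Lemma test1124S l t r A : test1124 l t r A -> test1124 l t r (A + 2 * Z.of_nat 2).
Proof. by rewrite /test1124; lia. Qed.

Lemma test1223S l t r A : test1223 l t r A -> test1223 l t r (A + 2 * Z.of_nat 1).
Proof. by rewrite /test1223; lia. Qed.

(** Only the residues modulo 8 of [n] and [n / 4] and lower bounds are tested, so 32 is a period
    upwards. *)
Lemma three_squares_testS n m k : m = n + 32 * Z.of_nat k ->
  three_squares_test n -> three_squares_test m.
Proof. by move=> ->; rewrite /three_squares_test /three_squares_test1; lia. Qed.

Lemma test11233S t r A : test11233 t r A -> test11233 t r (A + 2 * Z.of_nat 16).
Proof.
rewrite /test11233; case: ifP => _ /andP[h1 h2]; apply/andP; split; try lia.
by move: h2; apply: (@three_squares_testS _ _ 3); lia.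
Qed.

Lemma test11235S t r A : test11235 t r A -> test11235 t r (A + 2 * Z.of_nat 32).
Proof.
have e : (A + 2 * Z.of_nat 32) / 2 = A / 2 + 32 by lia.
rewrite /test11235 e; case: ifP => _ /andP[h1 h2]; apply/andP; split; try lia.
move: h2; case: ifP => _ => [/andP[h2 h3]|]; last by apply: (@three_squares_testS _ _ 9); lia.
by apply/andP; split=> //; move: h3; apply: (@three_squares_testS _ _ 1); lia.
Qed.

Lemma test11236S t r A : test11236 t r A -> test11236 t r (A + 2 * Z.of_nat 3).
Proof.
rewrite /test11236; set N := 4 * A - _ - _.
have -> : 4 * (A + 2 * Z.of_nat 3) - 4 * t * t - (r - 3 * t) * (r - 3 * t) = N + 24 by rewrite /N; lia.
move=> /and4P[h1 h2 h3 h4]; apply/and4P; split; try lia.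
by move: h4; case: ifP; lia.
Qed.

Lemma test12248S t r A : test12248 t r A -> test12248 t r (A + 2 * Z.of_nat 4).
Proof.
have e : (A + 2 * Z.of_nat 4 - t * t) mod 2 = (A - t * t) mod 2.
  have -> : A + 2 * Z.of_nat 4 - t * t = A - t * t + 4 * 2 by lia.
  exact: Z.mod_add.
move=> /and3P[h1 h2 /test1124S h3]; apply/and3P; split=> //; first by rewrite e.
by move: h3; congr test1124; lia.
Qed.
End Tests.

(** * The augmenting coefficients *)

Section Quads.
Local Open Scope Z_scope.

Lemma augments_perm c c' s : perm_eq c c' -> augments c s -> augments c' s.
Proof.
move=> cc' [h0 h1]; split=> [r Q rs Q0|Q Q1]; first exact: rep_perm (h0 _ _ rs Q0).
by case: (h1 Q Q1) => h; [left|right]; exact: rep_perm h.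
Qed.

Ltac aug c tst T s M Q0 P S :=
  apply: (@augments_perm c); [exact: isT|];
  apply: (@checkP c tst T s M Q0 isT P S); vm_compute; reflexivity.
(** In this and the following lemmas the first entry is the augmenting coefficient. It is chosen so
    that the five coefficients contain 1, 1, 1, 1 or 1, 1, 2, 4 or 1, 2, 2, 3; the exceptions are 1,
    1, 3, 3 and 1, 1, 3, 5 and 1, 1, 3, 6 and 1, 2, 4, 8, which have tests of their own. *)
Lemma augments_1111 : augments [:: 1; 1; 1; 1; 1]%N 4.
Proof. aug [:: 1; 1; 1; 1; 1]%N (test1111 1) 1%N 4%N 1%N 10%N (@test1111P 1%N) (@test1111S 1). Qed.
Lemma augments_1112 : augments [:: 4; 1; 1; 1; 2]%N 5.
Proof. aug [:: 1; 1; 1; 2; 4]%N (test1124 1) 1%N 5%N 2%N 10%N (@test1124P 1%N) (@test1124S 1). Qed.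
Lemma augments_1113 : augments [:: 1; 1; 1; 1; 3]%N 6.
Proof. aug [:: 3; 1; 1; 1; 1]%N (test1111 3) 1%N 6%N 1%N 10%N (@test1111P 3%N) (@test1111S 3). Qed.
Lemma augments_1114 : augments [:: 2; 1; 1; 1; 4]%N 7.
Proof. aug [:: 1; 1; 1; 2; 4]%N (test1124 1) 1%N 7%N 2%N 10%N (@test1124P 1%N) (@test1124S 1). Qed.
Lemma augments_1122 : augments [:: 4; 1; 1; 2; 2]%N 6.
Proof. aug [:: 2; 1; 1; 2; 4]%N (test1124 2) 1%N 6%N 2%N 10%N (@test1124P 2%N) (@test1124S 2). Qed.
Lemma augments_1123 : augments [:: 4; 1; 1; 2; 3]%N 7.
Proof. aug [:: 3; 1; 1; 2; 4]%N (test1124 3) 1%N 7%N 2%N 10%N (@test1124P 3%N) (@test1124S 3). Qed.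
Lemma augments_1124 : augments [:: 1; 1; 1; 2; 4]%N 8.
Proof. aug [:: 1; 1; 1; 2; 4]%N (test1124 1) 1%N 8%N 2%N 10%N (@test1124P 1%N) (@test1124S 1). Qed.
Lemma augments_1125 : augments [:: 4; 1; 1; 2; 5]%N 9.
Proof. aug [:: 5; 1; 1; 2; 4]%N (test1124 5) 1%N 9%N 2%N 10%N (@test1124P 5%N) (@test1124S 5). Qed.
Lemma augments_1133 : augments [:: 2; 1; 1; 3; 3]%N 8.
Proof. aug [:: 3; 3; 1; 1; 2]%N test11233 2%N 8%N 16%N 27%N test11233P test11233S. Qed.
Lemma augments_1134 : augments [:: 2; 1; 1; 3; 4]%N 9.
Proof. aug [:: 3; 1; 1; 2; 4]%N (test1124 3) 1%N 9%N 2%N 10%N (@test1124P 3%N) (@test1124S 3). Qed.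
Lemma augments_1135 : augments [:: 2; 1; 1; 3; 5]%N 10.
Proof. aug [:: 5; 3; 1; 1; 2]%N test11235 7%N 10%N 32%N 550%N test11235P test11235S. Qed.
Lemma augments_1136 : augments [:: 2; 1; 1; 3; 6]%N 11.
Proof. aug [:: 6; 3; 1; 1; 2]%N test11236 4%N 11%N 3%N 60%N test11236P test11236S. Qed.
Lemma augments_1222 : augments [:: 3; 1; 2; 2; 2]%N 7.
Proof. aug [:: 2; 1; 2; 2; 3]%N (test1223 2) 1%N 7%N 1%N 10%N (@test1223P 2%N) (@test1223S 2). Qed.
Lemma augments_1223 : augments [:: 1; 1; 2; 2; 3]%N 8.
Proof. aug [:: 1; 1; 2; 2; 3]%N (test1223 1) 1%N 8%N 1%N 10%N (@test1223P 1%N) (@test1223S 1). Qed.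
Lemma augments_1224 : augments [:: 1; 1; 2; 2; 4]%N 9.
Proof. aug [:: 2; 1; 1; 2; 4]%N (test1124 2) 1%N 9%N 2%N 10%N (@test1124P 2%N) (@test1124S 2). Qed.
Lemma augments_1225 : augments [:: 3; 1; 2; 2; 5]%N 10.
Proof. aug [:: 5; 1; 2; 2; 3]%N (test1223 5) 1%N 10%N 1%N 10%N (@test1223P 5%N) (@test1223S 5). Qed.
Lemma augments_1226 : augments [:: 3; 1; 2; 2; 6]%N 11.
Proof. aug [:: 6; 1; 2; 2; 3]%N (test1223 6) 1%N 11%N 1%N 10%N (@test1223P 6%N) (@test1223S 6). Qed.
Lemma augments_1233 : augments [:: 2; 1; 2; 3; 3]%N 9.
Proof. aug [:: 3; 1; 2; 2; 3]%N (test1223 3) 1%N 9%N 1%N 10%N (@test1223P 3%N) (@test1223S 3). Qed.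
Lemma augments_1234 : augments [:: 1; 1; 2; 3; 4]%N 10.
Proof. aug [:: 3; 1; 1; 2; 4]%N (test1124 3) 1%N 10%N 2%N 10%N (@test1124P 3%N) (@test1124S 3). Qed.
Lemma augments_1235 : augments [:: 2; 1; 2; 3; 5]%N 11.
Proof. aug [:: 5; 1; 2; 2; 3]%N (test1223 5) 1%N 11%N 1%N 10%N (@test1223P 5%N) (@test1223S 5). Qed.
Lemma augments_1236 : augments [:: 2; 1; 2; 3; 6]%N 12.
Proof. aug [:: 6; 1; 2; 2; 3]%N (test1223 6) 1%N 12%N 1%N 10%N (@test1223P 6%N) (@test1223S 6). Qed.
Lemma augments_1237 : augments [:: 2; 1; 2; 3; 7]%N 13.
Proof. aug [:: 7; 1; 2; 2; 3]%N (test1223 7) 1%N 13%N 1%N 10%N (@test1223P 7%N) (@test1223S 7). Qed.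
Lemma augments_1244 : augments [:: 1; 1; 2; 4; 4]%N 11.
Proof. aug [:: 4; 1; 1; 2; 4]%N (test1124 4) 1%N 11%N 2%N 10%N (@test1124P 4%N) (@test1124S 4). Qed.
Lemma augments_1245 : augments [:: 1; 1; 2; 4; 5]%N 12.
Proof. aug [:: 5; 1; 1; 2; 4]%N (test1124 5) 1%N 12%N 2%N 10%N (@test1124P 5%N) (@test1124S 5). Qed.
Lemma augments_1246 : augments [:: 1; 1; 2; 4; 6]%N 13.
Proof. aug [:: 6; 1; 1; 2; 4]%N (test1124 6) 1%N 13%N 2%N 10%N (@test1124P 6%N) (@test1124S 6). Qed.
Lemma augments_1247 : augments [:: 1; 1; 2; 4; 7]%N 14.
Proof. aug [:: 7; 1; 1; 2; 4]%N (test1124 7) 1%N 14%N 2%N 10%N (@test1124P 7%N) (@test1124S 7). Qed.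
Lemma augments_1248 : augments [:: 2; 1; 2; 4; 8]%N 15.
Proof. aug [:: 1; 2; 2; 4; 8]%N test12248 4%N 15%N 4%N 9%N test12248P test12248S. Qed.

(** The upper bounds say that each entry exceeds the sum of its predecessors by at most 1. *)
Lemma augments_exists a2 a3 a4 : (1 <= a2 <= 2)%N -> (a2 <= a3 <= a2 + 2)%N ->
  (a3 <= a4 <= a2 + a3 + 2)%N ->
  exists b, (0 < b)%N /\ augments [:: b; 1; a2; a3; a4]%N (Z.of_nat (1 + a2 + a3 + a4)).
Proof.
case: a2 => [|[|[|a2]]] //= _; case: a3 => [|[|[|[|[|a3]]]]] //= _;
  case: a4 => [|[|[|[|[|[|[|[|[|a4]]]]]]]]] //= _.
all: eexists; split; last first.
all: try first [ exact: augments_1111 | exact: augments_1112 | exact: augments_1113 | exact: augments_1114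
  | exact: augments_1122 | exact: augments_1123 | exact: augments_1124 | exact: augments_1125 | exact: augments_1133
  | exact: augments_1134 | exact: augments_1135 | exact: augments_1136 | exact: augments_1222 | exact: augments_1223
  | exact: augments_1224 | exact: augments_1225 | exact: augments_1226 | exact: augments_1233 | exact: augments_1234
  | exact: augments_1235 | exact: augments_1236 | exact: augments_1237 | exact: augments_1244 | exact: augments_1245
  | exact: augments_1246 | exact: augments_1247 | exact: augments_1248 ].
all: by [].
Qed.
End Quads.

(** * Completing forms *)

Section SubsetSums.
Local Open Scope Z_scope.

Definition gonal_rep (mu : Z) (c : seq nat) (N : Z) : Prop :=
  exists r Q, rep c r (2 * Q + r) /\ N = mu * Q + r.

Lemma rep_consE k c r A : rep (k :: c) r A =
  exists x, rep c (r - Z.of_nat k * x) (A - Z.of_nat k * (x * x)).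
Proof. by []. Qed.

Fixpoint subset_sum (c : seq nat) (N : Z) : Prop :=
  if c is k :: c' then subset_sum c' N \/ subset_sum c' (N - Z.of_nat k) else N = 0.

Lemma subset_sum_rep c N : subset_sum c N -> rep c N N.
Proof.
elim: c N => [|k c IH] N //= [/IH h|/IH h].
  by exists 0; rewrite !Z.mul_0_r !Z.sub_0_r.
by exists 1; rewrite !Z.mul_1_r.
Qed.

Lemma subset_sum0 c : subset_sum c 0.
Proof. by elim: c => [|k c IH] //=; left. Qed.

Lemma subset_sum_bounds c N : subset_sum c N -> 0 <= N <= Z.of_nat (sumn c).
Proof. by elim: c N => [|k c IH] N /=; [|case=> /IH]; lia. Qed.

Lemma subset_sum_cat s t N : subset_sum (s ++ t) N ->
  exists N1 N2, [/\ subset_sum s N1, subset_sum t N2 & N = N1 + N2].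
Proof.
elim: s N => [|k s IH] N; first by exists 0, N.
rewrite /=; case=> /IH[N1 [N2 [h1 h2 e]]]; [exists N1, N2|exists (N1 + Z.of_nat k), N2]; split=> //; try lia.
  by left.
by right; rewrite Z.add_simpl_r.
Qed.

Lemma subset_sum_min k c N : all (leq k) c -> subset_sum c N -> 0 < N -> Z.of_nat k <= N.
Proof.
elim: c N => [|j c IH] N /=; first by lia.
case/andP=> kj /IH{}IH [/IH //|h N0].
by have := subset_sum_bounds h; lia.
Qed.

Lemma triangular x : exists t, x * x = 2 * t + x.
Proof.
have [[k ->]|[k ->]] := parity x; first by exists (2 * k * k - k); ring.
by exists (2 * k * k + k); ring.
Qed.

(** Here [mu * t + x] is [P_m x]; the bound [mu - 1 = m - 3] is attained at [x = -1]. *)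
Lemma gonal_bound mu x t : 1 < mu -> x * x = 2 * t + x -> [\/ x = 0, x = 1 | mu - 1 <= mu * t + x].
Proof.
move=> mu1 e; have [->|x0] := Z.eq_dec x 0; first by apply: Or31.
have [->|x1] := Z.eq_dec x 1; first by apply: Or32.
apply: Or33.
have t1 : 1 <= t by nia.
have tx : - t <= x by nia.
have : 0 <= (mu - 1) * (t - 1) by apply: Z.mul_nonneg_nonneg; lia.
clear -tx; nia.
Qed.

Lemma rep_gonal_ge0 mu c r Q : 1 < mu -> rep c r (2 * Q + r) -> 0 <= mu * Q + r.
Proof.
move=> mu1; elim: c r Q => [|k c IH] r Q.
  case=> -> e; have Q0 : Q = 0 by lia.
  by rewrite Q0; lia.
rewrite rep_consE => -[x]; have [t e] := triangular x.
have -> : 2 * Q + r - Z.of_nat k * (x * x)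
  = 2 * (Q - Z.of_nat k * t) + (r - Z.of_nat k * x) by rewrite e; ring.
move/IH; have : 0 <= Z.of_nat k * (mu * t + x).
  apply: Z.mul_nonneg_nonneg; first by lia.
  case: (gonal_bound mu1 e) => [x0|x1|]; last by lia.
    have t0 : t = 0 by subst; lia.
    by rewrite t0 x0; lia.
  have t0 : t = 0 by subst; lia.
  by rewrite t0 x1; lia.
by lia.
Qed.

(* Outside x = 0, 1 an m-gonal number is at least m - 3, so only the coefficients themselves can
   be used to represent the numbers up to m - 4. *)
Lemma gonal_rep_subset_sum mu c N : 1 < mu -> all (leq 1) c -> gonal_rep mu c N -> N <= mu - 2 ->
  subset_sum c N.
Proof.
move=> mu1 + [r [Q [+ ->]]]; elim: c r Q => [|k c IH] r Q.
  move=> _ [-> e] _; have Q0 : Q = 0 by lia.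
  by rewrite Q0 Z.mul_0_r.
rewrite rep_consE => /andP[k1 /IH{}IH] [x]; have [t e] := triangular x.
have -> : 2 * Q + r - Z.of_nat k * (x * x)
  = 2 * (Q - Z.of_nat k * t) + (r - Z.of_nat k * x) by rewrite e; ring.
move=> h le; case: (gonal_bound mu1 e) => [x0|x1|big].
- have t0 : t = 0 by subst; lia.
  by subst; left; move: (IH _ _ h); rewrite !Z.mul_0_r !Z.sub_0_r; apply.
- have t0 : t = 0 by subst; lia.
  subst; right; move: (IH _ _ h); rewrite !Z.mul_0_r !Z.sub_0_r !Z.mul_1_r.
  by rewrite -Z.add_sub_assoc; apply; lia.
have := rep_gonal_ge0 mu1 h; nia.
Qed.

(** The number [sumn p + 1] is out of reach of [p] alone, so some entry of [q] takes part, and the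
    least entry of [q] cannot exceed the target. *)
Lemma next_coefficient p q : all (leq 1) q -> sorted leq q ->
  subset_sum (p ++ q) (Z.of_nat (sumn p) + 1) ->
  exists k q', [/\ q = k :: q', (1 <= k)%N & (k <= sumn p + 1)%N].
Proof.
move=> q1 qs /subset_sum_cat[N1 [N2 [/subset_sum_bounds h1 h2 e]]].
case: q => [|k q] in q1 qs h2 *; first by move: h2 => /=; lia.
have le : Z.of_nat k <= N2.
  apply: subset_sum_min h2 _; last by lia.
  by rewrite /= leqnn; exact: order_path_min leq_trans qs.
by exists k, q; split=> //; [case/andP: q1|lia].
Qed.

Lemma gonal_rep_perm mu c c' N : perm_eq c c' -> gonal_rep mu c N -> gonal_rep mu c' N.
Proof. by move=> cc' [r [Q [h e]]]; exists r, Q; split=> //; exact: rep_perm h. Qed.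

Lemma gonal_rep_cat mu s t r Q T : rep s r (2 * Q + r) -> subset_sum t T ->
  gonal_rep mu (s ++ t) (mu * Q + r + T).
Proof.
move=> hs /subset_sum_rep ht; exists (r + T), Q; split; last by ring.
apply/rep_cat; exists r, (2 * Q + r); split=> //.
have -> : r + T - r = T by ring.
by have -> : 2 * Q + (r + T) - (2 * Q + r) = T by ring.
Qed.

(** For a residue [B] other than 0, it is [B - 1] that is written as a subset sum: the share [N1] of
    [q] then gives [r = N1 + 1], between 1 and [sumn q + 1], which avoids the exceptional
    [r = 0]. *)
Lemma universal_of_augments mu q b t : 1 < mu ->
  (forall N, 0 <= N <= mu - 2 -> subset_sum (q ++ t) N) ->
  augments (b :: q) (Z.of_nat (sumn q)) ->
  forall N, 0 < N -> gonal_rep mu (b :: q ++ t) N.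
Proof.
move=> mu1 cover [aug0 aug1] N N0; rewrite -cat_cons.
have eN : N = mu * (N / mu) + N mod mu by apply: Z.div_mod; lia.
have k0 : 0 <= N / mu by apply: Z.div_pos; lia.
have [B0 Bmu] : 0 <= N mod mu < mu by apply: Z.mod_pos_bound; lia.
set k := N / mu in eN k0; set B := N mod mu in eN B0 Bmu.
have [Bz|Bnz] := Z.eq_dec B 0; last first.
  have [|N1 [T [/subset_sum_bounds h1 hT e]]] := subset_sum_cat (cover (B - 1) _); first by lia.
  have -> : N = mu * k + (N1 + 1) + T by lia.
  by apply: gonal_rep_cat hT; apply: aug0; lia.
(* For [B = 0] one multiple of [mu] is traded for [N1 + 2 + T]. Only [N1 = sumn q] makes [r] too
   large, and there the second clause of [augments] decides between [r = 0] and [r = sumn q + 2]. *)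
have k1 : 1 <= k by nia.
have [|N1 [T [/subset_sum_bounds h1 hT e]]] := subset_sum_cat (cover (mu - 2) _); first by lia.
have eN' : N = mu * (k - 1) + (N1 + 2) + T by lia.
have [lt|ge] := Z_lt_ge_dec N1 (Z.of_nat (sumn q)).
  by rewrite eN'; apply: gonal_rep_cat hT; apply: aug0; lia.
have e1 : N1 = Z.of_nat (sumn q) by lia.
case: (aug1 k k1) => h; last by rewrite eN' e1; apply: gonal_rep_cat hT.
have -> : N = mu * k + 0 + 0 by lia.
by apply: gonal_rep_cat; [rewrite Z.add_0_r|exact: subset_sum0].
Qed.
End SubsetSums.

(** * Completions in the different ranges of m *)

Section Completions.
Local Open Scope Z_scope.

Lemma sorted_cover mu c : 1 < mu -> all (leq 1) c ->
  (forall N, 0 < N <= mu - 2 -> gonal_rep mu c N) ->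
  exists s, [/\ perm_eq s c, sorted leq s, all (leq 1) s &
    forall N, 0 <= N <= mu - 2 -> subset_sum s N].
Proof.
move=> mu1 c1 repc; exists (sort leq c).
have pc : perm_eq (sort leq c) c by rewrite perm_sort.
split=> //; first exact: sort_sorted leq_total c.
  by rewrite all_sort.
move=> N [N0 Nmu]; have [->|Nnz] := Z.eq_dec N 0; first exact: subset_sum0.
apply: (gonal_rep_subset_sum mu1 _ _ Nmu); first by rewrite all_sort.
by apply: gonal_rep_perm (repc N _); [rewrite perm_sym|lia].
Qed.

(** A further coefficient is forced as long as 1 plus the sum so far is at most [mu - 2]. The sums
    of the first 0, 1, 2, 3 coefficients are at most 0, 1, 3, 7, whence the bounds 3, 4, 6, 10 on
    [mu] here and in the next three lemmas. *)
Lemma cover_first s mu : 3 <= mu -> sorted leq s -> all (leq 1) s ->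
  (forall N, 0 <= N <= mu - 2 -> subset_sum s N) -> exists t, s = (1 :: t)%N.
Proof.
move=> mu3 ss s1 cover; have [//|//||k [t [es k1 k2]]] := @next_coefficient [::] s.
  by apply: cover => /=; lia.
by exists t; rewrite es; congr cons; move: k2 => /=; lia.
Qed.

Lemma cover_second t mu : 4 <= mu -> sorted leq (1 :: t)%N -> all (leq 1) (1 :: t)%N ->
  (forall N, 0 <= N <= mu - 2 -> subset_sum (1 :: t)%N N) ->
  exists a2 u, t = a2 :: u /\ (1 <= a2 <= 2)%N.
Proof.
move=> mu4 ss s1 cover; have [|||k [u [et k1 k2]]] := @next_coefficient [:: 1%N] t.
- by case/andP: s1.
- exact: path_sorted ss.
- by apply: cover => /=; lia.
by exists k, u; split=> //; apply/andP.
Qed.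

Lemma cover_third a2 u mu : 6 <= mu -> (1 <= a2 <= 2)%N ->
  sorted leq [:: 1, a2 & u]%N -> all (leq 1) [:: 1, a2 & u]%N ->
  (forall N, 0 <= N <= mu - 2 -> subset_sum [:: 1, a2 & u]%N N) ->
  exists a3 v, u = a3 :: v /\ (a2 <= a3 <= a2 + 2)%N.
Proof.
move=> mu6 a2_ ss s1 cover; have [|||k [v [eu k1 k2]]] := @next_coefficient [:: 1; a2]%N u.
- by case/and3P: s1.
- by case/andP: ss => _; apply: path_sorted.
- by apply: cover => /=; lia.
exists k, v; split=> //; move: ss k2; rewrite eu /= => /and3P[_ h _]; lia.
Qed.

Lemma cover_fourth a2 a3 v mu : 10 <= mu -> (1 <= a2 <= 2)%N -> (a2 <= a3 <= a2 + 2)%N ->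
  sorted leq [:: 1, a2, a3 & v]%N -> all (leq 1) [:: 1, a2, a3 & v]%N ->
  (forall N, 0 <= N <= mu - 2 -> subset_sum [:: 1, a2, a3 & v]%N N) ->
  exists a4 w, v = a4 :: w /\ (a3 <= a4 <= a2 + a3 + 2)%N.
Proof.
move=> mu10 a2_ a3_ ss s1 cover.
have [|||k [w [ev k1 k2]]] := @next_coefficient [:: 1; a2; a3]%N v.
- by case/and4P: s1.
- by case/and3P: ss => _ _; apply: path_sorted.
- by apply: cover => /=; lia.
exists k, w; split=> //; move: ss k2; rewrite ev /= => /and4P[_ _ h _]; lia.
Qed.

Lemma one_completion_large mu c : 10 <= mu -> all (leq 1) c ->
  (forall N, 0 < N <= mu - 2 -> gonal_rep mu c N) ->
  exists b, (0 < b)%N /\ forall N, 0 < N -> gonal_rep mu (b :: c) N.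
Proof.
move=> mu10 c1 repc; have mu1 : 1 < mu by lia.
have [s [pc ss s1 cover]] := sorted_cover mu1 c1 repc.
have [|t et] := cover_first _ ss s1 cover; [by lia|subst s].
have [|a2 [u [et a2_]]] := cover_second _ ss s1 cover; [by lia|subst t].
have [|a3 [v [eu a3_]]] := cover_third _ a2_ ss s1 cover; [by lia|subst u].
have [//|a4 [w [ev a4_]]] := cover_fourth _ a2_ a3_ ss s1 cover; subst v.
have [b [b0 aug]] := augments_exists a2_ a3_ a4_; exists b; split=> // N N0.
apply: (@gonal_rep_perm _ (b :: [:: 1; a2; a3; a4]%N ++ w)); first by rewrite perm_cons.
apply: (@universal_of_augments mu [:: 1; a2; a3; a4]%N b w mu1 cover _ N N0).
by rewrite /= addn0 !addnA in aug *.
Qed.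

(** The three coefficients forced by [mu >= 6] become one of the quadruples when a further 1 is
    added. *)
Lemma two_completions_large mu c : 6 <= mu -> all (leq 1) c ->
  (forall N, 0 < N <= mu - 2 -> gonal_rep mu c N) ->
  exists b, (0 < b)%N /\ forall N, 0 < N -> gonal_rep mu [:: b, 1%N & c] N.
Proof.
move=> mu6 c1 repc; have mu1 : 1 < mu by lia.
have [s [pc ss s1 cover]] := sorted_cover mu1 c1 repc.
have [|t et] := cover_first _ ss s1 cover; [by lia|subst s].
have [|a2 [u [et a2_]]] := cover_second _ ss s1 cover; [by lia|subst t].
have [//|a3 [v [eu a3_]]] := cover_third _ a2_ ss s1 cover; subst u.
have [||| b [b0 aug]] := @augments_exists 1 a2 a3; [by []|by lia|by lia|].
exists b; split=> // N N0.
apply: (@gonal_rep_perm _ (b :: [:: 1; 1; a2; a3]%N ++ v)); first by rewrite !perm_cons.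
apply: (@universal_of_augments mu [:: 1; 1; a2; a3]%N b v mu1 _ _ N N0) => [M HM|].
  by left; apply: cover.
by rewrite /= addn0 !addnA in aug *.
Qed.

Lemma gonal_rep_catr mu s t N : gonal_rep mu s N -> gonal_rep mu (s ++ t) N.
Proof.
by case=> r [Q [h ->]]; rewrite -[_ + r]Z.add_0_r; apply: gonal_rep_cat h (subset_sum0 t).
Qed.

(** The residues modulo 5 are represented by 5, 1, 2, 3 and -1, none of them divisible by 4, so that
    [rep_1124] applies; -1 replaces 4 and comes with [Q >= 1]. *)
Lemma heptagonal_1124 N : 0 < N -> gonal_rep 5 [:: 1; 1; 2; 4]%N N.
Proof.
have rep' r Q : 0 <= 16 * Q + 8 * r - r * r -> r mod 4 <> 0 -> N = 5 * Q + r ->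
    gonal_rep 5 [:: 1; 1; 2; 4]%N N.
  by move=> h1 h2 ->; exists r, Q; split=> //; apply: rep_1124; [lia|lia|left].
move=> N0; have [h|[h|[h|[h|h]]]] : N mod 5 = 0 \/ N mod 5 = 1 \/ N mod 5 = 2 \/ N mod 5 = 3
  \/ N mod 5 = 4 by lia.
- by apply: (rep' 5 (N / 5 - 1)); lia.
- by apply: (rep' 1 (N / 5)); lia.
- by apply: (rep' 2 (N / 5)); lia.
- by apply: (rep' 3 (N / 5)); lia.
by apply: (rep' (- 1) (N / 5 + 1)); lia.
Qed.

Lemma gonal_rep_112 mu x y z t u v N : x * x = 2 * t + x -> y * y = 2 * u + y ->
  z * z = 2 * v + z -> N = mu * (t + u + 2 * v) + (x + y + 2 * z) ->
  gonal_rep mu [:: 1; 1; 2]%N N.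
Proof.
move=> ex ey ez e; exists (x + y + 2 * z), (t + u + 2 * v); split=> //.
by exists x, y, z; split; lia.
Qed.

(** As [P_6 x = ((4 x - 1) ^ 2 - 1) / 8], it suffices to write [8 N + 4] as
    [X ^ 2 + Y ^ 2 + 2 Z ^ 2] with odd entries. This is twice a representation of [4 N + 2] by three
    squares, [X] and [Y] being the sum and the difference of an odd and the even root. *)
Lemma hexagonal_112 N : 0 < N -> gonal_rep 4 [:: 1; 1; 2]%N N.
Proof.
move=> N0; have [||a [b [c e]]] := @three_squares_2mod4 (4 * N + 2); try lia.
have [||X [x [sX eX]]] := @sign_mod4 (2 * a + 1 + 2 * c) (- 1); try lia.
have [||Y [y [sY eY]]] := @sign_mod4 (2 * a + 1 - 2 * c) (- 1); try lia.
have [||Z [z [sZ eZ]]] := @sign_mod4 (2 * b + 1) (- 1); try lia.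
have [t et] := triangular x; have [u eu] := triangular y; have [v ev] := triangular z.
apply: (gonal_rep_112 et eu ev).
have : X * X + Y * Y + 2 * (Z * Z) = 8 * N + 4 by rewrite sX sY sZ; lia.
by rewrite eX eY eZ; lia.
Qed.

Lemma sign_mod6 x : x mod 2 = 1 -> x mod 3 <> 0 -> exists k, x * x = (6 * k - 1) * (6 * k - 1).
Proof.
move=> x2 x3; have [h|h] : x mod 6 = 1 \/ x mod 6 = 5 by lia.
  have [k ->] : exists k, x = 6 * k + 1 by exists (x / 6); lia.
  by exists (- k); ring.
by exists ((x + 1) / 6); have {1 2}-> : x = 6 * ((x + 1) / 6) - 1 by lia.
Qed.

Lemma odd_odd_even_mod3 n : 0 < n -> n mod 12 = 2 -> exists p q w,
  [/\ n = p * p + q * q + w * w, p mod 2 = 1, q mod 2 = 1, w mod 2 = 0 & p mod 3 <> 0].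
Proof.
move=> n0 n12; have [|a [b [c e]]] := three_squares_2mod4 n0; first by lia.
have [h|h] := Z.eq_dec ((2 * a + 1) mod 3) 0; last first.
  by exists (2 * a + 1), (2 * b + 1), (2 * c); split; lia.
exists (2 * b + 1), (2 * a + 1), (2 * c); split; try lia.
move=> h'; case: (square_mod3 (2 * a + 1)) => -[g1 [i1 e1]]; last by lia.
case: (square_mod3 (2 * b + 1)) => -[g2 [i2 e2]]; last by lia.
by case: (square_mod3 (2 * c)) => -[g3 [i3 e3]]; lia.
Qed.

(** As [P_5 x = ((6 x - 1) ^ 2 - 1) / 24], it suffices to write [24 N + 4] as
    [X ^ 2 + Y ^ 2 + 2 Z ^ 2] with entries prime to 6; these are [q + w], [q - w] and [p]. *)
Lemma pentagonal_112 N : 0 < N -> gonal_rep 3 [:: 1; 1; 2]%N N.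
Proof.
move=> N0; have [||p [q [w [e p2 q2 w2 p3]]]] := @odd_odd_even_mod3 (12 * N + 2); try lia.
(* The squares add up to 2 modulo 3 and [p] is prime to 3, so exactly one of [q] and [w] is
   divisible by 3. *)
have qw3 : (q + w) mod 3 <> 0 /\ (q - w) mod 3 <> 0.
  case: (square_mod3 p) => -[g1 [i1 e1]]; first by lia.
  case: (square_mod3 q) => -[g2 [i2 e2]]; case: (square_mod3 w) => -[g3 [i3 e3]]; lia.
have [||x ex] := @sign_mod6 (q + w); try lia.
have [||y ey] := @sign_mod6 (q - w); try lia.
have [||z ez] := @sign_mod6 p; try lia.
have [t et] := triangular x; have [u eu] := triangular y; have [v ev] := triangular z.
by apply: (gonal_rep_112 et eu ev); lia.
Qed.

(** The two smallest coefficients are 1, 1 or 1, 2, and [3 - a2] completes them to 1, 1, 2. *)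
Lemma one_completion_hexagonal c : all (leq 1) c ->
  (forall N, 0 < N <= 2 -> gonal_rep 4 c N) ->
  exists b, (0 < b)%N /\ forall N, 0 < N -> gonal_rep 4 (b :: c) N.
Proof.
move=> c1 repc; have [s [pc ss s1 cover]] := @sorted_cover 4 c erefl c1 repc.
have [|t et] := cover_first _ ss s1 cover; [by lia|subst s].
have [|a2 [u [et a2_]]] := cover_second _ ss s1 cover; [by lia|subst t].
exists (3 - a2)%N; split=> [|N N0]; first by lia.
apply: (@gonal_rep_perm _ ([:: 3 - a2; 1; a2]%N ++ u)); first by rewrite /= perm_cons.
apply: gonal_rep_catr; apply: gonal_rep_perm (hexagonal_112 N0).
by have [->|->] : a2 = 1%N \/ a2 = 2%N by lia.
Qed.

Lemma two_completions_heptagonal c : all (leq 1) c ->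
  (forall N, 0 < N <= 3 -> gonal_rep 5 c N) ->
  exists b d, [/\ (0 < b)%N, (0 < d)%N & forall N, 0 < N -> gonal_rep 5 [:: b, d & c] N].
Proof.
move=> c1 repc; have [s [pc ss s1 cover]] := @sorted_cover 5 c erefl c1 repc.
have [|t et] := cover_first _ ss s1 cover; [by lia|subst s].
have [|a2 [u [et a2_]]] := cover_second _ ss s1 cover; [by lia|subst t].
exists (3 - a2)%N, 4%N; split=> [||N N0] //; first by lia.
apply: (@gonal_rep_perm _ ([:: 3 - a2; 4; 1; a2]%N ++ u)); first by rewrite /= !perm_cons.
apply: gonal_rep_catr; apply: gonal_rep_perm (heptagonal_1124 N0).
by have [->|->] : a2 = 1%N \/ a2 = 2%N by lia.
Qed.

Lemma two_completions_pentagonal c : all (leq 1) c ->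
  (forall N, 0 < N <= 1 -> gonal_rep 3 c N) ->
  forall N, 0 < N -> gonal_rep 3 [:: 1%N, 2%N & c] N.
Proof.
move=> c1 repc N N0; have [s [pc ss s1 cover]] := @sorted_cover 3 c erefl c1 repc.
have [|t et] := cover_first _ ss s1 cover; [by lia|subst s].
apply: (@gonal_rep_perm _ ([:: 1; 2; 1]%N ++ t)); first by rewrite /= !perm_cons.
apply: gonal_rep_catr; exact: gonal_rep_perm (pentagonal_112 N0).
Qed.
End Completions.

(** * Translation to m-gonal forms *)

Section IntForms.
Local Open Scope Z_scope.

Lemma mgonal_triangular m x t : Z_of_int x * Z_of_int x = 2 * t + Z_of_int x ->
  Z_of_int (mgonal m x) = (Z_of_int m - 2) * t + Z_of_int x.
Proof.
move=> e; have -> : mgonal m x = (int_of_Z ((Z_of_int m - 2) * t + Z_of_int x) * 2 %/ 2)%Z.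
  by rewrite /mgonal; congr divz; rewrite expr2; lia.
by rewrite mulzK // int_of_ZK.
Qed.

Lemma representsP m n (a : n.-tuple nat) N :
  represents m a N <-> gonal_rep (Z_of_int m - 2) a (Z_of_int N).
Proof.
elim: n a N => [|n IH] a N.
  rewrite tuple0; split=> [[x <-]|[r [Q [[-> e] eN]]]].
    by exists 0, 0; rewrite /mgonal_form big_ord0; split; [split|lia].
  exists [tuple]; rewrite /mgonal_form big_ord0.
  have Q0 : Q = 0 by lia.
  by rewrite Q0 in eN; lia.
case/tupleP: a => k a; have form_cons x0 (x : n.-tuple int) :
    mgonal_form m [tuple of k :: a] [tuple of x0 :: x]
      = (k%:Z * mgonal m x0 + mgonal_form m a x)%R.
  rewrite /mgonal_form big_ord_recl !tnth0; congr +%R.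
  by apply: eq_bigr => i _; rewrite !tnthS.
split=> [[x0x]|[r [Q [+ eN]]]].
  case/tupleP: x0x => x0 x; rewrite form_cons => eN.
  have [|r [Q [h e]]] := (IH a (N - k%:Z * mgonal m x0)%R).1; first by exists x; lia.
  have [t et] := triangular (Z_of_int x0); have em := mgonal_triangular m et.
  exists (r + Z.of_nat k * Z_of_int x0), (Q + Z.of_nat k * t); split; last by lia.
  rewrite rep_consE; exists (Z_of_int x0); rewrite et Z.add_simpl_r.
  by move: h; congr rep; ring.
rewrite rep_consE => -[x]; have [t et] := triangular x.
have ex : Z_of_int (int_of_Z x) = x by exact: int_of_ZK.
have em : Z_of_int (mgonal m (int_of_Z x)) = (Z_of_int m - 2) * t + x.
  by rewrite -{2}ex; apply: mgonal_triangular; rewrite ex.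
have -> : 2 * Q + r - Z.of_nat k * (x * x)
  = 2 * (Q - Z.of_nat k * t) + (r - Z.of_nat k * x) by rewrite et; ring.
move=> h; have [|y ey] := (IH a (N - k%:Z * mgonal m (int_of_Z x))%R).2.
  by exists (r - Z.of_nat k * x), (Q - Z.of_nat k * t); split=> //; lia.
by exists [tuple of int_of_Z x :: y]; rewrite form_cons ey; lia.
Qed.

Lemma positive_coefs_all n (a : n.-tuple nat) : positive_coefs a -> all (leq 1) a.
Proof. by move=> a0; apply/allP => k /tnthP[i ->]; exact: a0. Qed.

Lemma represents_small m n (a : n.-tuple nat) :
  (forall N : int, (0 < N)%R -> (N <= m - 4)%R -> represents m a N) ->
  forall N, 0 < N <= Z_of_int m - 2 - 2 -> gonal_rep (Z_of_int m - 2) a N.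
Proof.
move=> h N N0; have eN : Z_of_int (int_of_Z N) = N by exact: int_of_ZK.
by rewrite -eN; apply/representsP; apply: h; lia.
Qed.

Lemma universal_perm m n (a : n.-tuple nat) c : perm_eq c a ->
  (forall N, 0 < N -> gonal_rep (Z_of_int m - 2) c N) -> universal m a.
Proof.
by move=> ca h N N0; apply/representsP; apply: gonal_rep_perm ca _; apply: h; lia.
Qed.
End IntForms.

Theorem theorem1p2 :
  (forall (m : int) (n : nat) (a : n.-tuple nat),
     m = 6 \/ 12 <= m ->
     positive_coefs a ->
     (forall N : int, 0 < N -> N <= m - 4 -> represents m a N) ->
     exists b : nat, (0 < b)%N /\ universal m [tuple of rcons a b])
  /\
  (forall (m : int) (n : nat) (a : n.-tuple nat),
     m \in [:: 5; 7; 8; 9; 10; 11] ->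
     positive_coefs a ->
     (forall N : int, 0 < N -> N <= m - 4 -> represents m a N) ->
     exists b c : nat,
       [/\ (0 < b)%N, (0 < c)%N &
           universal m [tuple of rcons (rcons a b) c]]).
Proof.
have perm1 (s : seq nat) b : perm_eq (b :: s) (rcons s b) by rewrite perm_sym perm_rcons.
have perm2 (s : seq nat) b c : perm_eq [:: c, b & s] (rcons (rcons s b) c).
  by rewrite perm_sym perm_rcons perm_cons perm_rcons.
split=> m n a mE /positive_coefs_all a1 /represents_small small.
  case: mE => [m6|m12].
    subst m; have [b [b0 ub]] := one_completion_hexagonal a1 small.
    by exists b; split=> //; apply: universal_perm (perm1 _ _) _.
  have [|b [b0 ub]] := one_completion_large _ a1 small; first by lia.
  by exists b; split=> //; apply: universal_perm (perm1 _ _) _.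
have [m8|] : (8 <= m) \/ (m = 5 \/ m = 7).
  by move: mE; rewrite !inE => /or4P[| | |/or3P[]] /eqP ->; auto.
  have [|b [b0 ub]] := two_completions_large _ a1 small; first by lia.
  by exists 1%N, b; split=> //; apply: universal_perm (perm2 _ _ _) _.
case=> em; subst m.
  exists 2%N, 1%N; split=> //; apply: universal_perm (perm2 _ _ _) _.
  exact: two_completions_pentagonal.
have [b [d [b0 d0 ub]]] := two_completions_heptagonal a1 small.
by exists d, b; split=> //; apply: universal_perm (perm2 _ _ _) _.
Qed.
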